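(* Let $(Z,d,\nu)$ be a complete doubling metric measure space with uniformized hyperbolic filling $X_\rho$ (parameters $\alpha,\tau$). Suppose that $\nu$ has relative lower volume decay of order $Q>0$ and that $\nu$ satisfies the reverse-doubling condition. Let $p\ge1$ and $0<\theta<1$ be such that $p\theta<Q$, set $Q_*=Qp/(Q-p\theta)$, and equip $\bar X_\rho$ with $\mu_\beta$, $\beta=p(1-\theta)$. Let $f\in\tilde B^\theta_p(Z)$ and let $g:\bar X_\rho\to[0,\infty]$ be a Borel function that is a $p$-integrable $p$-weak upper gradient of some function $u\in\tilde D^{1,p}(\bar X_\rho)$ such that $u|_Z=f$ $\nu$-a.e. Then for any ball $B\subset Z$, $$\left(\frac1{\nu(B)}\int_B|f-u_{\hat B}|^{Q_*}\,d\nu\right)^{1/Q_*}\le C\,\operatorname{diam}(B)\left(\frac1{\mu_\beta(2\hat B)}\int_{2\hat B}g^p\,d\mu_\beta\right)^{1/p},$$ where $u_{\hat B}$ is the mean of $u$ over $\hat B$ with respect to $\mu_\beta$ and $C$ depends only on the constants and exponents in the relative lower volume decay and reverse-doubling conditions, on $\alpha$, $\tau$, and on $p$ and $\theta$.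
   Context: **Metric measure spaces.** A metric measure space is a metric space with a Borel regular measure giving every ball positive finite measure. Balls are open and carry a specified center and radius; $cB$ is the concentric ball with radius multiplied by $c$. $(Z,d,\nu)$ is doubling: $\nu(2B)\le C_\nu\,\nu(B)$ for all balls $B$. **Volume conditions.** Relative lower volume decay of order $Q$: there is $C_{\rm low}\ge1$ with $\frac{\nu(B(z,r'))}{\nu(B(z,r))}\ge C_{\rm low}^{-1}\left(\frac{r'}{r}\right)^Q$ for all $z\in Z$, $0<r'\le r$. Reverse-doubling condition: there are $\eta>0$, $C_{\rm rev}\ge1$ with $\frac{\nu(B(z,r'))}{\nu(B(z,r))}\le C_{\rm rev}\left(\frac{r'}{r}\right)^\eta$ for all $z\in Z$, $0<r'\le r$. **Hyperbolic filling.** Fix $\alpha>1$ and $\tau>\max\{3,\alpha/(\alpha-1)\}$. For each $n\in\mathbb Z$ choose a maximal $\alpha^{-n}$-separated set $S_n\subset Z$ (distinct points at distance $\ge\alpha^{-n}$). Put $V_n=\{(z,n):z\in S_n\}$, $V=\bigcup_n V_n$, $\pi(z,n)=z$, $h(z,n)=n$, and $B(v)=B_Z(\pi(v),\tau\alpha^{-h(v)})$. Distinct vertices $v,w$ are joined by an edge ($v\sim w$) iff $|h(v)-h(w)|\le 1$ and $B(v)\cap B(w)\ne\emptyset$. $X$ is the resulting (connected) metric graph with unit-length edges; $h$ is extended linearly to edges. **Uniformization.** $\rho(x)=\alpha^{-h(x)}$, $d_\rho(x,y)=\inf_\gamma\int_\gamma\rho\,ds$ over curves in $X$ from $x$ to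 $y$; $X_\rho=(X,d_\rho)$, $\bar X_\rho$ its completion, $\partial X_\rho=\bar X_\rho\setminus X_\rho$. There is a canonical biLipschitz identification (constant depending on $\alpha,\tau$) of $Z$ with $\partial X_\rho$: $z\in Z$ corresponds to $\lim_{n\to\infty}v_n$ in $\bar X_\rho$ for any $v_n\in V_n$ with $d(\pi(v_n),z)<\alpha^{-n}$. After this construction the metric of $Z$ is replaced by the biLipschitz equivalent metric induced by $d_\rho$, so that $Z=\partial X_\rho$ isometrically ($S_n$ and $B(v)$ are those coming from the original metric). For a ball $B=B_Z(z,r)$ in $Z$, $\hat B=B_\rho(z,r)$ is the $d_\rho$-ball in $\bar X_\rho$ with the same center and radius. **Measures.** Let $\mathcal L$ be Lebesgue measure on the unit edges of $X$, $\mu(A)=\sum_{v\in V}\sum_{w\sim v}(\nu(B(v))+\nu(B(w)))\,\mathcal L(A\cap vw)$ where $vw$ is the edge from $v$ to $w$, and $d\mu_\beta=\alpha^{-\beta h}\,d\mu$ on $X_\rho$, extended by $\mu_\beta(\partial X_\rho)=0$. **Function spaces.** A Borel $g:Y\to[0,\infty]$ is an upper gradient of $u:Y\to[-\infty,\infty]$ if $|u(x)-u(y)|\le\int_\gamma g\,ds$ for every nonconstant compact rectifiable curve $\gamma$ joining $x,y$ (with $\int_\gamma g\,ds=\infty$ required if $u(x)$ or $u(y)$ is infinite); it is a $p$-weak upper gradient if this holds for all such curves outside a family of zero $p$-modulus. $\tilde D^{1,p}(Y)$ is the space of measurable (pointwise defined) functions having an upper gradient in $L^p(Y)$. $\|u\|_{B^\theta_p(Z)}^p=\int_Z\int_Z\frac{|u(x)-u(y)|^p}{d(x,y)^{p\theta}}\frac{d\nu(x)\,d\nu(y)}{\nu(B(x,d(x,y)))}$;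 $\tilde B^\theta_p(Z)$ is the set of $u$ that are $p$-integrable on every ball with $\|u\|_{B^\theta_p(Z)}<\infty$. *)

(* Defs.v *)
From HB Require Import structures.
From mathcomp Require Import all_boot all_order all_algebra.
From mathcomp Require Import all_classical all_reals all_analysis.
From mathcomp Require Import measurable_realfun.

Set Implicit Arguments.
Unset Strict Implicit.
Unset Printing Implicit Defensive.

Import Order.TTheory GRing.Theory Num.Theory.
Import numFieldNormedType.Exports.

Local Open Scope classical_set_scope.
Local Open Scope ring_scope.

#[short(type="completeMetricType")]
HB.structure Definition CompleteMetric (R : numDomainType) :=
  {T of CompletePseudoMetric R T & Metric R T}.

(** Measures are outer measures, as usual in analysis on metric spaces; the
    associated measurable sets are the Caratheodory-measurable ones. *)
Section outer_measures.
Context {R : realType} {T : pointedType} (m : {outer_measure set T -> \bar R}).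
Local Open Scope ereal_scope.

Definition om_measurable (f : T -> \bar R) :=
  measurable_fun [set: caratheodory_type m] (f : caratheodory_type m -> \bar R).

Definition om_integral (A : set T) (f : T -> \bar R) : \bar R :=
  \int[m : set (caratheodory_type m) -> \bar R]_(x in
    (A : set (caratheodory_type m))) f x.

Definition om_ae (P : T -> Prop) :=
  {ae (m : set (caratheodory_type m) -> \bar R), forall x, P x}.

Definition average (A : set T) (f : T -> \bar R) : \bar R :=
  om_integral A f / m A.

End outer_measures.

Definition borel (T : topologicalType) := g_sigma_algebraType (@open T).

Definition borel_set {T : ptopologicalType} (A : set T) :=
  measurable (A : set (borel T)).

Definition borel_fun {R : realType} {T : ptopologicalType} (f : T -> \bar R) :=
  measurable_fun [set: borel T] (f : borel T -> \bar R).

Definition borel_regular {R : realType} {T : ptopologicalType}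
    (m : {outer_measure set T -> \bar R}) :=
  (forall A, borel_set A -> m.-caratheodory A) /\
  (forall A, exists B, [/\ borel_set B, A `<=` B & m B = m A]).

(** The distance [d] is an explicit argument because several distances on the
    same space are in use. *)
Section metric_notions.
Context {R : realType} {T : Type} (d : T -> T -> R).

Definition dball (x : T) (r : R) : set T := [set y | d x y < r].

Definition diameter (A : set T) : R :=
  sup [set r | exists x y, [/\ A x, A y & r = d x y]].

Definition curve_length (gamma : R -> T) (a b : R) : \bar R :=
  ereal_sup [set (let F := gamma \o nth b (a :: s) in
                  \sum_(0 <= i < size s) d (F i) (F i.+1))%:E
            | s in itv_partition a b].

(** Compact rectifiable curves are taken in their arc-length parametrization;
    [L] is the length of the curve, and [L = 0] is the constant curve. *)
Definition arclength_curve (L : R) (gamma : R -> T) :=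
  0 <= L /\ forall s t, 0 <= s -> s <= t -> t <= L ->
    curve_length gamma s t = (t - s)%:E.

Definition line_integral (L : R) (gamma : R -> T) (g : T -> \bar R) : \bar R :=
  (\int[lebesgue_measure]_(t in `[0%R, L]) g (gamma t))%E.

End metric_notions.

Section volume_conditions.
Context {R : realType} {T : Type}.
Variables (d : T -> T -> R) (m : set T -> \bar R).
Local Open Scope ereal_scope.

Definition balls_positive_finite :=
  forall x r, (0 < r)%R -> 0 < m (dball d x r) < +oo.

Definition doubling := exists C : R,
  forall x r, (0 < r)%R -> m (dball d x (2 * r)) <= C%:E * m (dball d x r).

Definition relative_lower_volume_decay (C Q : R) :=
  forall x r' r, (0 < r')%R -> (r' <= r)%R ->
    (C^-1 * (r' / r) `^ Q)%:E <= m (dball d x r') / m (dball d x r).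

Definition reverse_doubling (C eta : R) :=
  forall x r' r, (0 < r')%R -> (r' <= r)%R ->
    m (dball d x r') / m (dball d x r) <= (C * (r' / r) `^ eta)%:E.

End volume_conditions.

Section upper_gradients.
Context {R : realType} {Y : completeMetricType R}.
Variables (m : {outer_measure set Y -> \bar R}) (p : R).
Local Open Scope ereal_scope.

(** A nonconstant compact rectifiable curve, as a pair (length, arc-length
    parametrization); values outside [0, length] play no role. *)
Definition proper_curve (c : R * (R -> Y)) :=
  (0 < c.1)%R /\ arclength_curve mdist c.1 c.2.

Definition modulus (Gamma : set (R * (R -> Y))) : \bar R :=
  ereal_inf [set om_integral m setT (fun x => rho x `^ p) |
    rho in [set rho : Y -> \bar R | [/\ borel_fun rho, (forall x, 0 <= rho x) &
      forall c, Gamma c -> 1 <= line_integral c.1 c.2 rho]]].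

(** In [\bar R], [`|x - y| = +oo] as soon as [x] or [y] is infinite, including
    [x = y = +oo] and [x = y = -oo], so that the inequality then forces the
    line integral to be infinite. *)
Definition gradient_ineq (u g : Y -> \bar R) (c : R * (R -> Y)) :=
  `|u (c.2 0%R) - u (c.2 c.1)| <= line_integral c.1 c.2 g.

Definition upper_gradient (u g : Y -> \bar R) :=
  [/\ borel_fun g, (forall x, 0 <= g x) &
      forall c, proper_curve c -> gradient_ineq u g c].

Definition weak_upper_gradient (u g : Y -> \bar R) :=
  [/\ borel_fun g, (forall x, 0 <= g x) &
      exists Gamma : set (R * (R -> Y)),
        [/\ Gamma `<=` proper_curve, modulus Gamma = 0 &
          forall c, proper_curve c -> ~ Gamma c -> gradient_ineq u g c]].

Definition p_integrable (A : set Y) (g : Y -> \bar R) :=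
  om_measurable m g /\ om_integral m A (fun x => `|g x| `^ p) < +oo.

Definition dirichlet_space (u : Y -> \bar R) :=
  om_measurable m u /\
  exists g, upper_gradient u g /\ p_integrable setT g.

End upper_gradients.

Section besov.
Context {R : realType} {Z : pointedType}.
Variables (d : Z -> Z -> R) (m : {outer_measure set Z -> \bar R}) (theta p : R).
Local Open Scope ereal_scope.

Definition besov_energy (u : Z -> \bar R) : \bar R :=
  om_integral m setT (fun y => om_integral m setT (fun x =>
    `|u x - u y| `^ p /
      ((d x y `^ (p * theta))%:E * m (dball d x (d x y))))).

Definition besov_space (u : Z -> \bar R) :=
  [/\ om_measurable m u,
      (forall z r, (0 < r)%R ->
         om_integral m (dball d z r) (fun x => `|u x| `^ p) < +oo) &
      besov_energy u < +oo].

End besov.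

Section hyperbolic_filling.
Context {R : realType} {Z : completeMetricType R}.
Variables (alpha tau : R) (S : int -> set Z).

Definition separated (e : R) (A : set Z) :=
  forall x y, A x -> A y -> x != y -> e <= mdist x y.

Definition maximal_separated (e : R) (A : set Z) :=
  separated e A /\ forall B, separated e B -> A `<=` B -> B = A.

Definition filling_net := forall n : int, maximal_separated (alpha ^ (- n)) (S n).

Definition vertex (v : Z * int) := S v.2 v.1.

Definition vball (v : Z * int) : set Z := dball mdist v.1 (tau * alpha ^ (- v.2)).

Definition edge (v w : Z * int) :=
  [/\ vertex v, vertex w, v != w, `|v.2 - w.2| <= 1 &
      vball v `&` vball w !=set0].

(** Points of the metric graph are represented by their barycentric
    coordinates with respect to the vertices. *)
Local Notation coords := (Z * int -> R).

Definition vertex_pt (v : Z * int) : coords := fun u => (u == v)%:R.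

Definition edge_pt (v w : Z * int) (t : R) : coords :=
  fun u => (1 - t) * vertex_pt v u + t * vertex_pt w u.

Definition filling : set coords := [set x |
  (exists2 v, vertex v & x = vertex_pt v) \/
  (exists v w t, [/\ edge v w, 0 <= t <= 1 & x = edge_pt v w t])].

Definition segment (x y : coords) (l : R) := exists v w s t,
  [/\ edge v w, 0 <= s <= 1, 0 <= t <= 1,
      x = edge_pt v w s /\ y = edge_pt v w t & l = `|s - t|].

(** Path metric of the graph with unit-length edges. *)
Definition graph_dist (x y : coords) : R := inf [set r |
  exists (n : nat) (q : nat -> coords) (l : nat -> R),
    [/\ q 0%N = x, q n = y,
        (forall i, (i < n)%N -> segment (q i) (q i.+1) (l i)) &
        r = \sum_(i < n) l i]].

(** The height, extended linearly to the edges; the sum is finite on the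
    filling. *)
Definition height (x : coords) : R :=
  \sum_(v \in [set: Z * int]) x v * (v.2)%:~R.

Definition density (x : coords) : R := alpha `^ (- height x).

Definition uniformized_dist (x y : coords) : R := fine (ereal_inf [set I |
  exists (L : R) (gamma : R -> coords),
    [/\ arclength_curve graph_dist L gamma,
        (forall t, 0 <= t <= L -> filling (gamma t)),
        gamma 0 = x, gamma L = y &
        I = line_integral L gamma (fun z => (density z)%:E)]]).

Definition trace (A : set coords) (v w : Z * int) : set R :=
  [set t | 0 <= t <= 1 /\ A (edge_pt v w t)].

Section filling_measure.
Variable nu : {outer_measure set Z -> \bar R}.
Local Open Scope ereal_scope.

(** [completed_lebesgue_measure] is defined on all sets, as Lebesgue outer
    measure. *)
Definition filling_measure (A : set coords) : \bar R :=
  \esum_(v in vertex) \esum_(w in edge v)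
    (nu (vball v) + nu (vball w)) * completed_lebesgue_measure (trace A v w).

Let filling_measure_term_ge0 (A : set coords) v w :
  0 <= (nu (vball v) + nu (vball w)) * completed_lebesgue_measure (trace A v w).
Proof. by rewrite mule_ge0// adde_ge0// outer_measure_ge0. Qed.

Let filling_measure0 : filling_measure set0 = 0.
Proof.
apply: esum1 => v _; apply: esum1 => w _.
rewrite (_ : trace set0 v w = set0) ?measure0 ?mule0//.
by rewrite -subset0 => t [].
Qed.

Let filling_measure_ge0 A : 0 <= filling_measure A.
Proof. by apply: esum_ge0 => v _; apply: esum_ge0. Qed.

Let le_filling_measure :
  {homo filling_measure : A B / A `<=` B >-> A <= B}.
Proof.
move=> A B AB; apply: le_esum => v _; apply: le_esum => w _.
apply: lee_wpmul2l; first by rewrite adde_ge0// outer_measure_ge0.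
apply: le_mu_ext => t [t01 At]; split => //; exact: AB.
Qed.

Let esum_nneseries_le (I : choiceType) (J : set I) (a : I -> nat -> \bar R) :
  (forall i k, 0 <= a i k) ->
  \esum_(i in J) \sum_(k <oo) a i k <= \sum_(k <oo) \esum_(i in J) a i k.
Proof.
move=> a0; apply: ge_ereal_sup => _ [F [finF FJ] <-].
rewrite fsbig_finite//= -nneseries_sum//.
apply: lee_nneseries => [k _ _|k _].
  by apply: sume_ge0.
rewrite -fsbig_finite//; apply: ereal_sup_ubound; exists F => //.
Qed.

Let lee_mul_nneseries (c x : \bar R) (a : nat -> \bar R) :
  0 <= c -> (forall k, 0 <= a k) -> x <= \sum_(k <oo) a k ->
  c * x <= \sum_(k <oo) c * a k.
Proof.
move=> c0 a0 xa; case: c c0 => [r||] // r0.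
  by rewrite nneseriesZl//; exact: lee_wpmul2l.
have [[k ak]|/forallNP a_eq0] := pselect (exists k, 0 < a k).
  rewrite [leRHS](eseries_pinfty _ _ (_ : +oo * a k = +oo)) ?leey//.
    by move=> n _; rewrite -ltNye (lt_le_trans _ (mule_ge0 r0 (a0 n))).
  by rewrite gt0_mulye.
rewrite [leRHS]eseries0; last first.
  move=> k _ _; suff -> : a k = 0 by rewrite mule0.
  by apply/eqP; rewrite eq_le a0 andbT leNgt; exact/negP.
rewrite mule_ge0_le0//; apply: (le_trans xa); rewrite eseries0// => k _ _.
by apply/eqP; rewrite eq_le a0 andbT leNgt; exact/negP.
Qed.

Let filling_measure_sigma_subadditive : sigma_subadditive filling_measure.
Proof.
move=> A.
apply: (@le_trans _ _ (\esum_(v in vertex) \sum_(k <oo) \esum_(w in edge v)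
    (nu (vball v) + nu (vball w)) *
      completed_lebesgue_measure (trace (A k) v w))); last first.
  by apply: esum_nneseries_le => v k; apply: esum_ge0.
apply: le_esum => v _; apply: le_trans (esum_nneseries_le _ _) => //.
apply: le_esum => w _.
apply: lee_mul_nneseries => //; first by rewrite adde_ge0// outer_measure_ge0.
rewrite (_ : trace (\bigcup_n A n) v w = \bigcup_n trace (A n) v w).
  exact: (outer_measure_sigma_subadditive (mu_ext (wlength idfun))).
apply/seteqP; split => [t [t01 [n _ An]]|t [n _ [t01 An]]]; first by exists n.
by split => //; exists n.
Qed.

HB.instance Definition _ := isOuterMeasure.Build R coords filling_measure
  filling_measure0 filling_measure_ge0 le_filling_measure
  filling_measure_sigma_subadditive.

End filling_measure.

Section uniformized_space.
Variables (Y : completeMetricType R) (iota : coords -> Y).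

(** [iota] (restricted to the filling) presents [Y] as the completion of the
    uniformized filling. *)
Definition is_completion :=
  (forall x y, filling x -> filling y ->
     mdist (iota x) (iota y) = uniformized_dist x y) /\
  closure (iota @` filling) = [set: Y].

(** This determines [j]: by maximality of the nets, admissible sequences [s]
    exist for every [z]. *)
Definition boundary_identification (j : Z -> Y) :=
  forall (z : Z) (s : nat -> Z),
    (forall n : nat, S n%:Z (s n) /\ mdist (s n) z < alpha ^- n) ->
    (fun n : nat => iota (vertex_pt (s n, n%:Z))) @ \oo --> j z.

(** The metric on [Z] induced by the one of the completed uniformization. *)
Definition boundary_dist (j : Z -> Y) (x y : Z) : R := mdist (j x) (j y).

Variables (nu : {outer_measure set Z -> \bar R}) (beta : R).
Local Open Scope ereal_scope.

(** On Borel sets; nothing is charged outside the image of the filling, in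
    particular the boundary has measure 0. *)
Definition weighted_measure (A : set (borel Y)) : \bar R :=
  om_integral (filling_measure nu) (filling `&` iota @^-1` A)
    (fun x => (alpha `^ (- (beta * height x)))%:E).

(** Its Borel regular extension to all sets. *)
Definition uniformized_measure : set Y -> \bar R := mu_ext weighted_measure.

Let weighted_measure0 : weighted_measure set0 = 0.
Proof. by rewrite /weighted_measure preimage_set0 setI0 /om_integral integral_set0. Qed.

Let weighted_measure_ge0 A : 0 <= weighted_measure A.
Proof. by apply: integral_ge0 => x _; rewrite lee_fin powR_ge0. Qed.

HB.instance Definition _ := isOuterMeasure.Build R Y uniformized_measure
  (mu_ext0 weighted_measure0 weighted_measure_ge0)
  (mu_ext_ge0 weighted_measure_ge0)
  (le_mu_ext weighted_measure)
  (mu_ext_sigma_subadditive weighted_measure_ge0).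

End uniformized_space.

End hyperbolic_filling.

(* Main.v *)
(** A weak upper gradient controls [u] along every edge of the filling, because a
    single edge has positive modulus, and hence along the chain of vertical edges
    descending to a boundary point. By Hölder's inequality the contribution of the
    edge of level [k] is governed by the mean of [g ^ p] over that edge. This mean
    is bounded in two ways: by a function on [Z] (the mass of [g ^ p] spread over
    the balls of the vertices) whose [nu]-integral is at most the energy of [g] in
    [2 hatB], and, by relative lower volume decay, by [(r alpha ^ k) ^ Q] times
    the energy divided by [nu B]. Using the second bound at coarse levels and the
    first one at fine levels, the geometric sum is an interpolation between the
    two, and its [Qs]-th power is integrable over [B]. Points at scale comparable
    to [r] are joined to a central vertex by boundedly many edges inside [2 hatB].
    The mean of [u] over [hatB] is compared with the value at that vertex by
    integrating the same estimate over balls packed in [Z]. Reverse doubling enters only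
    through [diam B >= c r]. *)
From HB Require Import structures.
From mathcomp Require Import all_boot all_order all_algebra finmap.
From mathcomp Require Import all_classical all_reals all_analysis.
From mathcomp Require Import measurable_realfun ring lra zify.
Require Import Defs.

Set Implicit Arguments.
Unset Strict Implicit.
Unset Printing Implicit Defensive.

Import Order.TTheory GRing.Theory Num.Theory.
Import numFieldNormedType.Exports.

Local Open Scope classical_set_scope.
Local Open Scope ring_scope.

(** The exponent comes out of the interpolation: if [spread a] is at most y^p T^Q, the oscillation
    along the ray is of order y r^theta T^de with de = Q/p - theta, and de * Qs = Q turns its
    [Qs]-th power into a linear function of [spread], whose integral is known. Here [y] is any
    positive number such that y^p nu(B) bounds the energy in 2 hatB; a limit at the end removes the
    positivity. The edges joining points at scale [r] are never counted: Young's inequality replaces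
    [g] by a majorant [F] containing a multiple of the indicator of 2 hatB, and the terms of a
    simple path are part of a single integral of [F]. Two obstacles shape the rest. The volume
    hypotheses refer to the metric induced by the completion, the combinatorics to the original one,
    so volume estimates pass through biLipschitz inclusions. And the completion is given abstractly:
    its distances are bounded below by test functions on the graph ([rho_lip]) and above by explicit
    curves, while integrals against [mu] are reduced to countable sums of Lebesgue integrals over
    edges. *)

Section integral_representation.
Context {R : realType}.
Local Open Scope ereal_scope.

(** * Integrals against countable sums of curve measures *)

Lemma nneseries_cvg (u : nat -> nat -> \bar R) (v : nat -> \bar R) :
  (forall m n, 0 <= u m n) -> (forall n, nondecreasing_seq (u ^~ n)) ->
  (forall n, u ^~ n @ \oo --> v n) ->
  (fun m => \sum_(n <oo) u m n) @ \oo --> \sum_(n <oo) v n.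
Proof.
move=> u0 nd cv.
have v0 n : 0 <= v n.
  rewrite -(cvg_lim _ (cv n))//; apply: lime_ge; first by apply/cvg_ex; exists (v n).
  by apply: nearW => m.
rewrite -ge0_integral_count//.
have -> : (fun m => \sum_(n <oo) u m n) = (fun m => \int[counting]_n u m n).
  by apply/funext => m; rewrite ge0_integral_count.
have -> : \int[counting]_n v n = \int[counting]_n limn (u ^~ n).
  by apply: eq_integral => n _; rewrite (cvg_lim _ (cv n)).
exact: cvg_monotone_convergence.
Qed.

Import HBNNSimple.

Context d (T : measurableType d) (mu : {measure set T -> \bar R}).
Variables (D : set R) (k : nat -> R -> R) (gam : nat -> R -> T).
Hypothesis mD : measurable D.
Hypothesis k0 : forall n t, D t -> (0 <= k n t)%R.
Hypothesis mk : forall n, measurable_fun D (k n).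
Hypothesis mgam : forall n, measurable_fun D (gam n).
Hypothesis muE : forall A, measurable A ->
  mu A = \sum_(n <oo) \int[lebesgue_measure]_(t in D) ((k n t)%:E * (\1_A (gam n t))%:E).

Let ind_meas A n : measurable A ->
  measurable_fun D (fun t => (k n t)%:E * (\1_A (gam n t))%:E).
Proof.
move=> mA; apply: emeasurable_funM => //; first exact/measurable_EFinP;  apply/measurable_EFinP.
by apply: measurableT_comp.
Qed.

Let ge0_integral_repr_nnsfun (h : {nnsfun T >-> R}) :
  \int[mu]_x (h x)%:E =
  \sum_(n <oo) \int[lebesgue_measure]_(t in D) ((k n t)%:E * (h (gam n t))%:E).
Proof.
rewrite integralT_nnsfun sintegralE fsbig_finite//=.
rewrite (eq_bigr (fun x => \sum_(n <oo) (x%:E *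
    \int[lebesgue_measure]_(t in D) ((k n t)%:E * (\1_(h @^-1` [set x]) (gam n t))%:E)))); last first.
  move=> x _; rewrite muE// nneseriesZl// => n _.
  by apply: integral_ge0 => t Dt; rewrite mule_ge0 ?lee_fin ?k0// lee_fin.
have [x0|x0] := pselect (forall x, x \in fset_set (range h) -> (0 <= x)%R); last first.
  by exfalso; apply: x0 => x; rewrite in_fset_set// => /set_mem[t _ <-]; exact: fun_ge0.
rewrite big_seq -nneseries_sum; last first.
  move=> x n hx; rewrite mule_ge0 ?lee_fin ?x0// integral_ge0// => t Dt.
  by rewrite mule_ge0 ?lee_fin ?k0// lee_fin.
apply: eq_eseriesr => n _.
under eq_bigr => x hx.
  rewrite -ge0_integralZl//; last 3 first.
  - exact: ind_meas.
  - by move=> t Dt; rewrite mule_ge0 ?lee_fin ?k0// lee_fin.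
  - by rewrite lee_fin x0.
  over.
rewrite -big_seq -ge0_integral_sum//.
- apply: eq_integral => t /set_mem Dt.
  rewrite [in RHS]fimfunE fsbig_finite//= -sumEFin ge0_sume_distrr.
    by apply: eq_bigr => x _; rewrite EFinM muleCA.
  move=> x _; rewrite lee_fin; case: (pselect (range h x)) => [[y _ <-]|nx].
    by rewrite mulr_ge0// fun_ge0.
  rewrite indicE; case: (boolP (_ \in _)); last by rewrite mulr0.
  by move=> /set_mem e; exfalso; apply: nx; exists (gam n t).
- by move=> x; apply: emeasurable_funM => //; exact: ind_meas.
- move=> x t Dt.
  case: (pselect (range h x)) => [[y _ <-]|nx].
    by rewrite !mule_ge0 ?lee_fin ?k0// lee_fin// fun_ge0.
  rewrite indicE; case: (boolP (_ \in _)); last by rewrite !mule0.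
  by move=> /set_mem e; exfalso; apply: nx; exists (gam n t).
Qed.

(** The hypothesis [muE] is the case of indicators. Simple functions follow by linearity, and
    monotone convergence, in the integral and in the series at once, gives the general case. For the
    filling, [gam] enumerates the edges. *)
Lemma ge0_integral_repr (F : T -> \bar R) : measurable_fun setT F ->
  (forall x, 0 <= F x) -> \int[mu]_x F x =
  \sum_(n <oo) \int[lebesgue_measure]_(t in D) ((k n t)%:E * F (gam n t)).
Proof.
move=> mF F0; pose h m := nnsfun_approx measurableT mF m.
have hF x : EFin \o h^~ x @ \oo --> F x by apply: cvg_nnsfun_approx.
have nd x : nondecreasing_seq (EFin \o h^~ x).
  by move=> a b ab; rewrite lee_fin; exact/lefP/nd_nnsfun_approx.
have h1 : (fun m => \int[mu]_x (h m x)%:E) @ \oo --> \int[mu]_x F x.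
  have -> : \int[mu]_x F x = \int[mu]_x limn (EFin \o h^~ x).
    by apply: eq_integral => x _; rewrite (cvg_lim _ (hF x)).
  apply: cvg_monotone_convergence => //.
  - by move=> m; apply/measurable_EFinP.
  - by move=> m x _; rewrite lee_fin.
  - by move=> x _; exact: nd.
have mkh m n : measurable_fun D (fun t => (k n t)%:E * (h m (gam n t))%:E).
  apply: emeasurable_funM; first exact/measurable_EFinP.
  by apply/measurable_EFinP; exact: measurableT_comp.
rewrite -(cvg_lim _ h1)//; apply/cvg_lim => //.
rewrite (_ : (fun m => \int[mu]_x (h m x)%:E) = (fun m => \sum_(n <oo)
    \int[lebesgue_measure]_(t in D) ((k n t)%:E * (h m (gam n t))%:E))); last first.
  by apply/funext => m; rewrite ge0_integral_repr_nnsfun.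
apply: nneseries_cvg.
- by move=> m n; apply: integral_ge0 => t Dt; rewrite mule_ge0 ?lee_fin ?k0// lee_fin.
- move=> n a b ab; apply: ge0_le_integral => //.
  + by move=> t Dt; rewrite mule_ge0 ?lee_fin ?k0// lee_fin.
  + exact: mkh.
  + exact: mkh.
  + by move=> t Dt; rewrite lee_wpmul2l ?lee_fin ?k0//; exact: nd.
move=> n.
have -> : \int[lebesgue_measure]_(t in D) ((k n t)%:E * F (gam n t)) =
    \int[lebesgue_measure]_(t in D) limn (fun m => (k n t)%:E * (h m (gam n t))%:E).
  apply: eq_integral => t /set_mem Dt; apply/esym/cvg_lim => //.
  by apply: cvgeZl => //; exact: hF.
apply: cvg_monotone_convergence => //.
- by move=> m; exact: mkh.
- by move=> m t Dt; rewrite mule_ge0 ?lee_fin ?k0// lee_fin.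
- by move=> t Dt a b ab; rewrite lee_wpmul2l ?lee_fin ?k0//; exact: nd.
Qed.

End integral_representation.

(** The case of a single curve: the series is padded with zero weights. *)
Lemma ge0_integral_repr1 (R : realType) d (T : measurableType d)
    (mu : {measure set T -> \bar R}) (D : set R) (k : R -> R) (gam : R -> T)
    (F : T -> \bar R) :
  measurable D -> (forall t, D t -> 0 <= k t) -> measurable_fun D k ->
  measurable_fun D gam ->
  (forall A, measurable A ->
    mu A = (\int[lebesgue_measure]_(t in D) ((k t)%:E * (\1_A (gam t))%:E))%E) ->
  measurable_fun setT F -> (forall x, (0 <= F x)%E) ->
  (\int[mu]_x F x = \int[lebesgue_measure]_(t in D) ((k t)%:E * F (gam t)))%E.
Proof.
move=> mD k0 mk mgam muE mF F0.
have E (u : nat -> \bar R) : (forall n, (0 <= u n)%E) -> (forall n, u n.+1 = 0%E) ->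
    (\sum_(n <oo) u n = u 0%N)%E.
  move=> u0 uS; rewrite nneseries_recl// eseries0 ?adde0// => -[|n] //= _ _.
pose kk (n : nat) t := if n is 0%N then k t else 0.
rewrite (ge0_integral_repr (D := D) (k := kk) (gam := fun=> gam))//.
- rewrite E//.
  + by case=> [|n]; apply: integral_ge0 => t Dt; rewrite mule_ge0 ?lee_fin ?k0.
  + by move=> n; apply: integral0_eq => t _; rewrite mul0e.
- by case=> [|n] t Dt; rewrite /kk ?k0.
- by case=> [|n]; [exact: mk|exact: measurable_cst].
move=> A mA; rewrite E ?muE//.
- by case=> [|n]; apply: integral_ge0 => t Dt; rewrite mule_ge0 ?lee_fin ?k0.
- by move=> n; apply: integral0_eq => t _; rewrite mul0e.
Qed.

(** * Comparison of measures and a substitution inequality *)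

Section measure_comparison.
Context {R : realType}.
Local Open Scope ereal_scope.
Local Notation leb := (@lebesgue_measure R).
Import HBNNSimple.

Lemma le_measure_integral d (T : measurableType d)
    (m1 m2 : {measure set T -> \bar R}) (F : T -> \bar R) :
  (forall A, measurable A -> m1 A <= m2 A) ->
  measurable_fun setT F -> (forall x, 0 <= F x) ->
  \int[m1]_x F x <= \int[m2]_x F x.
Proof.
move=> m12 mF F0; pose h m := nnsfun_approx measurableT mF m.
have hF x : EFin \o h^~ x @ \oo --> F x by apply: cvg_nnsfun_approx.
have nd x : nondecreasing_seq (EFin \o h^~ x).
  by move=> a b ab; rewrite lee_fin; exact/lefP/nd_nnsfun_approx.
have cv (m : {measure set T -> \bar R}) :
    (fun n => \int[m]_x (h n x)%:E) @ \oo --> \int[m]_x F x.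
  have -> : \int[m]_x F x = \int[m]_x limn (EFin \o h^~ x).
    by apply: eq_integral => x _; rewrite (cvg_lim _ (hF x)).
  apply: cvg_monotone_convergence => //.
  - by move=> n; apply/measurable_EFinP.
  - by move=> n x _; rewrite lee_fin.
  - by move=> x _; exact: nd.
rewrite -(cvg_lim _ (cv m1))// -(cvg_lim _ (cv m2))//.
apply: lee_lim; [by apply/cvg_ex; eexists; exact: cv|by apply/cvg_ex; eexists; exact: cv|].
apply: nearW => n; rewrite !integralT_nnsfun !sintegralE !fsbig_finite//=.
rewrite big_seq [leRHS]big_seq; apply: lee_sum => x.
rewrite in_fset_set// => /set_mem[t _ <-]; rewrite lee_wpmul2l ?lee_fin ?fun_ge0//.
exact: m12.
Qed.

Lemma lebesgue_measure_diam (E : set R) (c : R) : measurable E -> (0 <= c)%R ->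
  (forall x y, E x -> E y -> x - y <= c)%R -> leb E <= c%:E.
Proof.
move=> mE c0 Ec; have [->|/set0P[x0 Ex0]] := eqVneq E set0; first by rewrite measure0 lee_fin.
have ubE : has_ubound E by exists (x0 + c)%R => y Ey; rewrite -lerBlDl; exact: Ec.
have lbE : has_lbound E by exists (x0 - c)%R => y Ey; rewrite lerBlDr -lerBlDl; exact: Ec.
have supE y : E y -> (sup E <= y + c)%R.
  move=> Ey; apply: ge_sup; first by exists x0.
  by move=> x Ex; rewrite -lerBlDl; exact: Ec.
have supinf : (sup E - c <= inf E)%R.
  by apply: lb_le_inf; [exists x0|move=> y Ey; rewrite lerBlDr; exact: supE].
apply: (@le_trans _ _ (leb `[inf E, sup E]%classic)).
  apply: le_outer_measure => x Ex.
  by rewrite /= in_itv/= ge_inf// ub_le_sup.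
rewrite lebesgue_measure_itv/= lte_fin; case: ifP => _; last by rewrite lee_fin.
by rewrite -EFinB lee_fin; move: supinf; lra.
Qed.

(** Every interval of a cover of [A] has a preimage whose diameter is at most its length divided by
    [k]. *)
Lemma lebesgue_measure_expanding (a b k : R) (f : R -> R) (A : set R) :
  (0 < k)%R -> measurable_fun setT f ->
  (forall x y, a <= x <= b -> a <= y <= b -> k * `|x - y| <= `|f x - f y|)%R ->
  measurable A -> leb (`[a, b] `&` f @^-1` A) <= k^-1%:E * leb A.
Proof.
move=> k0 mf fk mA; have mP B : measurable B -> measurable (f @^-1` B).
  by move=> mB; rewrite -[X in measurable X]setTI; exact: mf.
rewrite muleC -lee_pdivrMr// ?invr_gt0// invrK.
apply: le_ereal_inf_tmp => _ [F [mF AF] <-].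
have mF' n : measurable (F n : set (measurableTypeR R)).
  by apply: sub_sigma_algebra; exact: mF.
apply: (@le_trans _ _ (\sum_(n <oo) k%:E * leb (`[a, b] `&` f @^-1` F n))); last first.
  apply: lee_nneseries => [n _|n _]; first by rewrite mule_ge0// lee_fin ltW.
  have /ocitvP[->|[[x y] /= xy ->]] : ocitv (F n) by exact: mF.
    by rewrite preimage_set0 setI0 measure0 mule0.
  rewrite wlength_itv_bnd ?(ltW xy)//= muleC -lee_pdivlMr// -EFinM.
  apply: lebesgue_measure_diam.
  - by apply: measurableI => //; apply: mP; exact: measurable_itv.
  - by rewrite divr_ge0// ?subr_ge0 ltW.
  move=> u v [/= uab fu] [/= vab fv]; rewrite ler_pdivlMr// mulrC.
  rewrite !in_itv/= in uab vab fu fv.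
  apply: (@le_trans _ _ (k * `|u - v|)%R); first by rewrite ler_wpM2l ?ler_norm// ltW.
  apply: le_trans (fk _ _ uab vab) _; rewrite ler_norml.
  by move: fu fv => /andP[? ?] /andP[? ?]; lra.
rewrite nneseriesZl// muleC lee_wpmul2l ?lee_fin ?(ltW k0)//.
apply: measure_sigma_subadditive => //.
- by move=> n; apply: (@measurableI _ R); [exact: measurable_itv|exact: mP (mF' n)].
- by apply: (@measurableI _ R); [exact: measurable_itv|exact: mP].
by move=> x [abx /AF[n _ Fn]]; exists n.
Qed.

(** A change of variables that needs no derivative: both sides integrate [H], against the
    push-forward by [f] and against a multiple of Lebesgue measure, and these two measures are
    compared on sets. It relates arc length to the parameter of an edge. *)
Lemma integral_expanding (a b k : R) (f : R -> R) (D : set R) (H : R -> \bar R) :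
  (0 < k)%R -> measurable_fun setT f ->
  (forall x y, a <= x <= b -> a <= y <= b -> k * `|x - y| <= `|f x - f y|)%R ->
  measurable D -> (forall x, a <= x <= b -> D (f x))%R ->
  measurable_fun setT H -> (forall x, 0 <= H x) ->
  \int[leb]_(x in `[a, b]) H (f x) <= k^-1%:E * \int[leb]_(x in D) H x.
Proof.
move=> k0 mf fk mD Df mH H0.
have mab : measurable (`[a, b]%classic : set R) by [].
pose m1 : {measure set _ -> \bar R} := mrestr leb mab.
have ki0 : (0 <= k^-1)%R by rewrite invr_ge0 ltW.
pose m2 : {measure set _ -> \bar R} := mscale (NngNum ki0) (mrestr leb mD).
have mP B : measurable B -> measurable (f @^-1` B).
  by move=> mB; rewrite -[X in measurable X]setTI; exact: mf.
have mf' : measurable_fun [set: measurableTypeR R] (f : measurableTypeR R -> measurableTypeR R).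
  exact: mf.
have -> : \int[leb]_(x in `[a, b]) H (f x) =
    \int[pushforward m1 (f : measurableTypeR R -> measurableTypeR R)]_x H x.
  rewrite (@ge0_integral_repr1 _ _ _
    (measure_function_pushforward__canonical__measure_function_Measure m1 mf')
    `[a, b]%classic (fun=> 1%R) f)//.
  - by apply: eq_integral => x _; rewrite mul1e.
  - exact: measurable_funS mf.
  move=> A mA; under eq_integral do rewrite mul1e.
  by rewrite (@integral_indic _ _ _ leb _ mab (f @^-1` A))//; exact: mP.
have -> : k^-1%:E * \int[leb]_(x in D) H x = \int[m2]_x H x.
  rewrite ge0_integral_mscale//=; congr (_ * _).
  rewrite (@ge0_integral_repr1 _ _ _ (mrestr leb mD) D (fun=> 1%R) id)//.
  - by apply: eq_integral => x _; rewrite mul1e.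
  move=> A mA; under eq_integral do rewrite mul1e.
  by rewrite (@integral_indic _ _ _ leb _ mD A).
pose m3 : {measure set (measurableTypeR R) -> \bar R} :=
  measure_function_pushforward__canonical__measure_function_Measure m1 mf'.
suff : forall A, measurable A -> m3 A <= m2 A.
  by move=> m32; exact: (@le_measure_integral _ _ m3 m2 H m32 mH H0).
move=> A mA.
rewrite /m2/mscale/= /pushforward /m1 /mrestr/=.
have -> : f @^-1` A `&` `[a, b] = `[a, b] `&` f @^-1` (A `&` D).
  apply/seteqP; split=> x /=; rewrite in_itv/=.
    by move=> [fA xab]; split => //; split => //; exact: Df.
  by move=> [xab [fA _]].
by apply: lebesgue_measure_expanding => //; exact: measurableI.
Qed.

End measure_comparison.

(** * Sums over countable sets as series *)

Section countable_sums.
Context {R : realType}.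
Local Open Scope ereal_scope.

(** One enumeration serves all summands, so a sum of functions becomes a series of functions and
    monotone convergence applies. The [option] type allows [D] to be finite or empty. *)
Lemma esum_enum (I : choiceType) (D : set I) : countable D ->
  exists en : nat -> option I, (forall n i, en n = Some i -> D i) /\
    forall a : I -> \bar R, (forall i, D i -> 0 <= a i) ->
      \esum_(i in D) a i = \sum_(n <oo) if en n is Some i then a i else 0.
Proof.
move=> /countable_injP[f finj].
pose en n := if pselect (exists2 i, D i & f i = n) is left e
  then Some (projT1 (cid2 e)) else None.
have enD n i : en n = Some i -> D i.
  by rewrite /en; case: pselect => // e [<-]; case: cid2.
have enf i : D i -> en (f i) = Some i.
  move=> Di; rewrite /en; case: pselect => [e|]; last by case; exists i.
  by case: cid2 => k Dk fki /=; congr Some; apply: finj => //; exact: mem_set.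
have enN n : ~ (f @` D) n -> en n = None.
  by rewrite /en; case: pselect => // -[i Di fi] []; exists i.
exists en; split => // a a0.
rewrite nneseries_esumT; last by move=> n; case e : (en n) => [i|] //; exact/a0/enD/e.
rewrite (eq_esum (b := fun i => if en (f i) is Some k then a k else 0)); last first.
  by move=> i Di; rewrite enf.
rewrite -(@reindex_esum _ _ _ D (f @` D) f
  (fun n => if en n is Some k then a k else 0)); last exact: inj_bij.
rewrite esum_mkcond; apply: eq_esum => n _; case: ifPn => // /negP nD.
by rewrite enN// => Dn; apply: nD; exact: mem_set.
Qed.

Context d (T : measurableType d) (mu : {measure set T -> \bar R}).

Lemma measurable_fun_esum (I : choiceType) (D : set I) (f : I -> T -> \bar R) :
  countable D -> (forall i, D i -> measurable_fun setT (f i)) ->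
  (forall i x, D i -> 0 <= f i x) ->
  measurable_fun setT (fun x => \esum_(i in D) f i x).
Proof.
move=> /esum_enum[en [enD enE]] mf f0.
rewrite (_ : (fun x => _) = (fun x => \sum_(n <oo) if en n is Some i then f i x else 0)).
  apply: ge0_emeasurable_sum => n.
    by move=> x _ _; case e : (en n) => [i|] //; exact/f0/enD/e.
  by move=> _; case e : (en n) => [i|]; [exact/mf/enD/e|exact: measurable_cst].
by apply/funext => x; rewrite enE// => i Di; exact: f0.
Qed.

Lemma le_esumZ (I : choiceType) (D : set I) (c : \bar R) (a : I -> \bar R) :
  0 <= c -> (forall i, 0 <= a i) ->
  \esum_(i in D) (c * a i) <= c * \esum_(i in D) a i.
Proof.
move=> c0 a0; apply: ge_ereal_sup => _ [F FD <-].
rewrite -ge0_mule_fsumr//; apply: lee_wpmul2l => //.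
by apply: ereal_sup_ubound; exists F.
Qed.

Lemma le_esum_sub (I : choiceType) (D D' : set I) (a : I -> \bar R) : (D `<=` D')%classic ->
  \esum_(i in D) a i <= \esum_(i in D') a i.
Proof.
move=> DD; apply: ge_ereal_sup => _ [F [fF FD] <-].
by apply: ereal_sup_ubound; exists F => //; split => // x /FD/DD.
Qed.

Lemma ge0_integral_esum (I : choiceType) (D : set I) (f : I -> T -> \bar R) :
  countable D -> (forall i, D i -> measurable_fun setT (f i)) ->
  (forall i x, D i -> 0 <= f i x) ->
  \int[mu]_x (\esum_(i in D) f i x) = \esum_(i in D) \int[mu]_x f i x.
Proof.
move=> /esum_enum[en [enD enE]] mf f0.
rewrite enE; last by move=> i Di; apply: integral_ge0 => x _; exact: f0.
rewrite (eq_integral (fun x => \sum_(n <oo) if en n is Some i then f i x else 0)); last first.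
  by move=> x _; rewrite enE// => i Di; exact: f0.
rewrite integral_nneseries//.
- apply: eq_eseriesr => n _; case e : (en n) => [i|]//.
  by rewrite integral0.
- by move=> n; case e : (en n) => [i|]; [exact/mf/enD/e|exact: measurable_cst].
- by move=> n x _; case e : (en n) => [i|] //; exact/f0/enD/e.
Qed.

End countable_sums.

(** * Integrals against outer measures on a smaller sigma-algebra *)

Section outer_measure_integral.
Context {R : realType} {T : pointedType} (m : {outer_measure set T -> \bar R}).
Variable G : set (set T).
Hypothesis Gm : G `<=` m.-caratheodory.
Local Open Scope ereal_scope.

Lemma sigma_caratheodory : <<s G >> `<=` m.-caratheodory.
Proof.
apply: smallest_sub => //.
exact: (@sigma_algebra_measurable _ (caratheodory_type m)).
Qed.

(** The identity as a measurable map onto the sigma-algebra generated by [G]; restricting [m] to it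
    is then a push-forward. *)
Let phi : caratheodory_type m -> g_sigma_algebraType G := id.

Let mphi : measurable_fun setT phi.
Proof.
by move=> _ A mA; rewrite setTI; exact: sigma_caratheodory.
Qed.

Let mG : {measure set (g_sigma_algebraType G) -> \bar R} :=
  measure_function_pushforward__canonical__measure_function_Measure
    (m : {measure set (caratheodory_type m) -> \bar R}) mphi.

Lemma om_integral_sigma (F : T -> \bar R) :
  measurable_fun setT (F : g_sigma_algebraType G -> \bar R) -> (forall x, 0 <= F x) ->
  om_integral m setT F = \int[mG]_x F x.
Proof.
move=> mF F0; rewrite /om_integral /mG.
by rewrite ge0_integral_pushforward.
Qed.

Lemma om_measurable_sigma (F : T -> \bar R) :
  measurable_fun setT (F : g_sigma_algebraType G -> \bar R) -> om_measurable m F.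
Proof. by move=> mF; exact: (measurableT_comp mF mphi). Qed.

Lemma om_integral_repr (D : set R) (k : nat -> R -> R)
    (gam : nat -> R -> g_sigma_algebraType G) (F : T -> \bar R) :
  measurable D -> (forall n t, D t -> (0 <= k n t)%R) ->
  (forall n, measurable_fun D (k n)) -> (forall n, measurable_fun D (gam n)) ->
  (forall A, <<s G >> A -> m A =
    \sum_(n <oo) \int[lebesgue_measure]_(t in D) ((k n t)%:E * (\1_A (gam n t))%:E)) ->
  measurable_fun setT (F : g_sigma_algebraType G -> \bar R) -> (forall x, 0 <= F x) ->
  om_integral m setT F =
  \sum_(n <oo) \int[lebesgue_measure]_(t in D) ((k n t)%:E * F (gam n t)).
Proof.
move=> mD k0 mk mgam mE mF F0; rewrite om_integral_sigma//.
exact: (@ge0_integral_repr _ _ _ mG).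
Qed.

End outer_measure_integral.

(** * Elementary properties of [om_integral] and of averages *)

Section caratheodory_integral.
Context {R : realType} {T : pointedType} (m : {outer_measure set T -> \bar R}).
Local Open Scope ereal_scope.

Lemma om_integral_restrict (D : set T) (f : T -> \bar R) : om_integral m D f = om_integral m setT (f \_ D).
Proof. by rewrite /om_integral [LHS]integral_mkcond. Qed.

Lemma om_integral_le (D : set T) (f h : T -> \bar R) : m.-caratheodory D -> om_measurable m f -> om_measurable m h ->
  (forall x, D x -> 0 <= f x) -> (forall x, D x -> f x <= h x) ->
  om_integral m D f <= om_integral m D h.
Proof.
move=> mD mf mh f0 fh; apply: ge0_le_integral => //; exact: measurable_funTS.
Qed.

Lemma om_integral_subset (D : set T)
    (f : T -> \bar R) : m.-caratheodory D -> om_measurable m f -> (forall x, 0 <= f x) ->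
  om_integral m D f <= om_integral m setT f.
Proof. by move=> mD mf f0; exact: ge0_subset_integral. Qed.

Lemma om_measurable_dist (f : T -> \bar R) c : om_measurable m f -> om_measurable m (fun x => `|f x - c|).
Proof.
move=> mf; apply: measurableT_comp => //.
by apply: emeasurable_funB => //; exact: measurable_cst.
Qed.

(** The bound makes [f - c] integrable on [D], which has finite measure; hence the average of [f]
    minus [c] is the average of [f - c]. *)
Lemma average_dist (D : set T)
    (f : T -> \bar R) (c M : R) : m.-caratheodory D -> 0 < m D < +oo -> om_measurable m f ->
  om_integral m D (fun x => `|f x - c%:E|) <= M%:E ->
  `|average m D f - c%:E| <= (M / fine (m D))%:E.
Proof.
move=> mD /andP[D0 Dfin] mf fM.
have mfD : measurable_fun (D : set (caratheodory_type m)) (f : caratheodory_type m -> \bar R).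
  exact: measurable_funTS.
have mDE : m D = (fine (m D))%:E by rewrite fineK// ge0_fin_numE// ltW.
have d0 : (0 < fine (m D))%R by rewrite -lte_fin -mDE.
have i1 : integrable (m : set (caratheodory_type m) -> \bar R)
    (D : set (caratheodory_type m)) (fun x => f x - c%:E).
  apply/integrableP; split; first by apply: emeasurable_funB => //; exact: measurable_cst.
  by apply: le_lt_trans fM _; rewrite ltry.
have i2 : integrable (m : set (caratheodory_type m) -> \bar R)
    (D : set (caratheodory_type m)) (fun=> c%:E).
  apply/integrableP; split; first exact: measurable_cst.
  by rewrite integral_cst// [X in _ * X < _]mDE -EFinM ltry.
have fE : om_integral m D f = om_integral m D (fun x => f x - c%:E) + c%:E * m D.
  have <- : om_integral m D (fun=> c%:E) = c%:E * m D by rewrite /om_integral integral_cst.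
  rewrite /om_integral -integralD//.
  by apply: eq_integral => x _; rewrite subeK.
have fin : om_integral m D (fun x => f x - c%:E) \is a fin_num.
  by apply: integrable_fin_num.
rewrite /average fE mDE inver gt_eqF//.
have h : `|om_integral m D (fun x => f x - c%:E)| <= M%:E.
  by apply: le_trans fM; apply: le_abse_integral => //; case/integrableP: i1.
rewrite -(fineK fin) in h *; rewrite abse_EFin lee_fin in h.
rewrite [fine (fine _)%:E]/=; move: (fine (m D)) (fine (om_integral _ _ _)) d0 h => d A d0 h.
have -> : (A%:E + c%:E * d%:E) * (d^-1)%:E - c%:E = (A / d)%:E.
  transitivity (((A + c * d) / d - c)%R%:E) => //.
  by congr (_%:E); field; rewrite gt_eqF.
have di : (0 < d^-1)%R by rewrite invr_gt0.
by rewrite abse_EFin lee_fin normrM (gtr0_norm di) ler_pM2r.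
Qed.

Lemma om_integral_lin (D : set T) (c d : R)
    (f h : T -> \bar R) : m.-caratheodory D -> (0 <= c)%R -> (0 <= d)%R ->
  om_measurable m f -> om_measurable m h -> (forall x, 0 <= f x) -> (forall x, 0 <= h x) ->
  om_integral m D (fun x => c%:E * f x + d%:E * h x) =
  c%:E * om_integral m D f + d%:E * om_integral m D h.
Proof.
move=> mD cge0 dge0 mf mh f0 h0.
have mfD : measurable_fun (D : set (caratheodory_type m)) (f : caratheodory_type m -> \bar R).
  exact: measurable_funTS.
have mhD : measurable_fun (D : set (caratheodory_type m)) (h : caratheodory_type m -> \bar R).
  exact: measurable_funTS.
rewrite /om_integral ge0_integralD//.
- by rewrite !ge0_integralZl.
- by move=> x _; rewrite mule_ge0.
- by apply: emeasurable_funM => //; exact: measurable_cst.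
- by move=> x _; rewrite mule_ge0.
- by apply: emeasurable_funM => //; exact: measurable_cst.
Qed.

Lemma om_ae_mono3 (P1 P2 P3 P4 : T -> Prop) :
  (forall x, P1 x -> P2 x -> P3 x -> P4 x) -> om_ae m P1 -> om_ae m P2 -> om_ae m P3 ->
  om_ae m P4.
Proof.
move=> H; apply: filterS3 H.
exact: (@ae_filter_ringOfSetsType _ (caratheodory_type m) _
  (m : {measure set (caratheodory_type m) -> \bar R})).
Qed.

End caratheodory_integral.

(** * Extended reals and powers *)

Section numbers.
Context {R : realType}.
Implicit Types a b c x w : \bar R.

Lemma powRV (x r : R) : (0 <= x)%R -> (x^-1 `^ r = (x `^ r)^-1)%R.
Proof. by move=> x0; rewrite -powRN -powR_inv1// -powRrM mulN1r. Qed.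

Lemma telescope_le (f h : nat -> R) : (forall i, f i <= h i - h i.+1)%R ->
  forall n, (\sum_(i < n) f i <= h 0%N - h n)%R.
Proof.
move=> fh; elim=> [|n IH]; first by rewrite big_ord0 subrr.
by rewrite big_ord_recr /=; have := fh n; lra.
Qed.

Lemma int_le_ex (m k : int) : (m <= k)%R -> exists i : nat, k = (m + i%:Z)%R.
Proof.
by move=> mk; exists `|k - m|%N; rewrite -[LHS](subrKC m) gez0_abs ?subr_ge0.
Qed.

Local Open Scope ereal_scope.

Lemma mule_factor a b c x w : 0 <= a -> 0 <= c * (x * b) ->
  a * w + c * (x * b * w) = w * (a + c * (x * b)).
Proof. by move=> a_ge0 b_ge0; rewrite ge0_muleDr// muleC (muleC _ w) muleCA. Qed.

Lemma abse_sub_fin a b : `|a - b| < +oo -> a \is a fin_num /\ b \is a fin_num.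
Proof. by case: a => [a| |]; case: b => [b| |]. Qed.

End numbers.

Lemma mball_open (R : realType) (M : metricType R) (x : M) (r : R) :
  open (dball mdist x r).
Proof.
rewrite openE => y /= xy; apply/nbhs_ballP.
exists (r - mdist x y) => /=; first by rewrite subr_gt0.
move=> z; rewrite ballEmdist /dball/= ltrBrDl; apply: le_lt_trans.
exact: metric_triangle.
Qed.

Section powers.
Context {R : realType} (a : R).
Hypothesis a1 : 1 < a.

Lemma pw_gt0 x : 0 < a `^ x.
Proof. by rewrite powR_gt0// (lt_trans ltr01). Qed.

Lemma pwD x y : a `^ (x + y) = a `^ x * a `^ y.
Proof. by rewrite powRD// (gt_eqF (lt_trans ltr01 a1)) implybT. Qed.

Lemma pw_le x y : x <= y -> a `^ x <= a `^ y.
Proof. by move=> xy; apply: ler_powR => //; exact: ltW. Qed.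

Lemma pw_lt x y : x < y -> a `^ x < a `^ y.
Proof.
move=> xy; rewrite /powR gt_eqF ?(lt_trans ltr01)// ltr_expR ltr_pM2r//.
by rewrite ln_gt0.
Qed.

Lemma pw_lnK y : 0 < y -> a `^ (ln y / ln a) = y.
Proof.
move=> y0; rewrite /powR gt_eqF ?(lt_trans ltr01)// divfK ?lnK//.
by rewrite gt_eqF// ln_gt0.
Qed.

Lemma pw_unbounded M : exists k : nat, forall x, k%:R <= x -> M < a `^ x.
Proof.
have [M0|M0] := leP M 0.
  by exists 0%N => x _; exact: le_lt_trans (pw_gt0 _).
exists (Num.bound (ln M / ln a)) => x kx; rewrite -(pw_lnK M0).
apply: pw_lt; apply: lt_le_trans kx.
have [l0|l0] := leP 0 (ln M / ln a); first exact: archi_boundP.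
exact: lt_le_trans l0 _.
Qed.

(* Both bounds are the mean value theorem for [x |-> a `^ (- x)]. *)
Lemma pw_diff_le s t : s <= t ->
  (t - s) * a `^ (- t) <= (a `^ (- s) - a `^ (- t)) / ln a.
Proof.
move=> st; have la : 0 < ln a by rewrite ln_gt0.
rewrite ler_pdivlMr//; have -> : a `^ (- s) = a `^ (t - s) * a `^ (- t).
  by rewrite -pwD addrC addKr.
rewrite -[X in _ <= _ - X]mul1r -mulrBl mulrAC ler_pM2r ?pw_gt0//.
rewrite /powR gt_eqF ?(lt_trans ltr01)// lerBrDl.
exact: expR_ge1Dx.
Qed.

Lemma pw_diff_ge s t : s <= t ->
  (a `^ (- s) - a `^ (- t)) / ln a <= (t - s) * a `^ (- s).
Proof.
move=> st; have la : 0 < ln a by rewrite ln_gt0.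
rewrite ler_pdivrMr//; have -> : a `^ (- t) = a `^ (s - t) * a `^ (- s).
  by rewrite -pwD addrC addKr.
rewrite -[X in X - _ <= _]mul1r -mulrBl mulrAC ler_pM2r ?pw_gt0//.
rewrite /powR gt_eqF ?(lt_trans ltr01)// lerBlDr -lerBlDl.
have -> : 1 - (t - s) * ln a = 1 + (s - t) * ln a by ring.
exact: expR_ge1Dx.
Qed.

End powers.

(** * Removing error factors by repeated bisection *)

Section bisection.
Context {R : realType} (a : R).
Hypothesis a1 : 1 < a.
Variables (lo hi C : R) (D J : R -> R -> R).
Hypothesis C0 : 0 <= C.
Hypothesis J0 : forall x y, lo <= x -> x <= y -> y <= hi -> 0 <= J x y.
Hypothesis Dsub : forall x z y, lo <= x -> x <= z -> z <= y -> y <= hi ->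
  D x y <= D x z + D z y.
Hypothesis Jsup : forall x z y, lo <= x -> x <= z -> z <= y -> y <= hi ->
  J x z + J z y <= J x y.
Hypothesis DJ : forall x y, lo <= x -> x <= y -> y <= hi ->
  D x y <= a `^ (C * (y - x)) * J x y.

(** Splitting at the midpoint halves the exponent of the error factor, because [D] is subadditive
    and [J] superadditive. *)
Let DJn (n : nat) x y : lo <= x -> x <= y -> y <= hi ->
  D x y <= a `^ (C * (y - x) / 2 ^+ n) * J x y.
Proof.
elim: n x y => [|n IH] x y lx xy yh; first by rewrite expr0 divr1 DJ.
pose z := (x + y) / 2.
have xz : x <= z by rewrite /z; lra.
have zy : z <= y by rewrite /z; lra.
have zh : z <= hi := le_trans zy yh.
have lz : lo <= z := le_trans lx xz.
apply: le_trans (Dsub lx xz zy yh) _.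
apply: le_trans (lerD (IH _ _ lx xz zh) (IH _ _ lz zy yh)) _.
have E u : u = (y - x) / 2 -> C * u / 2 ^+ n = C * (y - x) / 2 ^+ n.+1.
  by move=> ->; rewrite exprS invfM; ring.
have -> := E (z - x); last by rewrite /z; field.
have -> := E (y - z); last by rewrite /z; field.
by rewrite -mulrDr ler_wpM2l ?powR_ge0// Jsup.
Qed.

(** The error factor a^(C (y - x) / 2^n) tends to 1, so it would eventually fall below D / J if [D]
    exceeded [J]. This makes exact the bounds that are only known up to a factor close to 1 on short
    intervals. *)
Lemma bisection x y : lo <= x -> x <= y -> y <= hi -> D x y <= J x y.
Proof.
move=> lx xy yh; rewrite leNgt; apply/negP => JD.
have Jge := J0 lx xy yh.
have [J0e|Jn] := eqVneq (J x y) 0.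
  by have := DJ lx xy yh; rewrite J0e mulr0 leNgt -{1}J0e JD.
have Jp : 0 < J x y by rewrite lt_def Jn.
have DJ1 : 1 < D x y / J x y by rewrite ltr_pdivlMr// mul1r.
pose c := ln (D x y / J x y) / ln a.
have c0 : 0 < c by rewrite divr_gt0// ln_gt0.
pose n := Num.bound (C * (y - x) / c).
have nP : C * (y - x) / c < n%:R.
  rewrite /n; apply: archi_boundP; apply: divr_ge0; last exact: ltW.
  by rewrite mulr_ge0// subr_ge0.
have := DJn n lx xy yh; rewrite leNgt => /negP; apply.
rewrite -ltr_pdivlMr// -(pw_lnK a1 (lt_trans ltr01 DJ1)) pw_lt// -/c.
have {nP} : C * (y - x) < n%:R * c by rewrite -ltr_pdivrMr.
rewrite ltr_pdivrMr ?exprn_gt0// => /lt_trans; apply.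
by rewrite mulrC ltr_pM2l// -natrX ltr_nat ltn_expl.
Qed.

End bisection.

(** * Lebesgue integrals over compact intervals *)

Section interval_integrals.
Context {R : realType}.
Local Notation leb := (@lebesgue_measure R).
Local Open Scope ereal_scope.

Lemma integral_itv_le (f : R -> \bar R) (a b M : R) : measurable_fun setT f ->
  (a <= b)%R -> (forall x, (a <= x <= b)%R -> 0 <= f x <= M%:E) ->
  \int[leb]_(x in `[a, b]) f x <= ((b - a) * M)%:E.
Proof.
move=> mf ab fM; have M0 : (0 <= M)%R.
  rewrite -lee_fin; have /andP[/le_trans] := fM a (introT andP (conj (lexx _) ab)).
  exact.
have -> : ((b - a) * M)%:E = \int[leb]_(x in `[a, b]) M%:E.
  rewrite integral_cst//= lebesgue_measure_itv/= lte_fin.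
  have [ab'|ba] := ltP a b; first by rewrite -EFinB -EFinM mulrC.
  have -> : (b - a = 0)%R by apply/eqP; rewrite subr_eq0 eq_le ab ba.
  by rewrite mul0r mule0.
apply: ge0_le_integral => //.
- by move=> x; rewrite /= in_itv/= => /fM/andP[].
- exact: measurable_funS mf.
- by move=> x; rewrite /= in_itv/= => /fM/andP[].
Qed.

Lemma integral_itv_ge (f : R -> \bar R) (a b m : R) : measurable_fun setT f ->
  (0 <= m)%R -> (a <= b)%R -> (forall x, (a <= x <= b)%R -> m%:E <= f x) ->
  ((b - a) * m)%:E <= \int[leb]_(x in `[a, b]) f x.
Proof.
move=> mf m0 ab fM.
have -> : ((b - a) * m)%:E = \int[leb]_(x in `[a, b]) m%:E.
  rewrite integral_cst//= lebesgue_measure_itv/= lte_fin.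
  have [ab'|ba] := ltP a b; first by rewrite -EFinB -EFinM mulrC.
  have -> : (b - a = 0)%R by apply/eqP; rewrite subr_eq0 eq_le ab ba.
  by rewrite mul0r mule0.
apply: ge0_le_integral => //.
- exact: measurable_funS mf.
Qed.

Lemma integral_itv_split (f : R -> \bar R) (a c b : R) : measurable_fun setT f ->
  (forall x, 0 <= f x) -> (a <= c)%R -> (c <= b)%R ->
  \int[leb]_(x in `[a, b]) f x =
  \int[leb]_(x in `[a, c]) f x + \int[leb]_(x in `[c, b]) f x.
Proof.
move=> mf f0 ac cb.
rewrite (@itv_bndbnd_setU _ _ (BLeft a) (BRight c) (BRight b)) ?bnd_simp//.
rewrite ge0_integral_setU//; last 2 first.
- exact: measurable_funS mf.
- apply/disj_setPS => x []; rewrite /= !in_itv/= => /andP[_ xc] /andP[cx _].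
  by rewrite ltNge xc in cx.
- congr (_ + _); rewrite integral_itv_obnd_cbnd//; exact: measurable_funS mf.
Qed.

Lemma lipschitz1_continuous (k : R -> R) :
  (forall s t, `|k s - k t| <= `|s - t|)%R -> continuous k.
Proof.
move=> kL x; apply/cvgrPdist_lt => e e0; near=> t.
apply: le_lt_trans (kL _ _) _; near: t.
by apply: (@cvgr_dist_lt _ _ _ _ _ id) => //; exact: cvg_id.
Unshelve. all: by end_near. Qed.

End interval_integrals.

(** * From local growth bounds to an integral bound *)

Section growth_along_curves.
Context {R : realType} (a : R).
Hypothesis a1 : 1 < a.
Variables (L : R) (k phi : R -> R).
Hypothesis L0 : 0 <= L.
Hypothesis kL : forall s t, `|k s - k t| <= `|s - t|.
Hypothesis phiL : forall s t, 0 <= s -> s <= t -> t <= L ->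
  `|phi s - phi t| <= (t - s) * a `^ (- k s) * a `^ (t - s).

Local Notation leb := (@lebesgue_measure R).

Let f t := (a `^ (- k t))%:E.

Let mf : measurable_fun setT f.
Proof.
apply/measurable_EFinP; apply: (measurableT_comp (measurable_powRr a)).
by apply: continuous_measurable_fun => x; apply: cvgN; exact: lipschitz1_continuous.
Qed.

Let f0 t : (0 <= f t)%E. Proof. by rewrite lee_fin powR_ge0. Qed.

Let f_le s t : a `^ (- k t) <= a `^ (- k s) * a `^ `|t - s|.
Proof.
rewrite -pwD// pw_le//; have := kL s t; rewrite (distrC t).
have := ler_norm (k s - k t); lra.
Qed.

Let J x y := fine (\int[leb]_(t in `[x, y]) f t).

Let JE x y : x <= y -> (J x y)%:E = (\int[leb]_(t in `[x, y]) f t)%E.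
Proof.
move=> xy; rewrite /J fineK// ge0_fin_numE ?integral_ge0//.
apply: le_lt_trans (integral_itv_le (M := a `^ (- k x) * a `^ (y - x)) mf xy _) (ltry _).
move=> t /andP[xt ty]; rewrite f0 lee_fin (le_trans (f_le x t))//.
rewrite ler_wpM2l ?powR_ge0// pw_le// ger0_norm ?subr_ge0// lerB//.
Qed.

(** Since [k] is 1-Lipschitz, the integral over [x, y] is at least (y - x) a^(- k x) a^(-(y - x)).
    With the hypothesis on [phi] the two sides compare up to the factor a^(2 (y - x)), which
    [bisection] removes. *)
Lemma growth_le_integral :
  (`|phi 0 - phi L|%:E <= \int[leb]_(t in `[0%R, L]) (a `^ (- k t))%:E)%E.
Proof.
rewrite -JE// lee_fin.
apply: (@bisection _ _ a1 0 L 2 (fun x y => `|phi x - phi y|) J) => //.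
- by move=> x y _ xy _; rewrite -lee_fin JE// integral_ge0.
- by move=> x z y _ _ _ _; exact: ler_distD.
- move=> x z y _ xz zy _; rewrite -lee_fin EFinD !JE ?(le_trans xz)//.
  by rewrite (integral_itv_split mf f0 xz zy).
- move=> x y x0 xy yL; apply: le_trans (phiL x0 xy yL) _.
  have -> : a `^ (2 * (y - x)) = a `^ (y - x) * a `^ (y - x).
    by rewrite -pwD//; congr (_ `^ _); ring.
  rewrite mulrC -[leRHS]mulrA ler_wpM2l ?powR_ge0//.
  rewrite mulrC -ler_pdivrMl ?pw_gt0// -lee_fin JE// -powRN mulrA mulrC.
  apply: integral_itv_ge => //; first by rewrite mulr_ge0 ?powR_ge0.
  move=> t /andP[xt ty]; rewrite lee_fin powRN ler_pdivrMl ?pw_gt0//.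
  apply: le_trans (f_le t x) _; rewrite mulrC ler_wpM2r ?powR_ge0// pw_le//.
  by rewrite distrC ger0_norm ?subr_ge0// lerB.
Qed.

End growth_along_curves.

(** * Arc-length parametrizations *)

Section arclength.
Context {R : realType} {T : Type} (d : T -> T -> R).
Implicit Types (gamma : R -> T) (s : seq R).

Fixpoint polygon_length gamma x s :=
  if s is y :: s' then d (gamma x) (gamma y) + polygon_length gamma y s' else 0.

Lemma polygon_lengthE gamma b x s :
  \sum_(0 <= i < size s) d ((gamma \o nth b (x :: s)) i)
                           ((gamma \o nth b (x :: s)) i.+1) =
  polygon_length gamma x s.
Proof.
elim: s x => [|y s IH] x; first by rewrite big_nil.
by rewrite [size _]/= big_nat_recl//= -(IH y).
Qed.

Lemma curve_lengthE gamma a b : curve_length d gamma a b =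
  ereal_sup [set (polygon_length gamma a s)%:E | s in itv_partition a b].
Proof.
rewrite /curve_length; congr ereal_sup; apply/seteqP.
by split => _ [s abs <-]; exists s => //; rewrite ?polygon_lengthE// -polygon_lengthE.
Qed.

Lemma polygon_length_cat gamma x s t :
  polygon_length gamma x (s ++ t) =
  polygon_length gamma x s + polygon_length gamma (last x s) t.
Proof. by elim: s x => [|y s IH] x /=; rewrite ?add0r// IH addrA. Qed.

Lemma polygon_length_le gamma a b s :
  (forall x y, a <= x -> x <= y -> y <= b -> d (gamma x) (gamma y) <= y - x) ->
  itv_partition a b s -> polygon_length gamma a s <= b - a.
Proof.
elim: s a => [|y s IH] a H /=; first by move=> /itv_partition_nil ->; rewrite subrr.
move=> abs; have ybs := itv_partition_cons abs.
have yb := itv_partition_le ybs.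
have ay : a <= y by case: abs => /= /andP[/ltW].
have := H a y (lexx _) ay yb.
have := IH y (fun x z yx => H x z (le_trans ay yx)) ybs; lra.
Qed.

Lemma arclength_intro L gamma : 0 <= L ->
  (forall x y, 0 <= x -> x <= y -> y <= L -> d (gamma x) (gamma y) <= y - x) ->
  (forall x y e, 0 <= x -> x < y -> y <= L -> 0 < e ->
    exists2 s, itv_partition x y s & y - x - e < polygon_length gamma x s) ->
  arclength_curve d L gamma.
Proof.
move=> L0 Hle Hge; split=> // x y x0 xy yL; rewrite curve_lengthE.
apply/eqP; rewrite eq_le; apply/andP; split.
  apply: ge_ereal_sup => _ [s xys <-]; rewrite lee_fin.
  apply: polygon_length_le xys => u v xu uv vy.
  by apply: Hle => //; [exact: le_trans x0 xu|exact: le_trans vy yL].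
have [<-|nxy] := eqVneq x y.
  by rewrite subrr; apply: ereal_sup_ubound; exists [::].
apply/lee_addgt0Pr => e e0.
have xy' : x < y by rewrite lt_neqAle nxy.
have [s xys sP] := Hge x y e x0 xy' yL e0.
apply: (@le_trans _ _ ((polygon_length gamma x s)%:E + e%:E)%E).
  by rewrite -EFinD lee_fin; lra.
by rewrite leeD2r//; apply: ereal_sup_ubound; exists s.
Qed.

Lemma arclength_le L gamma x y : (forall z, d z z <= 0) ->
  arclength_curve d L gamma -> 0 <= x -> x <= y -> y <= L ->
  d (gamma x) (gamma y) <= y - x.
Proof.
move=> dxx [L0 H] x0 xy yL; have [<-|nxy] := eqVneq x y; first by rewrite subrr.
rewrite -lee_fin -H// curve_lengthE; apply: ereal_sup_ubound.
exists [:: y]; last by rewrite /= addr0.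
by apply: itv_partition1; rewrite lt_neqAle nxy.
Qed.

Lemma arclength_approx L gamma x y e : arclength_curve d L gamma ->
  0 <= x -> x < y -> y <= L -> 0 < e ->
  exists2 s, itv_partition x y s & y - x - e < polygon_length gamma x s.
Proof.
move=> [L0 H] x0 xy yL e0; have := H x y x0 (ltW xy) yL.
rewrite curve_lengthE => Hxy.
have fin : ereal_sup [set (polygon_length gamma x s)%:E
    | s in itv_partition x y] \is a fin_num by rewrite Hxy.
have [_ [s xys <-] sP] := ub_ereal_sup_adherent e0 fin.
by exists s => //; rewrite -lte_fin EFinB -Hxy.
Qed.

Lemma isometric_arclength L gamma : 0 <= L ->
  (forall x y, 0 <= x -> x <= y -> y <= L -> d (gamma x) (gamma y) = y - x) ->
  arclength_curve d L gamma.
Proof.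
move=> L0 H; apply: arclength_intro => //; first by move=> *; rewrite H.
move=> x y e x0 xy yL e0; exists [:: y]; first exact: itv_partition1.
by rewrite /= addr0 H ?(ltW xy)// ltrBlDr ltrDl.
Qed.

Lemma eq_polygon_length gamma gamma' x y s :
  (forall t, x <= t <= y -> gamma t = gamma' t) -> itv_partition x y s ->
  polygon_length gamma x s = polygon_length gamma' x s.
Proof.
elim: s x => [//|z s IH] x H /= xys; have zys := itv_partition_cons xys.
have zy := itv_partition_le zys.
have xz : x <= z by case: xys => /= /andP[/ltW].
rewrite !H ?lexx ?(le_trans xz)// ?xz//; congr (_ + _); apply: IH zys => t /andP[zt ty].
by apply: H; rewrite (le_trans xz).
Qed.

Lemma polygon_length_shift gamma c x s :
  polygon_length (fun t => gamma (t - c)) x s =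
  polygon_length gamma (x - c) [seq t - c | t <- s].
Proof. by elim: s x => [//|y s IH] x /=; rewrite IH. Qed.

Lemma itv_partition_shift c (x y : R) s : itv_partition x y s ->
  itv_partition (x + c) (y + c) [seq t + c | t <- s].
Proof.
move=> [xs /eqP <-]; split; last by rewrite (last_map (fun t => t + c)).
elim: s x xs => [//|z s IH] x /= /andP[xz zs]; rewrite ltrD2r xz/=; exact: IH.
Qed.

Definition concat L (gamma1 gamma2 : R -> T) t :=
  if t <= L then gamma1 t else gamma2 (t - L).

(** The triangle inequality is assumed only across the junction, because [graph_dist] satisfies it
    only for points of the filling. *)
Lemma arclength_concat L1 L2 gamma1 gamma2 : (forall z, d z z <= 0) ->
  gamma1 L1 = gamma2 0 ->
  (forall x y, 0 <= x <= L1 -> 0 <= y <= L2 ->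
    d (gamma1 x) (gamma2 y) <=
    d (gamma1 x) (gamma1 L1) + d (gamma2 0) (gamma2 y)) ->
  arclength_curve d L1 gamma1 -> arclength_curve d L2 gamma2 ->
  arclength_curve d (L1 + L2) (concat L1 gamma1 gamma2).
Proof.
move=> dxx g12 tri a1 a2; have [L10 _] := a1; have [L20 _] := a2.
have right t : L1 <= t -> concat L1 gamma1 gamma2 t = gamma2 (t - L1).
  rewrite /concat; case: (leP t L1) => // tL Lt.
  by have -> : t = L1 by [apply/eqP; rewrite eq_le tL]; rewrite subrr.
apply: arclength_intro; first exact: addr_ge0.
  move=> x y x0 xy yL; have [yL1|L1y] := leP y L1.
    by rewrite /concat yL1 (le_trans xy yL1) (arclength_le dxx a1).
  have [xL1|L1x] := leP x L1.
    rewrite (right y (ltW L1y)) /concat xL1.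
    apply: le_trans (tri x (y - L1) _ _) _; first by rewrite x0.
      by rewrite subr_ge0 (ltW L1y) lerBlDr addrC.
    apply: (@le_trans _ _ ((L1 - x) + ((y - L1) - 0))); last by lra.
    apply: lerD; first exact: (arclength_le dxx a1).
    by apply: (arclength_le dxx a2) => //; lra.
  rewrite (right y (ltW L1y)) (right x (ltW L1x)).
  apply: (@le_trans _ _ ((y - L1) - (x - L1))); last by lra.
  by apply: (arclength_le dxx a2); lra.
have left_part x y e : 0 <= x -> x < y -> y <= L1 -> 0 < e ->
    exists2 s, itv_partition x y s &
      y - x - e < polygon_length (concat L1 gamma1 gamma2) x s.
  move=> x0 xy yL e0; have [s xys sP] := arclength_approx a1 x0 xy yL e0.
  exists s => //; rewrite (eq_polygon_length (gamma' := gamma1) _ xys)//.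
  by move=> t /andP[_ ty]; rewrite /concat (le_trans ty yL).
have right_part x y e : L1 <= x -> x < y -> y <= L1 + L2 -> 0 < e ->
    exists2 s, itv_partition x y s &
      y - x - e < polygon_length (concat L1 gamma1 gamma2) x s.
  move=> x0 xy yL e0.
  have h1 : 0 <= x - L1 by lra.
  have h2 : x - L1 < y - L1 by lra.
  have h3 : y - L1 <= L2 by lra.
  have [s xys sP] := arclength_approx a2 h1 h2 h3 e0.
  have := itv_partition_shift L1 xys; rewrite !subrK => xys'.
  exists [seq t + L1 | t <- s] => //.
  rewrite (eq_polygon_length (gamma' := fun t => gamma2 (t - L1)) _ xys'); last first.
    by move=> t /andP[xt _]; rewrite right// (le_trans x0).
  rewrite polygon_length_shift -map_comp (eq_map (g := id)) ?map_id; last first.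
    by move=> t /=; rewrite addrK.
  by lra.
move=> x y e x0 xy yL e0; have [yL1|L1y] := leP y L1; first exact: left_part.
have [L1x|xL1] := leP L1 x; first exact: right_part.
have e20 : 0 < e / 2 by rewrite divr_gt0.
have [s ps sP] := left_part x L1 (e / 2) x0 xL1 (lexx _) e20.
have [t pt tP] := right_part L1 y (e / 2) (lexx _) L1y yL e20.
exists (s ++ t); first exact: itv_partition_cat ps pt.
have lastE : last x s = L1 by case: ps => _ /eqP.
by rewrite polygon_length_cat lastE; lra.
Qed.

End arclength.

(** * The graph of the hyperbolic filling and its path metric *)

Section filling.
Context {R : realType} {Z : completeMetricType R}.
Variables (alpha tau : R) (S : int -> set Z).
Hypothesis alpha_gt1 : 1 < alpha.
Hypothesis tau_gt3 : 3 < tau.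
Hypothesis netS : filling_net alpha S.

Local Notation "'E'" := (edge alpha tau S).
Local Notation sc n := (alpha `^ (- n%:~R)).
Local Notation coords := (Z * int -> R).
Local Notation vert := (vertex S).
Local Notation fill := (filling alpha tau S).
Local Notation seg := (segment alpha tau S).
Local Notation gdist := (graph_dist alpha tau S).

Let tau_gt1 : 1 < tau. Proof. by apply: lt_trans tau_gt3; rewrite ltr1n. Qed.

Lemma sc_gt0 (n : int) : 0 < sc n. Proof. exact: pw_gt0. Qed.

Lemma scE (n : int) : alpha ^ (- n) = sc n.
Proof. by rewrite -powR_intmul ?rmorphN//= ltW// (lt_trans ltr01). Qed.

(** Otherwise [z] could be added to the net, against maximality. *)
Lemma near_ex (n : int) (z : Z) : exists s, S n s /\ mdist s z < sc n.
Proof.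
have [sepS maxS] := netS n; rewrite -scE.
have [Sz|nSz] := pselect (S n z).
  by exists z; rewrite mdistxx exprz_gt0// (lt_trans ltr01).
apply: contrapT => /forallNP H; apply: nSz.
have <- : S n `|` [set z] = S n; last by right.
apply: maxS; last by move=> x Sx; left.
move=> x y [Sx|->] [Sy|->] xy; first exact: sepS.
- by rewrite leNgt; apply/negP => xz; exact: (H x).
- by rewrite leNgt; apply/negP; rewrite metric_sym => xz; exact: (H y).
- by rewrite eqxx in xy.
Qed.

Definition near n z := projT1 (cid (near_ex n z)).
Definition nearv n z : Z * int := (near n z, n).

Lemma near_in n z : S n (near n z).
Proof. by rewrite /near; case: cid => s []. Qed.

Lemma near_lt n z : mdist (near n z) z < sc n.
Proof. by rewrite /near; case: cid => s []. Qed.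

Lemma net_uniq n s t : S n s -> S n t -> mdist s t < sc n -> s = t.
Proof.
move=> Ss St; have [st|] := eqVneq s t; first by [].
have [sepS _] := netS n; move=> st; rewrite ltNge -scE.
by rewrite sepS.
Qed.

(** Net points of one level closer than its scale coincide, so the choice made by [near] returns net
    points unchanged and every vertex has the form [nearv n z]. *)
Lemma near_net n s : S n s -> near n s = s.
Proof. by move=> Ss; apply: (net_uniq (near_in n s) Ss); exact: near_lt. Qed.

Lemma nearvK v : vert v -> nearv v.2 v.1 = v.
Proof. by case: v => s n vv; rewrite /nearv/= near_net. Qed.

Lemma vert_nearv n z : vert (nearv n z). Proof. exact: near_in. Qed.

Lemma vballE (v : Z * int) (y : Z) : vball alpha tau v y = (mdist v.1 y < tau * sc v.2) :> Prop.
Proof. by rewrite /vball/dball/= scE. Qed.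

Lemma edgeI v w y : vert v -> vert w -> v != w -> `|v.2 - w.2| <= 1 ->
  mdist v.1 y < tau * sc v.2 -> mdist w.1 y < tau * sc w.2 -> E v w.
Proof. by move=> *; split => //; exists y; split; rewrite vballE. Qed.

Lemma edge_sym v w : E v w -> E w v.
Proof.
move=> [vv vw ne le [y [yv yw]]]; split => //; first by rewrite eq_sym.
  by rewrite distrC.
by exists y.
Qed.

Lemma lt_sc_tau n x : x < sc n -> x < tau * sc n.
Proof. by move=> /lt_trans; apply; rewrite ltr_pMl ?sc_gt0. Qed.

Lemma edge_nearS n z : E (nearv n z) (nearv (n + 1) z).
Proof.
apply: (@edgeI _ _ z) => //=; do ?exact: vert_nearv; do ?exact/lt_sc_tau/near_lt.
- by rewrite /nearv; apply/eqP => -[_]; lia.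
- by lia.
Qed.

Lemma edge_dist v w : E v w -> mdist v.1 w.1 < tau * sc v.2 + tau * sc w.2.
Proof.
move=> [_ _ _ _ [y []]]; rewrite !vballE => yv yw.
by rewrite (le_lt_trans (metric_triangle _ y _))// ltrD// metric_sym.
Qed.

Lemma edge_pt0 (v w : Z * int) : edge_pt v w 0 = vertex_pt v :> coords.
Proof. by apply/funext => u; rewrite /edge_pt subr0 mul1r mul0r addr0. Qed.

Lemma edge_pt1 (v w : Z * int) : edge_pt v w 1 = vertex_pt w :> coords.
Proof. by apply/funext => u; rewrite /edge_pt subrr mul1r mul0r add0r. Qed.

Lemma edge_ptC v w t : edge_pt v w t = edge_pt w v (1 - t) :> coords.
Proof. by apply/funext => u; rewrite /edge_pt subKr addrC. Qed.

Lemma fillingP x : fill x ->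
  exists v w t, [/\ E v w, 0 <= t <= 1 & x = edge_pt v w t].
Proof.
move=> [[v vv ->]|//]; exists v, (nearv (v.2 + 1) v.1), 0.
split; rewrite ?lexx ?ler01 ?edge_pt0//.
by rewrite -{1}(nearvK vv); exact: edge_nearS.
Qed.

Lemma filling_edge v w t : E v w -> 0 <= t <= 1 -> fill (edge_pt v w t).
Proof. by move=> vw t01; right; exists v, w, t. Qed.

Lemma filling_vertex v : vert v -> fill (vertex_pt v).
Proof. by move=> vv; left; exists v. Qed.

(** Inductive form of the sequences in the definition of [graph_dist], related to them by
    [chainP]. *)
Inductive chain : coords -> coords -> R -> Prop :=
| chain0 x : chain x x 0
| chainS x y z l m : seg x y l -> chain y z m -> chain x z (l + m).

Lemma chain1 x y l : seg x y l -> chain x y l.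
Proof. by move=> xy; rewrite -[l]addr0; apply: chainS xy (chain0 _). Qed.

Lemma chain_cat x y z l m : chain x y l -> chain y z m -> chain x z (l + m).
Proof.
move=> c; elim: c z m => {x y l} [x|x y z l m xy yz IH] w k; first by rewrite add0r.
by move=> /IH zw; rewrite -addrA; exact: chainS xy zw.
Qed.

Lemma seg_sym x y l : seg x y l -> seg y x l.
Proof.
by move=> [v [w [s [t [vw s01 t01 [-> ->] ->]]]]]; exists v, w, t, s; split; rewrite // distrC.
Qed.

Lemma chain_sym x y l : chain x y l -> chain y x l.
Proof.
elim=> [z|{}x {}y z {}l m xy yz zy]; first exact: chain0.
by rewrite addrC; apply: chain_cat zy _; exact/chain1/seg_sym.
Qed.

Lemma seg_ge0 x y l : seg x y l -> 0 <= l.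
Proof. by move=> [v [w [s [t [_ _ _ _ ->]]]]]. Qed.

Lemma chain_ge0 x y l : chain x y l -> 0 <= l.
Proof. by elim=> // {}x {}y z {}l m /seg_ge0 l0 _ m0; rewrite addr_ge0. Qed.

Lemma chainP x y r : chain x y r <->
  exists (n : nat) (q : nat -> coords) (l : nat -> R),
    [/\ q 0%N = x, q n = y, (forall i, (i < n)%N -> seg (q i) (q i.+1) (l i)) &
        r = \sum_(i < n) l i].
Proof.
split.
  elim=> [{}x|{}x {}y z l m xy _ [n [q [k [q0 qn qS ->]]]]].
    by exists 0%N, (fun=> x), (fun=> 0); split => //; rewrite big_ord0.
  exists n.+1, (fun i => if i is j.+1 then q j else x), (fun i => if i is j.+1 then k j else l).
  split => //; last by rewrite big_ord_recl.
  by move=> [_|i ni]; [rewrite q0|exact: qS].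
move=> [n [q [l [<- <- qS ->]]]]; elim: n qS => [|n IH] qS.
  by rewrite big_ord0; exact: chain0.
rewrite big_ord_recr/=; apply: (@chain_cat _ (q n)).
  by apply: IH => i ni; apply: qS; rewrite ltnS ltnW.
exact/chain1/qS.
Qed.

Lemma gdistE x y : gdist x y = inf [set r | chain x y r].
Proof.
rewrite /graph_dist; congr inf; apply/seteqP; split=> r /=.
  by move=> ?; apply/chainP.
by move/chainP.
Qed.

Lemma gdist_le x y l : chain x y l -> gdist x y <= l.
Proof.
move=> xy; rewrite gdistE; apply: ge_inf => //.
by exists 0 => r /= /chain_ge0.
Qed.

Lemma chain_edge v w s t : E v w -> 0 <= s <= 1 -> 0 <= t <= 1 ->
  chain (edge_pt v w s) (edge_pt v w t) `|s - t|.
Proof. by move=> vw s01 t01; apply: chain1; exists v, w, s, t. Qed.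

Definition linked (x y : coords) := exists l, chain x y l.

Lemma linked_sym x y : linked x y -> linked y x.
Proof. by move=> [l /chain_sym xy]; exists l. Qed.

Lemma linked_trans y x z : linked x y -> linked y z -> linked x z.
Proof. by move=> [l xy] [m yz]; exists (l + m); exact: chain_cat xy yz. Qed.

Lemma linked_edge v w : E v w -> linked (vertex_pt v) (vertex_pt w).
Proof.
move=> vw; exists `|0 - 1|; rewrite -(edge_pt0 v w) -(edge_pt1 v w).
by apply: chain_edge => //; rewrite lexx ler01.
Qed.

Lemma linked_near n z (k : nat) :
  linked (vertex_pt (nearv n z)) (vertex_pt (nearv (n - k%:Z) z)).
Proof.
elim: k => [|k IH]; first by rewrite subr0; exists 0; exact: chain0.
apply: linked_trans IH _; apply/linked_sym/linked_edge.
have := edge_nearS (n - k.+1%:Z) z.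
by have -> : n - k.+1%:Z + 1 = n - k%:Z by lia.
Qed.

Lemma linked_same n a b : mdist a b < (tau - 1) * sc n ->
  linked (vertex_pt (nearv n a)) (vertex_pt (nearv n b)).
Proof.
move=> ab; have [->|ne] := eqVneq (nearv n a) (nearv n b).
  by exists 0; exact: chain0.
apply/linked_edge/(@edgeI _ _ a) => //; do ?exact: vert_nearv.
- by rewrite subrr normr0.
- exact/lt_sc_tau/near_lt.
- apply: le_lt_trans (metric_triangle _ b _) _.
  have := near_lt n b; rewrite [mdist b a]metric_sym /=; lra.
Qed.

Lemma sc_sub n (k : nat) : sc (n - k%:Z) = sc n * alpha `^ k%:R.
Proof. by rewrite -pwD// rmorphB/= opprB addrC. Qed.

(** From both vertices one moves vertically to coarser levels, until the scale exceeds the distance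
    of the two projections; there the ancestors are neighbors. *)
Lemma linked_all x y : fill x -> fill y -> linked x y.
Proof.
wlog: x y / exists2 v, vert v & x = vertex_pt v.
  move=> H fx fy; have [v [w [t [vw t01 xE]]]] := fillingP fx.
  apply: (@linked_trans (vertex_pt v)).
    exists `|t - 0|; rewrite -(edge_pt0 v w) xE.
    by apply: chain_edge => //; rewrite lexx ler01.
  by have [vv _ _ _ _] := vw; apply: H => //; [exists v|exact: filling_vertex].
move=> [v vv ->{x}] fv; wlog: y / exists2 v, vert v & y = vertex_pt v.
  move=> H fy; have [w [w' [t [ww t01 yE]]]] := fillingP fy.
  apply: (@linked_trans (vertex_pt w)).
    by have [vw _ _ _ _] := ww; apply: H => //; [exists w|exact: filling_vertex].
  exists `|0 - t|; rewrite -(edge_pt0 w w') yE.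
  by apply: chain_edge => //; rewrite lexx ler01.
move=> [w vw ->{y}] _; rewrite -(nearvK vv) -(nearvK vw).
have [k kP] := pw_unbounded alpha_gt1 (mdist v.1 w.1 / ((tau - 1) * sc v.2)).
(* The part [k] lets the scale beat the distance, and the difference of the levels puts [m] below
   both of them. *)
pose m := v.2 - (k + `|v.2 - w.2|)%N%:Z.
have t10 : 0 < tau - 1 by rewrite subr_gt0.
apply: (@linked_trans (vertex_pt (nearv m v.1))); first exact: linked_near.
apply: (@linked_trans (vertex_pt (nearv m w.1))).
  apply: linked_same; rewrite sc_sub mulrA -ltr_pdivrMl ?mulr_gt0 ?sc_gt0//.
  by rewrite mulrC; apply: kP; rewrite ler_nat leq_addr.
apply/linked_sym; have [j mj] : exists j : nat, m = w.2 - j%:Z.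
  by exists `|w.2 - m|%N; rewrite /m; lia.
by rewrite mj; exact: linked_near.
Qed.

Lemma gdist_approx x y e : fill x -> fill y -> 0 < e ->
  exists2 l, chain x y l & l < gdist x y + e.
Proof.
move=> fx fy e0; rewrite gdistE.
have [|r /= xy re] := @inf_adherent _ [set r | chain x y r] e e0.
  by split; [have [l] := linked_all fx fy; exists l|exists 0 => r /= /chain_ge0].
by exists r.
Qed.

Lemma gdist_triangle y x z : fill x -> fill y -> fill z ->
  gdist x z <= gdist x y + gdist y z.
Proof.
move=> fx fy fz; apply/ler_addgt0Pr => e e0.
have [l xy lx] := gdist_approx fx fy (divr_gt0 e0 (ltr0n _ 2)).
have [m yz my] := gdist_approx fy fz (divr_gt0 e0 (ltr0n _ 2)).
apply: le_trans (gdist_le (chain_cat xy yz)) _; lra.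
Qed.

Lemma gdist_lip (phi : coords -> R) :
  (forall v w s t, E v w -> 0 <= s <= 1 -> 0 <= t <= 1 ->
    `|phi (edge_pt v w s) - phi (edge_pt v w t)| <= `|s - t|) ->
  forall x y l, chain x y l -> `|phi x - phi y| <= l.
Proof.
move=> lip x y l; elim => [z|{}x {}y z {}l m [v [w [s [t [vw s01 t01 [-> ->] ->]]]]] _ IH].
  by rewrite subrr normr0.
by rewrite (le_trans (ler_distD (phi (edge_pt v w t)) _ _))// lerD// lip.
Qed.

Lemma gdist_lip_fill (phi : coords -> R) :
  (forall v w s t, E v w -> 0 <= s <= 1 -> 0 <= t <= 1 ->
    `|phi (edge_pt v w s) - phi (edge_pt v w t)| <= `|s - t|) ->
  forall x y, fill x -> fill y -> `|phi x - phi y| <= gdist x y.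
Proof.
move=> lip x y fx fy; apply/ler_addgt0Pr => e e0.
have [l xy lx] := gdist_approx fx fy e0.
exact: le_trans (gdist_lip lip xy) (ltW lx).
Qed.

Lemma height_edge (v w : Z * int) (t : R) : v != w ->
  height (edge_pt v w t) = (1 - t) * v.2%:~R + t * w.2%:~R :> R.
Proof.
move=> vw; rewrite /height (@fsbigE _ _ _ _ _ [:: v; w])//=.
- rewrite big_mkcond !big_cons big_nil/= !in_setT /edge_pt /vertex_pt !eqxx.
  by rewrite (eq_sym w v) (negbTE vw) !mulr0 !mulr1 !addr0 add0r.
- by rewrite inE vw.
- move=> u _; rewrite !inE negb_or => /andP[uv uw].
  by rewrite /edge_pt/vertex_pt (negbTE uv) (negbTE uw) !mulr0 addr0 mul0r.
Qed.

Lemma edge_levels v w : E v w -> `|v.2%:~R - w.2%:~R| <= 1 :> R.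
Proof. by move=> [_ _ _ vw _]; rewrite -intrB -intr_norm -[1]/(1%:~R) ler_int. Qed.

Lemma height_lip v w s t : E v w -> 0 <= s <= 1 -> 0 <= t <= 1 ->
  `|height (edge_pt v w s) - height (edge_pt v w t)| <= `|s - t| :> R.
Proof.
move=> vw _ _; have [_ _ ne _ _] := vw; rewrite !height_edge//.
have -> : (1 - s) * v.2%:~R + s * w.2%:~R - ((1 - t) * v.2%:~R + t * w.2%:~R)
  = (t - s) * (v.2%:~R - w.2%:~R) :> R by ring.
by rewrite normrM (distrC t) ler_piMr// edge_levels.
Qed.

(** * Half edges as geodesics, and the density along chains *)

Local Notation dens := (density alpha).

(* Tents are 1-Lipschitz on the graph and isometric on each half of the edge [vw],
   so half-edges are geodesics. *)
Definition tent (v w : Z * int) (x : coords) := Num.min (x v) (x w).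

Lemma tentE v w a b s : v != w -> a != b -> 0 <= s <= 1 ->
  tent v w (edge_pt a b s) =
  if (v == a) && (w == b) || (v == b) && (w == a) then Num.min s (1 - s) else 0.
Proof.
move=> vw ab /andP[s0 s1]; rewrite /tent/edge_pt/vertex_pt.
have [va|va] := eqVneq v a.
  have -> : (v == b) = false by rewrite va (negbTE ab).
  have -> : (w == a) = false by rewrite -va eq_sym (negbTE vw).
  by have [wb|wb] := eqVneq w b => /=; rewrite !minEle; do ![case: ifP]; lra.
have [vb|vb] := eqVneq v b => /=.
  have -> : (w == b) = false by rewrite -vb eq_sym (negbTE vw).
  by have [wa|wa] := eqVneq w a => /=; rewrite !minEle; do ![case: ifP]; lra.
by have [|] := eqVneq w a => _; have [|] := eqVneq w b => _ /=;
  rewrite !minEle; do ![case: ifP]; lra.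
Qed.

Lemma tent_lip v w a b s t : v != w -> E a b -> 0 <= s <= 1 -> 0 <= t <= 1 ->
  `|tent v w (edge_pt a b s) - tent v w (edge_pt a b t)| <= `|s - t|.
Proof.
move=> vw [_ _ ab _ _] s01 t01; rewrite !tentE//; case: ifP => _; last first.
  by rewrite subrr normr0.
rewrite ler_norml; have := ler_norm (s - t); have := ler_norm (t - s).
by rewrite (distrC t) !minEle; do ![case: ifP]; lra.
Qed.

Lemma tent_half v w s t : v != w -> 0 <= s -> s <= t -> t <= 1 ->
  t <= 1 / 2 \/ 1 / 2 <= s ->
  `|tent v w (edge_pt v w s) - tent v w (edge_pt v w t)| = t - s.
Proof.
move=> vw s0 st t1 h; rewrite !tentE ?eqxx//=; try by apply/andP; split; lra.
case: h => h; last first.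
  by rewrite !min_r; [rewrite ger0_norm; lra|lra|lra].
by rewrite !min_l; [rewrite ler0_norm; lra|lra|lra].
Qed.

(** One segment gives the upper bound, the tent of the edge the lower one; the tent peaks at the
    midpoint, whence the restriction to halves. *)
Lemma gdist_half v w s t : E v w -> 0 <= s -> s <= t -> t <= 1 ->
  t <= 1 / 2 \/ 1 / 2 <= s -> gdist (edge_pt v w s) (edge_pt v w t) = t - s.
Proof.
move=> vw s0 st t1 h; have [_ _ ne _ _] := vw.
have s01 : 0 <= s <= 1 by rewrite s0 (le_trans st).
have t01 : 0 <= t <= 1 by rewrite t1 (le_trans s0).
apply/eqP; rewrite eq_le; apply/andP; split.
  by have := gdist_le (chain_edge vw s01 t01); rewrite distrC ger0_norm ?subr_ge0.
rewrite -(tent_half ne s0 st t1 h); apply: gdist_lip_fill.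
- by move=> *; exact: tent_lip.
- exact: filling_edge.
- exact: filling_edge.
Qed.

Lemma gdistxx x : gdist x x <= 0.
Proof. exact/gdist_le/chain0. Qed.

Lemma dens_edge v w t : E v w ->
  dens (edge_pt v w t) = alpha `^ (- ((1 - t) * v.2%:~R + t * w.2%:~R)).
Proof. by move=> [_ _ vw _ _]; rewrite /density height_edge. Qed.

Lemma dens_gt0 (x : coords) : 0 < dens x. Proof. exact: pw_gt0. Qed.

Lemma dens_quasi v w r s t : E v w -> s <= r -> r <= t ->
  dens (edge_pt v w r) <= Num.max (dens (edge_pt v w s)) (dens (edge_pt v w t)).
Proof.
move=> vw sr rt; rewrite !dens_edge// le_max.
have [h|h] := leP (v.2%:~R : R) w.2%:~R.
  rewrite pw_le//; have : 0 <= (r - s) * (w.2%:~R - v.2%:~R).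
    by rewrite mulr_ge0 ?subr_ge0.
  by lra.
rewrite [X in _ || X]pw_le ?orbT//; have : 0 <= (t - r) * (v.2%:~R - w.2%:~R).
  by rewrite mulr_ge0 ?subr_ge0// ltW.
by lra.
Qed.

(** Test functions for lower bounds of distances: by [udist_ge] they are 1-Lipschitz for the
    uniformized distance. Taking the larger end density costs nothing in the limit, since segments
    can be subdivided. *)
Definition rho_lip (phi : coords -> R) := forall v w s t, E v w ->
  0 <= s <= 1 -> 0 <= t <= 1 ->
  `|phi (edge_pt v w s) - phi (edge_pt v w t)| <=
  `|s - t| * Num.max (dens (edge_pt v w s)) (dens (edge_pt v w t)).

Lemma dens_le (x y : coords) l : `|height x - height y| <= l -> dens y <= dens x * alpha `^ l.
Proof.
by move=> hl; rewrite -pwD// pw_le//; have := ler_norm (height x - height y); lra.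
Qed.

Lemma chain_height x y l : chain x y l -> `|height x - height y| <= l.
Proof. by apply: gdist_lip => *; exact: height_lip. Qed.

(** Along a chain of length [l] the height changes by at most [l], hence the density by at most the
    factor alpha^l. *)
Lemma chain_rho_lip phi x y l : rho_lip phi -> chain x y l ->
  `|phi x - phi y| <= l * dens x * alpha `^ l.
Proof.
move=> lip; elim => [z|{}x {}y z {}l m xy yz IH].
  by rewrite subrr normr0 !mul0r.
have l0 := seg_ge0 xy; have m0 := chain_ge0 yz.
have dyx : dens y <= dens x * alpha `^ l by exact/dens_le/chain_height/chain1.
have p1 : 1 <= alpha `^ l by rewrite -(powRr0 alpha) pw_le.
apply: le_trans (ler_distD (phi y) _ _) _.
rewrite -mulrA mulrDl; apply: lerD; last first.
  apply: le_trans IH _; rewrite -mulrA ler_wpM2l// pwD// mulrA ler_wpM2r ?powR_ge0//.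
case: xy => v [w [s [t [vw s01 t01 [xE yE] lE]]]].
have := lip _ _ _ _ vw s01 t01; rewrite -lE -xE -yE => /le_trans; apply.
rewrite ler_wpM2l//; apply: (@le_trans _ _ (dens x * alpha `^ l)).
  by rewrite ge_max dyx ler_peMr// ltW// dens_gt0.
by rewrite ler_wpM2l ?(ltW (dens_gt0 _))// pw_le// lerDl.
Qed.

(** * Line integrals of the density along curves of the graph *)

Section curve.
Variables (L : R) (gamma : R -> coords).
Hypothesis arc : arclength_curve gdist L gamma.
Hypothesis gfill : forall t, 0 <= t <= L -> fill (gamma t).

Let L0 : 0 <= L. Proof. by case: arc. Qed.

(** Clamping the parameter makes the height along the curve a 1-Lipschitz function on the whole
    line. *)
Let clip t := Num.max 0 (Num.min L t).

Let clip_id t : 0 <= t <= L -> clip t = t.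
Proof. by move=> /andP[t0 tL]; rewrite /clip min_r// max_r. Qed.

Let clip_itv t : 0 <= clip t <= L.
Proof. by rewrite /clip le_max lexx/= ge_max L0 ge_min lexx. Qed.

Let clip_lip s t : `|clip s - clip t| <= `|s - t|.
Proof.
rewrite ler_norml; have := ler_norm (s - t); have := ler_norm (t - s).
by rewrite (distrC t) /clip !minEle !maxEle; do ![case: ifP]; have := L0; lra.
Qed.

Lemma curve_chain s t e : 0 <= s -> s <= t -> t <= L -> 0 < e ->
  exists2 l, chain (gamma s) (gamma t) l & l < t - s + e.
Proof.
move=> s0 st tL e0.
have [l cl ll] := gdist_approx (gfill (introT andP (conj s0 (le_trans st tL))))
  (gfill (introT andP (conj (le_trans s0 st) tL))) e0.
exists l => //; apply: lt_le_trans ll _; rewrite lerD2r.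
exact: (arclength_le gdistxx arc).
Qed.

Lemma curve_height s t : 0 <= s -> s <= t -> t <= L ->
  `|height (gamma s) - height (gamma t)| <= t - s.
Proof.
move=> s0 st tL; apply/ler_addgt0Pr => e e0.
have [l cl ll] := curve_chain s0 st tL e0.
exact: le_trans (chain_height cl) (ltW ll).
Qed.

Let k t := height (gamma (clip t)).

Let kL s t : `|k s - k t| <= `|s - t|.
Proof.
apply: le_trans (clip_lip s t); rewrite /k.
have /andP[s0 sL] := clip_itv s; have /andP[t0 tL] := clip_itv t.
have [st|/ltW ts] := leP (clip s) (clip t).
  by rewrite (distrC (clip s)) [leRHS]ger0_norm ?subr_ge0//; exact: curve_height.
by rewrite distrC [leRHS]ger0_norm ?subr_ge0//; exact: curve_height.
Qed.

Let line_integralE : line_integral L gamma (fun z => (dens z)%:E) =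
  (\int[lebesgue_measure]_(t in `[0%R, L]) (alpha `^ (- k t))%:E)%E.
Proof.
apply: eq_integral => t; rewrite inE/= in_itv/= => tL.
by rewrite /density /k clip_id.
Qed.

(** Points of the curve are joined by chains only slightly longer than the piece of curve. The bound
    of [chain_rho_lip] is continuous in the length, so this excess disappears, and
    [growth_le_integral] applies. *)
Lemma curve_rho_lip phi : rho_lip phi ->
  (`|phi (gamma 0) - phi (gamma L)|%:E <=
   line_integral L gamma (fun z => (dens z)%:E))%E.
Proof.
move=> lip; rewrite line_integralE.
apply: (@growth_le_integral _ _ alpha_gt1 L k (phi \o gamma)) => // s t s0 st tL.
apply/ler_addgt0Pr => e e0.
have [d d0 dP] : exists2 d, 0 < d & forall x, x < t - s + d ->
    0 <= x -> x * dens (gamma s) * alpha `^ x <=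
    (t - s) * alpha `^ (- k s) * alpha `^ (t - s) + e.
  have -> : alpha `^ (- k s) = dens (gamma s).
    by rewrite /k clip_id// s0 (le_trans st).
  have cont : (fun x : R => x * dens (gamma s) * alpha `^ x) @ (t - s) -->
      (t - s) * dens (gamma s) * alpha `^ (t - s).
    apply: cvgM; first by apply: cvgMl; exact: cvg_id.
    rewrite /powR gt_eqF ?(lt_trans ltr01)//.
    apply: continuous_comp; last exact: continuous_expR.
    by apply: cvgMl; exact: cvg_id.
  move/cvgrPdist_lt/(_ _ e0)/nbhs_ballP: cont => [d /= d0 dP].
  exists d => // x xd x0; have [xts|tsx] := leP x (t - s).
    apply: (@le_trans _ _ ((t - s) * dens (gamma s) * alpha `^ (t - s))); last first.
      by rewrite lerDl ltW.
    by rewrite ler_pM ?pw_le ?powR_ge0 ?mulr_ge0 ?(ltW (dens_gt0 _))// ler_wpM2r ?(ltW (dens_gt0 _)).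
  have := dP x; rewrite /ball/= distrC ger0_norm ?subr_ge0 ?(ltW tsx)// ltrBlDl.
  by move=> /(_ xd); rewrite ltr_norml => /andP[+ _]; lra.
have [l cl ll] := curve_chain s0 st tL d0.
exact: le_trans (chain_rho_lip lip cl) (dP _ ll (chain_ge0 cl)).
Qed.

Lemma line_integral_le M : (forall t, 0 <= t <= L -> dens (gamma t) <= M) ->
  (line_integral L gamma (fun z => (dens z)%:E) <= (L * M)%:E)%E.
Proof.
move=> HM; rewrite line_integralE -[L in (L * M)%:E]subr0.
apply: integral_itv_le => //.
  apply/measurable_EFinP; apply: (measurableT_comp (measurable_powRr alpha)).
  by apply: continuous_measurable_fun => x; apply: cvgN; exact: lipschitz1_continuous.
by move=> t tL; rewrite !lee_fin powR_ge0/= /k clip_id// HM.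
Qed.

End curve.

(** * Connection by curves and the uniformized distance *)

Definition joined x y := exists L gamma,
  [/\ arclength_curve gdist L gamma, forall t, 0 <= t <= L -> fill (gamma t),
      gamma 0 = x & gamma L = y].

Lemma joined_refl x : fill x -> joined x x.
Proof.
move=> fx; exists 0, (fun=> x); split => //.
apply: isometric_arclength => // s t s0 st t0.
have -> : t = s by lra.
apply/eqP; rewrite subrr eq_le gdistxx/=.
have := gdist_lip_fill (phi := fun=> 0) _ fx fx; rewrite subrr normr0; apply.
by move=> *; rewrite normr_ge0.
Qed.

Lemma joined_trans y x z : joined x y -> joined y z -> joined x z.
Proof.
move=> [L1 [g1 [a1 f1 <- g1L]]] [L2 [g2 [a2 f2 g20 <-]]].
have [L10 _] := a1; have [L20 _] := a2.
exists (L1 + L2), (concat L1 g1 g2); split.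
- apply: arclength_concat => //; first exact: gdistxx.
    by rewrite g20.
  move=> u v u1 v2; rewrite {1}g20 -g1L; apply: gdist_triangle; do ?exact: f1.
    by apply: f1; rewrite lexx L10.
  exact: f2.
- move=> t /andP[t0 tL]; rewrite /concat; case: ifPn => [tL1|].
    by apply: f1; rewrite t0.
  by rewrite -ltNge => tL1; apply: f2; lra.
- by rewrite /concat L10.
- rewrite /concat; case: ifPn => [h|_]; last by congr g2; ring.
  have -> : L2 = 0 by apply/eqP; rewrite eq_le L20 andbT; move: h; rewrite gerDl.
  by rewrite addr0 g1L g20.
Qed.

Lemma half_curve v w s t : E v w -> 0 <= s -> s <= t -> t <= 1 ->
  t <= 1 / 2 \/ 1 / 2 <= s ->
  arclength_curve gdist (t - s) (fun r => edge_pt v w (s + r)) /\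
  forall r, 0 <= r <= t - s -> fill (edge_pt v w (s + r)).
Proof.
move=> vw s0 st t1 h; split; last first.
  by move=> r r0; apply: filling_edge => //; lra.
apply: isometric_arclength; first by rewrite subr_ge0.
move=> x y x0 xy yL; rewrite gdist_half//; [lra|lra|lra|lra|].
by case: h => h; [left|right]; lra.
Qed.

Lemma joined_edge v w s t : E v w -> 0 <= s <= 1 -> 0 <= t <= 1 ->
  joined (edge_pt v w s) (edge_pt v w t).
Proof.
have H v' w' s' t' : E v' w' -> 0 <= s' -> s' <= t' -> t' <= 1 ->
    t' <= 1 / 2 \/ 1 / 2 <= s' -> joined (edge_pt v' w' s') (edge_pt v' w' t').
  move=> vw s0 st t1 h; have [arc fl] := half_curve vw s0 st t1 h.
  exists (t' - s'), (fun r => edge_pt v' w' (s' + r)).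
  by split; rewrite // ?addr0// addrC subrK.
wlog st : v w s t / s <= t.
  move=> W vw s01 t01; have [st|/ltW ts] := leP s t; first exact: W.
  rewrite !(edge_ptC v w); apply: W; [lra|exact: edge_sym|lra|lra].
move=> vw /andP[s0 s1] /andP[t0 t1].
have [th|th] := leP t (1 / 2); first by apply: H => //; left.
have [sh|sh] := leP (1 / 2) s; first by apply: H => //; right.
apply: (@joined_trans (edge_pt v w (1 / 2))).
  by apply: H => //; [lra|lra|left].
by apply: H => //; [lra|right].
Qed.

Lemma joined_all x y : fill x -> fill y -> joined x y.
Proof.
move=> fx fy; have [l c] := linked_all fx fy.
elim: c fx fy => [z|{}x {}y z {}l m [v [w [s [t [vw s01 t01 [-> ->] _]]]]] _ IH] fx fz.
  exact: joined_refl.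
apply: joined_trans (joined_edge vw s01 t01) (IH _ fz).
exact: filling_edge.
Qed.

Local Notation udist := (uniformized_dist alpha tau S).

Section udist.

Let uset x y := [set I : \bar R | exists (L : R) (gamma : R -> coords),
    [/\ arclength_curve gdist L gamma,
        (forall t, 0 <= t <= L -> fill (gamma t)),
        gamma 0 = x, gamma L = y &
        I = line_integral L gamma (fun z => (dens z)%:E)]].

Let uset_ge0 x y : (0 <= ereal_inf (uset x y))%E.
Proof.
apply: le_ereal_inf_tmp => _ [L [gamma [_ _ _ _ ->]]].
by apply: integral_ge0 => t _; rewrite lee_fin powR_ge0.
Qed.

(** Needed because [uniformized_dist] is [fine] of this infimum. A joining curve has finite length,
    and the density on it is bounded since the height is 1-Lipschitz. *)
Let uset_fin x y : fill x -> fill y -> ereal_inf (uset x y) \is a fin_num.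
Proof.
move=> fx fy; rewrite ge0_fin_numE ?uset_ge0//.
have [L [gamma [arc gf g0 gL]]] := joined_all fx fy.
apply: le_lt_trans (ltry (L * (dens (gamma 0) * alpha `^ L))).
apply: le_trans (line_integral_le arc gf _).
  by apply: ereal_inf_lbound; exists L, gamma.
move=> t /andP[t0 tL]; apply: (le_trans (dens_le (curve_height arc gf (lexx _) t0 tL))).
by rewrite ler_wpM2l ?(ltW (dens_gt0 _))// pw_le// subr0.
Qed.

Lemma udist_ge phi x y : rho_lip phi -> fill x -> fill y ->
  `|phi x - phi y| <= udist x y.
Proof.
move=> lip fx fy; rewrite -lee_fin /uniformized_dist fineK; last exact: uset_fin.
apply: le_ereal_inf_tmp => _ [L [gamma [arc gf <- <- ->]]].
exact: curve_rho_lip.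
Qed.

Lemma udist_half v w s t : E v w -> 0 <= s -> s <= t -> t <= 1 ->
  t <= 1 / 2 \/ 1 / 2 <= s ->
  udist (edge_pt v w s) (edge_pt v w t) <=
  (t - s) * Num.max (dens (edge_pt v w s)) (dens (edge_pt v w t)).
Proof.
move=> vw s0 st t1 h; have [arc fl] := half_curve vw s0 st t1 h.
rewrite -lee_fin /uniformized_dist fineK; last first.
  by apply: uset_fin; apply: filling_edge => //; lra.
apply: le_trans (line_integral_le arc fl _).
  apply: ereal_inf_lbound; exists (t - s), (fun r => edge_pt v w (s + r)).
  by split; rewrite // ?addr0// addrC subrK.
by move=> r /andP[r0 rt]; apply: dens_quasi => //; lra.
Qed.

End udist.

(** * Distances in the completion and the boundary identification *)

Variables (Y : completeMetricType R) (iota : coords -> Y) (j : Z -> Y).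
Hypothesis compl : is_completion alpha tau S iota.
Hypothesis jP : boundary_identification alpha S iota j.

Local Notation dY := (@mdist R Y).
Local Notation la := (ln alpha).
Local Notation vpt := (fun v : Z * int => iota (vertex_pt v)).

Let la_gt0 : 0 < la. Proof. exact: ln_gt0. Qed.

Lemma rho_lip_dist phi x y : rho_lip phi -> fill x -> fill y ->
  `|phi x - phi y| <= dY (iota x) (iota y).
Proof. by move=> lip fx fy; case: compl => -> // _; exact: udist_ge. Qed.

Lemma dY_edge v w s t : E v w -> 0 <= s <= 1 -> 0 <= t <= 1 ->
  dY (iota (edge_pt v w s)) (iota (edge_pt v w t)) <=
  `|s - t| * Num.max (dens (edge_pt v w s)) (dens (edge_pt v w t)).
Proof.
have H v' w' s' t' : E v' w' -> 0 <= s' -> s' <= t' -> t' <= 1 ->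
    t' <= 1 / 2 \/ 1 / 2 <= s' ->
    dY (iota (edge_pt v' w' s')) (iota (edge_pt v' w' t')) <=
    (t' - s') * Num.max (dens (edge_pt v' w' s')) (dens (edge_pt v' w' t')).
  move=> vw s0 st t1 h; case: compl => -> ; last 2 first.
  - by apply: filling_edge => //; lra.
  - by apply: filling_edge => //; lra.
  by move=> _; exact: udist_half.
wlog st : s t / s <= t.
  move=> W vw s01 t01; have [st|/ltW ts] := leP s t; first exact: W.
  by rewrite metric_sym distrC maxC; exact: W.
move=> vw /andP[s0 s1] /andP[t0 t1]; rewrite distrC ger0_norm ?subr_ge0//.
have [th|/ltW th] := leP t (1 / 2); first by apply: H => //; left.
have [sh|/ltW sh] := leP (1 / 2) s; first by apply: H => //; right.
have h1 := H v w s (1 / 2) vw s0 sh ltac:(lra) (or_introl (lexx _)).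
have h2 := H v w (1 / 2) t vw ltac:(lra) th t1 (or_intror (lexx _)).
apply: le_trans (metric_triangle _ (iota (edge_pt v w (1 / 2))) _) _.
apply: le_trans (lerD h1 h2) _.
have -> : t - s = (1 / 2 - s) + (t - 1 / 2) by ring.
have q := dens_quasi vw sh th.
by rewrite [leRHS]mulrDl; apply: lerD; rewrite ler_wpM2l ?subr_ge0// ge_max q le_max lexx ?orbT.
Qed.

(** The derivative of alpha^(-h) / ln alpha in [h] is minus the density, and the height is
    1-Lipschitz on edges. *)
Lemma rho_lip_dens : rho_lip (fun x => dens x / la).
Proof.
move=> v w s t vw s01 t01; rewrite -mulrBl !dens_edge//.
set hs := (1 - s) * _ + _; set ht := (1 - t) * _ + _.
have hst : `|hs - ht| <= `|s - t|.
  by have := height_lip vw s01 t01; have [_ _ ne _ _] := vw; rewrite !height_edge.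
clearbody hs ht; wlog le : s t s01 t01 hs ht hst / hs <= ht.
  move=> W; have [h|/ltW h] := leP hs ht; first exact: W.
  by rewrite -opprB mulNr normrN distrC maxC; apply: W; rewrite // distrC [leRHS]distrC.
rewrite ger0_norm ?divr_ge0 ?subr_ge0 ?pw_le ?lerN2 ?(ltW la_gt0)//.
apply: le_trans (pw_diff_ge alpha_gt1 le) _.
rewrite ler_pM ?powR_ge0 ?subr_ge0// ?le_max ?lexx//.
by apply: le_trans hst; rewrite distrC ler_norm.
Qed.

Lemma dens_vertex v : vert v -> dens (vertex_pt v) = sc v.2.
Proof.
move=> vv; have E1 := edge_nearS v.2 v.1; rewrite nearvK// in E1.
by rewrite -(edge_pt0 v (nearv (v.2 + 1) v.1)) dens_edge//; congr (_ `^ _); ring.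
Qed.

Lemma dens_vertical v w t : E v w -> w.2 = v.2 + 1 ->
  dens (edge_pt v w t) = alpha `^ (- (v.2%:~R + t)).
Proof. by move=> vw wv; rewrite dens_edge// wv rmorphD/=; congr (_ `^ _); ring. Qed.

(** The test function [rho_lip_dens] gives the lower bound. The upper bound is clear up to the
    factor alpha^(y - x), and [bisection] removes that factor. *)
Lemma dY_vertical v w s t : E v w -> w.2 = v.2 + 1 -> 0 <= s -> s <= t -> t <= 1 ->
  dY (iota (edge_pt v w s)) (iota (edge_pt v w t)) =
  (dens (edge_pt v w s) - dens (edge_pt v w t)) / la.
Proof.
move=> vw wv s0 st t1.
have s01 : 0 <= s <= 1 by rewrite s0 (le_trans st).
have t01 : 0 <= t <= 1 by rewrite t1 (le_trans s0).
apply/eqP; rewrite eq_le; apply/andP; split; last first.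
  have := rho_lip_dist rho_lip_dens (filling_edge vw s01) (filling_edge vw t01).
  by rewrite -mulrBl; exact/le_trans/ler_norm.
apply: (@bisection _ _ alpha_gt1 0 1 1
    (fun s t => dY (iota (edge_pt v w s)) (iota (edge_pt v w t)))
    (fun s t => (dens (edge_pt v w s) - dens (edge_pt v w t)) / la)) => //.
- move=> x y x0 xy y1; rewrite divr_ge0 ?(ltW la_gt0)// subr_ge0 !dens_vertical//.
  by rewrite pw_le//; lra.
- by move=> x z y _ _ _ _; exact: metric_triangle.
- by move=> x z y _ _ _ _; rewrite -mulrDl addrA subrK.
- move=> x y x0 xy y1; apply: le_trans (dY_edge vw _ _) _; [lra|lra|].
  rewrite !dens_vertical// max_l; last by rewrite pw_le//; lra.
  rewrite mul1r distrC ger0_norm ?subr_ge0//.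
  have xy' : v.2%:~R + x <= v.2%:~R + y :> R by rewrite lerD2l.
  apply: le_trans (ler_wpM2l (powR_ge0 _ _) (pw_diff_le alpha_gt1 xy')).
  rewrite mulrCA -pwD//.
  have -> : v.2%:~R + y - (v.2%:~R + x) = y - x by ring.
  rewrite le_eqVlt; apply/orP; left; apply/eqP; congr (_ * _ `^ _); ring.
Qed.

(** The density is constant on a horizontal edge, and the tent vanishes on all other edges, so the
    scaled tent is a test function that attains the length. *)
Lemma dY_horizontal v w s t : E v w -> v.2 = w.2 -> 0 <= s -> s <= t -> t <= 1 ->
  t <= 1 / 2 \/ 1 / 2 <= s ->
  dY (iota (edge_pt v w s)) (iota (edge_pt v w t)) = (t - s) * sc v.2.
Proof.
move=> vw wv s0 st t1 h; have [_ _ ne _ _] := vw.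
have s01 : 0 <= s <= 1 by rewrite s0 (le_trans st).
have t01 : 0 <= t <= 1 by rewrite t1 (le_trans s0).
have densE a b r : E a b -> a.2 = b.2 -> dens (edge_pt a b r) = sc a.2.
  by move=> ab e; rewrite dens_edge// -e; congr (_ `^ _); ring.
apply/eqP; rewrite eq_le; apply/andP; split.
  apply: le_trans (dY_edge vw s01 t01) _.
  by rewrite !densE// maxxx distrC ger0_norm ?subr_ge0.
have lip : rho_lip (fun x => sc v.2 * tent v w x).
  move=> a b s' t' ab s'01 t'01; have [_ _ ne' _ _] := ab.
  rewrite -mulrBr normrM ger0_norm ?powR_ge0// mulrC.
  have [c|c] := boolP ((v == a) && (w == b) || (v == b) && (w == a)).
    have ea : a.2 = v.2.
      by case/orP: c => /andP[/eqP e1 /eqP e2]; [rewrite e1|rewrite -e2 wv].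
    have eb : a.2 = b.2 by case/orP: c => /andP[/eqP <- /eqP <-].
    by rewrite !densE// maxxx ea ler_wpM2r ?powR_ge0// tent_lip.
  by rewrite !tentE// (negbTE c) subrr normr0 mul0r mulr_ge0// le_max ltW// dens_gt0.
have := rho_lip_dist lip (filling_edge vw s01) (filling_edge vw t01).
by rewrite -mulrBr normrM ger0_norm ?powR_ge0// tent_half// mulrC.
Qed.

Lemma near_cvg z : (fun n : nat => vpt (nearv n%:Z z)) @ \oo --> j z.
Proof.
apply: (jP (s := fun n => near n%:Z z)) => n; split; first exact: near_in.
by rewrite exprnN scE; exact: near_lt.
Qed.

Lemma near_dist z e : 0 < e ->
  exists N : nat, forall n : nat, (N <= n)%N -> dY (j z) (vpt (nearv n%:Z z)) < e.
Proof.
move=> e0; have /cvg_ball/(_ _ e0) := @near_cvg z.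
by move=> -[N _ HN]; exists N => n Nn; have := HN n Nn; rewrite /= ballEmdist.
Qed.

Lemma sc_small e : 0 < e -> exists N : nat, forall n : nat, (N <= n)%N -> sc n%:Z < e.
Proof.
move=> e0; have [k kP] := pw_unbounded alpha_gt1 e^-1.
exists k => n kn; rewrite powRN -[ltRHS]invrK ltf_pV2 ?posrE ?invr_gt0 ?pw_gt0//.
by apply: kP; rewrite ler_nat.
Qed.

Lemma sc_homo (m n : int) : m <= n -> sc n <= sc m.
Proof. by move=> mn; rewrite pw_le// lerN2 ler_int. Qed.

Lemma dY_near z k (n : nat) : dY (vpt (nearv k z)) (vpt (nearv (k + n%:Z) z)) <=
  (sc k - sc (k + n%:Z)) / la.
Proof.
elim: n => [|n IH]; first by rewrite addr0 mdistxx subrr mul0r.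
apply: le_trans (metric_triangle _ (vpt (nearv (k + n%:Z) z)) _) _.
have vw := edge_nearS (k + n%:Z) z.
have := dY_vertical vw erefl (lexx 0) ler01 (lexx 1).
rewrite edge_pt0 edge_pt1 !dens_vertex; do ?exact: vert_nearv.
have -> : k + n%:Z + 1 = k + n.+1%:Z by lia.
rewrite /= => ->; apply: le_trans (lerD IH (lexx _)) _.
by rewrite -mulrDl addrA subrK.
Qed.

(** The bounds of [dY_near] telescope. The identification of the boundary speaks of natural levels
    only, so [m] is taken beyond both [N] and the integer [k]. *)
Lemma dY_j_near z k : dY (j z) (vpt (nearv k z)) <= sc k / la.
Proof.
apply/ler_addgt0Pr => e e0; have [N NP] := near_dist z e0.
pose m := maxn N `|k|%N.
have [i ki] : exists i : nat, m%:Z = k + i%:Z.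
  by exists `|m%:Z - k|%N; rewrite /m; lia.
have h1 := NP m (leq_maxl _ _).
have := dY_near z k i; rewrite -ki mulrBl => h2.
have h3 : 0 <= sc m%:Z / la by rewrite divr_ge0 ?powR_ge0 ?(ltW la_gt0).
have := metric_triangle (j z) (vpt (nearv m%:Z z)) (vpt (nearv k z)).
by rewrite [X in _ <= _ + X -> _]metric_sym; lra.
Qed.

(** The test function of [rho_lip_dens] tends to 0 along the vertices that converge to [j z]. *)
Lemma dens_j z x : fill x -> dens x / la <= dY (j z) (iota x).
Proof.
move=> fx; apply/ler_addgt0Pr => e e0; have e20 : 0 < e / 2 by rewrite divr_gt0.
have [N NP] := near_dist z e20.
have [M MP] := sc_small (mulr_gt0 e20 la_gt0).
pose m := maxn N M; have h1 := NP m (leq_maxl _ _); have := MP m (leq_maxr _ _).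
rewrite -ltr_pdivrMr// => h2.
have vm : vert (nearv m%:Z z) by exact: vert_nearv.
have := rho_lip_dist rho_lip_dens fx (filling_vertex vm); rewrite dens_vertex// => h3.
have h4 := le_trans (ler_norm _) h3.
have := metric_triangle (iota x) (j z) (vpt (nearv m%:Z z)).
by rewrite [mdist (iota x) (j z)]metric_sym; lra.
Qed.

Definition lin (f : Z * int -> R) (x : coords) : R := \sum_(v \in [set: Z * int]) x v * f v.

Lemma lin_edge f v w t : v != w -> lin f (edge_pt v w t) = (1 - t) * f v + t * f w.
Proof.
move=> vw; rewrite /lin (@fsbigE _ _ _ _ _ [:: v; w])//=.
- rewrite big_mkcond !big_cons big_nil/= !in_setT /edge_pt /vertex_pt !eqxx.
  by rewrite (eq_sym w v) (negbTE vw) !mulr0 !mulr1 !addr0 add0r.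
- by rewrite inE vw.
- move=> u _; rewrite !inE negb_or => /andP[uv uw].
  by rewrite /edge_pt/vertex_pt (negbTE uv) (negbTE uw) !mulr0 addr0 mul0r.
Qed.

Lemma lin_vertex f v : vert v -> lin f (vertex_pt v) = f v.
Proof.
move=> vv; have vw := edge_nearS v.2 v.1; rewrite nearvK// in vw.
have [_ _ ne _ _] := vw.
by rewrite -(edge_pt0 v (nearv (v.2 + 1) v.1)) lin_edge//; ring.
Qed.

Lemma sc_succ n : sc n = alpha * sc (n + 1).
Proof.
have a0 : 0 <= alpha by rewrite ltW// (lt_trans ltr01).
by rewrite -{2}(powRr1 a0) -pwD// rmorphD/=; congr (_ `^ _); ring.
Qed.

Lemma sc_adj (m n : int) : m <= n + 1 -> sc n <= alpha * sc m.
Proof.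
move=> mn; rewrite sc_succ ler_wpM2l ?sc_homo//.
by rewrite ltW// (lt_trans ltr01).
Qed.

Lemma edge_sc v w : E v w -> sc v.2 <= alpha * sc w.2 /\ sc w.2 <= alpha * sc v.2.
Proof. by move=> [_ _ _ h _]; split; apply: sc_adj; lia. Qed.

Lemma dens_ge_min v w t : E v w -> 0 <= t <= 1 ->
  Num.min (sc v.2) (sc w.2) <= dens (edge_pt v w t).
Proof.
move=> vw /andP[t0 t1]; rewrite dens_edge// ge_min.
have [h|h] := leP (v.2%:~R : R) w.2%:~R.
  apply/orP; right; rewrite pw_le// lerN2.
  have : 0 <= (1 - t) * (w.2%:~R - v.2%:~R) by rewrite mulr_ge0 ?subr_ge0.
  by lra.
apply/orP; left; rewrite pw_le// lerN2.
have : 0 <= t * (v.2%:~R - w.2%:~R) by rewrite mulr_ge0 ?subr_ge0// ltW.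
by lra.
Qed.

(** Adjacent vertices project to points at distance less than tau (1 + alpha) times the smaller of
    their scales, so this is the Lipschitz constant of the projection to [Z]. *)
Definition bilip := tau * (1 + alpha).

Lemma bilip_gt0 : 0 < bilip.
Proof.
by rewrite mulr_gt0 ?(lt_trans ltr01 tau_gt1)// addr_gt0// (lt_trans ltr01).
Qed.

Lemma rho_lip_proj z : rho_lip (fun x => lin (fun v => mdist z v.1) x / bilip).
Proof.
move=> v w s t vw s01 t01; have [_ _ ne _ _] := vw; rewrite !lin_edge//.
rewrite -mulrBl.
have -> : (1 - s) * mdist z v.1 + s * mdist z w.1 -
  ((1 - t) * mdist z v.1 + t * mdist z w.1) =
  (s - t) * (mdist z w.1 - mdist z v.1) by ring.
rewrite -mulrA normrM ler_wpM2l//.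
apply: (@le_trans _ _ (Num.min (sc v.2) (sc w.2))); last first.
  by rewrite le_max dens_ge_min.
rewrite normrM [X in _ * X]gtr0_norm ?invr_gt0 ?bilip_gt0//.
rewrite ler_pdivrMr ?bilip_gt0//.
have dd : `|mdist z w.1 - mdist z v.1| <= mdist v.1 w.1.
  rewrite ler_norml; have := metric_triangle z v.1 w.1.
  have := metric_triangle z w.1 v.1; rewrite (metric_sym w.1 v.1).
  by lra.
apply: le_trans dd _; apply: le_trans (ltW (edge_dist vw)) _.
rewrite -mulrDr /bilip mulrCA ler_wpM2l ?(ltW (lt_trans ltr01 tau_gt1))//.
have [h1 h2] := edge_sc vw.
by rewrite mulrDr mulr1 mulrC minEle; case: ifP; lra.
Qed.

Lemma mdist_vertex z v : vert v -> mdist z v.1 <= bilip * dY (j z) (vpt v).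
Proof.
move=> vv; rewrite -ler_pdivrMl ?bilip_gt0//; apply/ler_addgt0Pr => e e0.
have e20 : 0 < e / 2 by rewrite divr_gt0.
have [N NP] := near_dist z e20.
have [M MP] := sc_small (mulr_gt0 e20 bilip_gt0).
pose m := maxn N M; have h1 := NP m (leq_maxl _ _); have h2 := MP m (leq_maxr _ _).
have vm : vert (nearv m%:Z z) by exact: vert_nearv.
have := rho_lip_dist (rho_lip_proj z) (filling_vertex vv) (filling_vertex vm).
rewrite !lin_vertex//= -mulrBl => /(le_trans (ler_norm _)) h3.
have h4 : mdist z (near m%:Z z) / bilip < e / 2.
  rewrite ltr_pdivrMr ?bilip_gt0//; apply: lt_trans h2.
  by rewrite metric_sym; exact: near_lt.
have := metric_triangle (vpt v) (j z) (vpt (nearv m%:Z z)).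
rewrite [mdist (vpt v) (j z)]metric_sym; move: h3; rewrite mulrBl mulrC; lra.
Qed.

Lemma mdist_le_dZ z z' : mdist z z' <= bilip * boundary_dist j z z'.
Proof.
apply/ler_addgt0Pr => e e0; have e20 : 0 < e / 2 by rewrite divr_gt0.
have [N NP] := near_dist z' (divr_gt0 e20 bilip_gt0).
have [M MP] := sc_small e20.
pose m := maxn N M; have h1 := NP m (leq_maxl _ _); have h2 := MP m (leq_maxr _ _).
have vm : vert (nearv m%:Z z') by exact: vert_nearv.
have h3 := mdist_vertex z vm; rewrite /= in h3.
have h4 := near_lt m%:Z z'.
have h5 := metric_triangle z (near m%:Z z') z'.
have h6 := metric_triangle (j z) (j z') (vpt (nearv m%:Z z')).
have := ler_wpM2l (ltW bilip_gt0) h6; rewrite mulrDr => h7.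
have : bilip * mdist (j z') (vpt (nearv m%:Z z')) < e / 2.
  by rewrite mulrC -ltr_pdivlMr ?bilip_gt0.
by rewrite /boundary_dist; lra.
Qed.

Lemma near_adj n a b : mdist a b < (tau - 1) * sc n ->
  nearv n a = nearv n b \/ E (nearv n a) (nearv n b).
Proof.
move=> ab; have [->|ne] := eqVneq (nearv n a) (nearv n b); first by left.
right; apply: (@edgeI _ _ a) => //; do ?exact: vert_nearv.
- by rewrite subrr normr0.
- exact/lt_sc_tau/near_lt.
- apply: le_lt_trans (metric_triangle _ b _) _.
  have := near_lt n b; rewrite [mdist b a]metric_sym /=; lra.
Qed.

Lemma dY_same n a b : mdist a b < (tau - 1) * sc n ->
  dY (vpt (nearv n a)) (vpt (nearv n b)) <= sc n.
Proof.
move=> /near_adj[->|vw]; first by rewrite mdistxx ltW// sc_gt0.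
have := @dY_edge _ _ 0 1 vw; rewrite !lexx !ler01 => /(_ isT isT).
rewrite edge_pt0 edge_pt1 !dens_vertex; do ?exact: vert_nearv.
by rewrite maxxx sub0r normrN normr1 mul1r.
Qed.

(** From a boundary point to its vertex of level [n] costs at most sc n / ln alpha, once at either
    end, and the horizontal edge between the vertices costs sc n. *)
Definition bilip' := 2 / la + 1.

Lemma bilip'_gt0 : 0 < bilip'.
Proof. by rewrite addr_gt0// divr_gt0. Qed.

Lemma dZ_le_sc n a b : mdist a b < (tau - 1) * sc n ->
  boundary_dist j a b <= bilip' * sc n.
Proof.
move=> ab; have h1 := dY_j_near a n; have h2 := dY_j_near b n.
have h3 := dY_same ab.
have h4 := metric_triangle (j a) (vpt (nearv n a)) (j b).
have h5 := metric_triangle (vpt (nearv n a)) (vpt (nearv n b)) (j b).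
rewrite [mdist (vpt (nearv n b)) (j b)]metric_sym in h5.
by rewrite /bilip' mulrDl mul1r /boundary_dist mulrAC; lra.
Qed.

Lemma scale_ex x : 0 < x -> exists n, sc (n + 1) <= x < sc n.
Proof.
move=> x0; exists (Num.ceil (- (ln x / la)) - 1).
have /andP[h1 h2] := real_ceil_itv (num_real (- (ln x / la))).
rewrite subrK; set c := Num.ceil _ in h1 h2 *.
by rewrite -(pw_lnK alpha_gt1 x0) pw_le ?pw_lt//; lra.
Qed.

Lemma dZ_le_mdist a b : boundary_dist j a b <= bilip' * alpha * mdist a b.
Proof.
have [->|ab] := eqVneq a b; first by rewrite /boundary_dist !mdistxx mulr0.
have d0 : 0 < mdist a b by rewrite mdist_gt0.
have [n /andP[n1 n2]] := scale_ex d0.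
apply: (@le_trans _ _ (bilip' * sc n)).
  apply: dZ_le_sc; apply: lt_le_trans n2 _; rewrite ler_peMl ?powR_ge0//.
  by move: tau_gt3; lra.
by rewrite -mulrA ler_wpM2l ?(ltW bilip'_gt0)// sc_succ ler_wpM2l// ltW// (lt_trans ltr01).
Qed.

(** * Chains of edges inside a ball of the completion *)

Section reachability.
Variables (P : coords -> Prop) (b : Z * int).

Inductive reach : Z * int -> Prop :=
| reach0 : reach b
| reachS v w : reach v -> E v w ->
    (forall t, 0 <= t <= 1 -> P (edge_pt v w t)) -> reach w.

Definition reach_pt (x : coords) := exists v w s,
  [/\ E v w, 0 <= s <= 1, x = edge_pt v w s, reach v &
      forall t, 0 <= t <= s -> P (edge_pt v w t)].

Lemma edge_pt_l (v w : Z * int) (s : R) : v != w -> edge_pt v w s v = 1 - s :> R.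
Proof. by move=> vw; rewrite /edge_pt/vertex_pt eqxx (negbTE vw) mulr1 mulr0 addr0. Qed.

Lemma edge_pt_r (v w : Z * int) (s : R) : v != w -> edge_pt v w s w = s :> R.
Proof. by move=> vw; rewrite /edge_pt/vertex_pt eqxx eq_sym (negbTE vw) mulr1 mulr0 add0r. Qed.

Lemma edge_pt_out (v w u : Z * int) (s : R) : u != v -> u != w -> edge_pt v w s u = 0 :> R.
Proof. by move=> uv uw; rewrite /edge_pt/vertex_pt (negbTE uv) (negbTE uw) !mulr0 addr0. Qed.

(** A point has several names: a vertex lies on many edges, and an edge has two orientations.
    Barycentric coordinates match the edge that witnesses [reach_pt] with the given one, which may
    be entered from either end. *)
Lemma reach_pt_rep v w s : E v w -> 0 <= s <= 1 -> reach_pt (edge_pt v w s) ->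
  (reach v /\ forall t, 0 <= t <= s -> P (edge_pt v w t)) \/
  (reach w /\ forall t, s <= t <= 1 -> P (edge_pt v w t)).
Proof.
move=> vw s01 [v' [w' [s' [vw' s'01 e rv' Ps']]]].
have [_ _ ne _ _] := vw; have [_ _ ne' _ _] := vw'.
have /andP[s0 s1] := s01; have /andP[s'0 s'1] := s'01.
have [v'v|v'v] := eqVneq v' v.
  subst v'; left; split => // t /andP[t0 ts].
  have ss' : s = s' by have := congr1 (@^~ v) e; rewrite /= !edge_pt_l//; lra.
  have [s00|sn0] := eqVneq s 0.
    have -> : t = 0 by lra.
    by rewrite edge_pt0 -(edge_pt0 v w'); apply: Ps'; rewrite lexx.
  have ww' : w = w'.
    apply/eqP; apply: contraT => ww'; have := congr1 (@^~ w) e.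
    by rewrite /= edge_pt_r// edge_pt_out// 1?eq_sym// => s00; rewrite s00 eqxx in sn0.
  by subst w'; apply: Ps'; rewrite t0 -ss'.
have [v'w|v'w] := eqVneq v' w.
  subst v'; right; split => // t /andP[st t1].
  have ss' : s' = 1 - s.
    by have := congr1 (@^~ w) e; rewrite /= edge_pt_r// edge_pt_l//; lra.
  have [s00|sn0] := eqVneq s' 0.
    have -> : t = 1 by lra.
    by rewrite edge_pt1 -(edge_pt0 w w'); apply: Ps'; rewrite lexx.
  have w'v : w' = v.
    apply/eqP; apply: contraT => w'v; have := congr1 (@^~ w') e.
    rewrite /= [RHS]edge_pt_r// edge_pt_out// 1?eq_sym// => s00.
    by rewrite -s00 eqxx in sn0.
  by subst w'; rewrite edge_ptC; apply: Ps'; lra.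
have s'1' : s' = 1.
  by have := congr1 (@^~ v') e; rewrite /= edge_pt_out// edge_pt_l//; lra.
subst s'; have rw' : reach w' by apply: reachS rv' vw' _.
have Pw' : P (vertex_pt w') by rewrite -(edge_pt1 v' w'); apply: Ps'; rewrite lexx ler01.
have [w'v|w'v] := eqVneq w' v.
  subst w'; left; split => // t /andP[t0 ts].
  have s00 : s = 0.
    by have := congr1 (@^~ v) e; rewrite /= edge_pt_l// edge_pt_r//; lra.
  have -> : t = 0 by apply/eqP; rewrite eq_le t0 -s00 ts.
  by rewrite edge_pt0.
have [w'w|w'w] := eqVneq w' w.
  subst w'; right; split => // t /andP[st t1].
  have s11 : s = 1.
    by have := congr1 (@^~ w) e; rewrite /= edge_pt_r// edge_pt_r//; lra.
  have -> : t = 1 by apply/eqP; rewrite eq_le t1 -s11 st.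
  by rewrite edge_pt1.
have := congr1 (@^~ w') e; rewrite /= edge_pt_out// edge_pt_r// => /esym/eqP.
by rewrite oner_eq0.
Qed.

Lemma reach_pt_step v w s t : E v w -> 0 <= s <= 1 -> 0 <= t <= 1 ->
  reach_pt (edge_pt v w s) ->
  (forall r, Num.min s t <= r <= Num.max s t -> P (edge_pt v w r)) ->
  reach_pt (edge_pt v w t).
Proof.
move=> vw s01 t01 /(reach_pt_rep vw s01)[[rv Pv]|[rw Pw]] Pst.
  exists v, w, t; split => // r /andP[r0 rt].
  have [rs|sr] := leP r s; first by apply: Pv; rewrite r0.
  by apply: Pst; rewrite ge_min le_max rt (ltW sr) orbT.
exists w, v, (1 - t); split; [exact: edge_sym|lra|exact: edge_ptC| by []|].
move=> r /andP[r0 rt]; rewrite edge_ptC.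
have [rs|sr] := leP s (1 - r); first by apply: Pw; rewrite rs/=; lra.
by apply: Pst; rewrite ge_min le_max (ltW sr)/=; apply/andP; split; [apply/orP; right; lra|].
Qed.

Lemma reach_vertex v : vert v -> reach_pt (vertex_pt v) -> reach v.
Proof.
move=> vv; have vw := edge_nearS v.2 v.1; rewrite nearvK// in vw.
rewrite -(edge_pt0 v (nearv (v.2 + 1) v.1)).
move=> /(reach_pt_rep vw) -[|[]//|[rw Pw]]; first by rewrite lexx ler01.
apply: reachS rw (edge_sym vw) _ => t t01; rewrite edge_ptC; apply: Pw; lra.
Qed.

End reachability.

(** Chains with the density as cost. The cost bounds the distance from above ([wchain_dist]) and
    nearly attains it ([wchain_near]), so balls can be explored by chains that are followed edge by
    edge. *)
Inductive wchain (b : Z * int) : coords -> R -> Prop :=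
| wchain0 : wchain b (vertex_pt b) 0
| wchainS m v w s t : wchain b (edge_pt v w s) m -> E v w ->
    0 <= s <= 1 -> 0 <= t <= 1 ->
    wchain b (edge_pt v w t)
      (m + `|s - t| * Num.max (dens (edge_pt v w s)) (dens (edge_pt v w t))).

Let cost_ge0 (v w : Z * int) s t :
  0 <= `|s - t| * Num.max (dens (edge_pt v w s)) (dens (edge_pt v w t)).
Proof. by rewrite mulr_ge0// le_max ltW// dens_gt0. Qed.

Lemma wchain_ge0 b x m : wchain b x m -> 0 <= m.
Proof. by elim=> // {}m v w s t _ m0 _ _ _; rewrite addr_ge0. Qed.

Lemma wchain_dist b x m : vert b -> wchain b x m ->
  fill x /\ dY (vpt b) (iota x) <= m.
Proof.
move=> vb; elim=> [|{}m v w s t _ [_ IH] vw s01 t01].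
  by rewrite mdistxx; split => //; exact: filling_vertex.
split; first exact: filling_edge.
apply: le_trans (metric_triangle _ (iota (edge_pt v w s)) _) _.
by rewrite lerD// dY_edge.
Qed.

Lemma wchain_ex b x : vert b -> fill x -> exists m, wchain b x m.
Proof.
move=> vb fx; have [l c] := linked_all (filling_vertex vb) fx.
have H y z k : chain y z k -> (exists m, wchain b y m) -> exists m, wchain b z m.
  elim=> // {}y u {}z l' m [v [w [s [t [vw s01 t01 [-> ->] _]]]]] _ IH [m' cm].
  by apply: IH; eexists; exact: wchainS cm vw s01 t01.
by apply: H c _; exists 0; exact: wchain0.
Qed.

(** The infimum of the costs, as a function of the end point, belongs to [rho_lip] and is at most 0
    at [b]; hence it does not exceed the distance. *)
Lemma wchain_near b x e : vert b -> fill x -> 0 < e ->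
  exists2 m, wchain b x m & m < dY (vpt b) (iota x) + e.
Proof.
move=> vb fx e0; pose W y := [set m | wchain b y m].
have Winf y : fill y -> has_inf (W y).
  by move=> fy; split; [exact: wchain_ex|exists 0 => m /wchain_ge0].
have step v w s t : E v w -> 0 <= s <= 1 -> 0 <= t <= 1 ->
    inf (W (edge_pt v w t)) <= inf (W (edge_pt v w s)) +
    `|s - t| * Num.max (dens (edge_pt v w s)) (dens (edge_pt v w t)).
  move=> vw s01 t01; apply/ler_addgt0Pr => d d0.
  have [m Wm mP] := inf_adherent d0 (Winf _ (filling_edge vw s01)).
  apply: (@le_trans _ _ (m + `|s - t| * Num.max (dens (edge_pt v w s)) (dens (edge_pt v w t)))).
    apply: ge_inf; first by case: (Winf _ (filling_edge vw t01)).
    exact: wchainS Wm vw s01 t01.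
  by move: mP; lra.
have lip : rho_lip (fun y => inf (W y)).
  move=> v w s t vw s01 t01; rewrite ler_norml.
  have h1 := step v w s t vw s01 t01.
  by have := step v w t s vw t01 s01; rewrite distrC maxC; lra.
have := rho_lip_dist lip fx (filling_vertex vb) => /(le_trans (ler_norm _)).
have b0 : inf (W (vertex_pt b)) <= 0.
  apply: ge_inf; last exact: wchain0.
  by case: (Winf _ (filling_vertex vb)).
rewrite metric_sym => h.
have [m Wm mP] := inf_adherent e0 (Winf _ fx).
by exists m => //; lra.
Qed.

(** Each intermediate point is reached at cost at most [m], and thus stays within [r] of [b]. *)
Lemma wchain_reach b r x m : vert b -> wchain b x m -> m < r ->
  reach_pt (fun y => dY (vpt b) (iota y) < r) b x.
Proof.
move=> vb; elim=> [r0|{}m v w s t c IH vw s01 t01 mr].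
  have vw := edge_nearS b.2 b.1; rewrite nearvK// in vw.
  exists b, (nearv (b.2 + 1) b.1), 0; split => //; rewrite ?lexx ?ler01 ?edge_pt0//.
    exact: reach0.
  move=> t /andP[t0 t0']; have -> : t = 0 by apply/eqP; rewrite eq_le t0 t0'.
  by rewrite edge_pt0 mdistxx.
have cg := cost_ge0 v w s t; have [_ cd] := wchain_dist vb c.
apply: (reach_pt_step vw s01 t01); first by apply: IH; lra.
move=> q /andP[q1 q2]; have q01 : 0 <= q <= 1.
  by move: q1 q2; rewrite minEle maxEle; case: ifP; lra.
apply: le_lt_trans (metric_triangle _ (iota (edge_pt v w s)) _) _.
apply: le_lt_trans mr; apply: lerD => //.
apply: le_trans (dY_edge vw s01 q01) _; apply: ler_pM => //.
- by rewrite le_max ltW// dens_gt0.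
- have := ler_norm (s - t); have := ler_norm (t - s); rewrite (distrC t).
  by move: q1 q2; rewrite minEle maxEle ler_norml; case: ifP; lra.
rewrite ge_max le_max lexx/=; move: q1 q2; rewrite minEle maxEle.
by case: ifP => st q1 q2; [|rewrite maxC]; exact: dens_quasi.
Qed.

(** A deep vertex over [z] lies within [e] of [j z], and a nearly optimal chain from it to [x] costs
    less than r - e; such a chain cannot leave the ball. *)
Lemma ball_reach z r x : fill x -> dY (j z) (iota x) < r ->
  exists N : nat, forall n : nat, (N <= n)%N ->
    reach_pt (fun y => dY (j z) (iota y) < r) (nearv n%:Z z) x.
Proof.
move=> fx xr; pose e := (r - dY (j z) (iota x)) / 3.
have e0 : 0 < e by rewrite divr_gt0// subr_gt0.
have [N NP] := near_dist z e0; exists N => n Nn; have h1 := NP n Nn.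
have vb : vert (nearv n%:Z z) by exact: vert_nearv.
have [m cm mP] := wchain_near vb fx e0.
have h2 := metric_triangle (vpt (nearv n%:Z z)) (j z) (iota x).
rewrite [mdist (vpt (nearv n%:Z z)) (j z)]metric_sym in h2.
have eE : 3 * e = r - dY (j z) (iota x) by rewrite /e; field.
have mr : m < r - e by lra.
have [v [w [s [vw s01 xE rv Ps]]]] := wchain_reach vb cm mr.
have PP y : dY (vpt (nearv n%:Z z)) (iota y) < r - e -> dY (j z) (iota y) < r.
  by have := metric_triangle (j z) (vpt (nearv n%:Z z)) (iota y); lra.
exists v, w, s; split => // [|t ts]; last exact/PP/Ps.
elim: rv => [|v' w' _ rv' vw' P']; first exact: reach0.
by apply: reachS rv' vw' _ => t t01; exact/PP/P'.
Qed.

(** * Countability of the graph and measurability in the filling *)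

Variable nu : {outer_measure set Z -> \bar R}.
Hypothesis nu_reg : borel_regular nu.
Hypothesis nu_ball : balls_positive_finite mdist nu.

Local Notation nball x r := (nu (dball mdist x r)).

Lemma dball_borel (x : Z) r : borel_set (dball mdist x r).
Proof. by apply: sub_sigma_algebra; exact: mball_open. Qed.

Lemma dball_cara (x : Z) r : nu.-caratheodory (dball mdist x r).
Proof. by case: nu_reg => + _; apply; exact: dball_borel. Qed.

Lemma net_half_disj n : trivIset (S n) (fun x => dball mdist x (sc n / 2)).
Proof.
move=> x y Sx Sy [z [xz yz]]; apply: (net_uniq Sx Sy).
rewrite /dball/= in xz yz; apply: le_lt_trans (metric_triangle _ z _) _.
by rewrite (metric_sym z y); lra.
Qed.

Local Open Scope ereal_scope.

Lemma packing n (P A : set Z) : P `<=` S n ->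
  (forall x, P x -> dball mdist x (sc n / 2) `<=` A) ->
  \esum_(x in P) nball x (sc n / 2) <= nu A.
Proof.
move=> PS PA; apply: ge_ereal_sup => _ [F [finF FP] <-].
rewrite -(@measure_fin_bigcup _ _ (caratheodory_type nu)
  (nu : {measure set (caratheodory_type nu) -> \bar R}))//.
- apply: le_outer_measure => z [x Fx xz]; exact: PA (FP _ Fx) _ xz.
- by move=> x y Fx Fy; apply: net_half_disj; exact/PS/FP.
- by move=> x _; exact: dball_cara.
Qed.

(** Net points within distance [k] of a base point whose half balls have measure at least 1/(k+1)
    are finite in number, since these half balls are disjoint inside a ball of finite measure. Their
    union over [k] is the whole net. *)
Lemma net_countable n : countable (S n).
Proof.
have z0 : Z := point.
have h0 : (0 < sc n / 2)%R by rewrite divr_gt0 ?sc_gt0.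
pose P (k : nat) := [set x | [/\ S n x, (mdist z0 x < k%:R)%R &
  (k.+1%:R^-1)%:E <= nball x (sc n / 2)]].
have -> : S n = \bigcup_(k in setT) P k.
  apply/seteqP; split=> x; last by case=> k _ [].
  move=> Sx; have /andP[b0 bf] := nu_ball x h0.
  have fb : nball x (sc n / 2) \is a fin_num by rewrite ge0_fin_numE ?ltW.
  pose b := fine (nball x (sc n / 2)).
  have b0' : (0 < b)%R by rewrite -lte_fin fineK.
  exists (Num.bound (mdist z0 x) + Num.bound b^-1)%N => //; split => //.
    by rewrite natrD ltr_wpDr// archi_boundP// mdist_ge0.
  rewrite -(fineK fb) lee_fin -/b -[leRHS]invrK lef_pV2 ?posrE ?invr_gt0//.
  have := archi_boundP (ltW (b0' : 0 < b)%R); have : (0 <= b^-1)%R by rewrite invr_ge0 ltW.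
  move=> /archi_boundP /ltW /le_trans + _; apply.
  by rewrite ler_nat leqW// leq_addl.
apply: bigcup_countable => // k _; apply: finite_set_countable.
apply: contrapT => inf.
pose M := nball z0 (k%:R + sc n / 2).
have kp : (0 < k%:R + sc n / 2)%R by rewrite ltr_wpDl.
have /andP[M0 Mf] := nu_ball z0 kp.
have Mfin : M \is a fin_num by rewrite ge0_fin_numE ?ltW.
have [B BP cB] := infinite_set_fset (Num.bound (fine M * k.+1%:R)) inf.
have sumle : \esum_(x in [set` B]) nball x (sc n / 2) <= M.
  apply: (@packing n) => [x Bx|x Bx z xz]; first by have [] := BP _ Bx.
  have [_ zx _] := BP _ Bx; rewrite /dball/= in xz *.
  by apply: le_lt_trans (metric_triangle _ x _) _; rewrite ltrD.
have : \esum_(x in [set` B]) (k.+1%:R^-1)%:E <= M :> \bar R.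
  apply: le_trans sumle; apply: le_esum => x Bx.
  by have [] := BP _ Bx.
rewrite esum_fset//.
rewrite fsbig_finite//= set_fsetK big_const_seq count_predT.
rewrite -[size _]/(#|` B|) leNgt => /negP; apply.
have -> : iter #|` B| (+%E (k.+1%:R^-1)%:E) 0 = (k.+1%:R^-1 *+ #|` B|)%:E :> \bar R.
  elim: #|` B| => [|m /= ->]; first by rewrite mulr0n.
  by rewrite (mulrS _ m) EFinD.
rewrite -(fineK Mfin) lte_fin -(mulr_natr _ #|` B|) ltr_pdivlMl// mulrC.
apply: lt_le_trans (archi_boundP _) _; last by rewrite ler_nat.
by rewrite mulr_ge0// fine_ge0// ltW.
Qed.

Lemma vert_countable : countable vert.
Proof.
have -> : vert = \bigcup_(n in [set: int]) ((fun x => (x, n)) @` S n).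
  apply/seteqP; split=> [[x n] vx|v [n _ [x Sx <-]]//].
  by exists n => //; exists x.
apply: bigcup_countable; first exact: countableP.
by move=> n _; apply: sub_countable (net_countable n); exact: card_image_le.
Qed.

Definition edges : set ((Z * int) * (Z * int)) := [set e | E e.1 e.2].

Lemma edges_countable : countable edges.
Proof.
apply: sub_countable (countableX vert_countable vert_countable).
by apply: subset_card_le => -[v w] /= [vv vw _ _ _].
Qed.

Definition wt (v w : Z * int) := nu (vball alpha tau v) + nu (vball alpha tau w).

Lemma vball_dball (v : Z * int) : vball alpha tau v = dball mdist v.1 (tau * sc v.2).
Proof. by rewrite /vball scE. Qed.

Lemma tau_gt0 : (0 < tau)%R. Proof. exact: lt_trans ltr01 tau_gt1. Qed.

Lemma vball_pos_fin (v : Z * int) : 0 < nu (vball alpha tau v) < +oo.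
Proof. by rewrite vball_dball; apply: nu_ball; rewrite mulr_gt0 ?sc_gt0 ?tau_gt0. Qed.

Lemma wt_pos_fin v w : 0 < wt v w < +oo.
Proof.
have /andP[v0 vf] := vball_pos_fin v; have /andP[w0 wf] := vball_pos_fin w.
by rewrite /wt adde_gt0// lte_add_pinfty.
Qed.

Lemma wt_ge0 v w : 0 <= wt v w. Proof. by have /andP[/ltW] := wt_pos_fin v w. Qed.

Lemma wt_fin v w : wt v w \is a fin_num.
Proof. by rewrite ge0_fin_numE ?wt_ge0//; have /andP[] := wt_pos_fin v w. Qed.

Local Notation leb := (@lebesgue_measure R).
Local Notation fm := (filling_measure alpha tau S nu).
Local Notation tr := (@trace R Z).
Local Notation I01 := (`[0%R, 1%R]%classic : set R).

(** Measurability tested edge by edge. These sets form a sigma-algebra of Caratheodory sets of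
    [filling_measure], in which integrals reduce to integrals over edges. *)
Definition traceable : set (set coords) :=
  [set A | forall v w, E v w -> measurable (tr A v w : set R)].

Lemma traceE (A : set coords) v w :
  tr A v w = `[0%R, 1%R]%classic `&` edge_pt v w @^-1` A.
Proof. by apply/seteqP; split => t; rewrite /trace/= in_itv. Qed.

Lemma traceable_sigma : sigma_algebra setT traceable.
Proof.
split.
- by move=> v w _; rewrite traceE preimage_set0 setI0; exact: measurable0.
- move=> A mA v w vw; rewrite setTD traceE.
  have -> : `[0%R, 1%R] `&` edge_pt v w @^-1` (~` A) = `[0%R, 1%R]%classic `\` tr A v w.
    by rewrite traceE setDIr setDv set0U setDE.
  by apply: measurableD => //; exact: mA.
- move=> A mA v w vw; rewrite traceE preimage_bigcup setI_bigcupr.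
  by apply: bigcup_measurable => n _; rewrite -traceE; exact: mA.
Qed.

Lemma completed_lebesgueE (A : set R) : measurable A ->
  completed_lebesgue_measure A = leb A.
Proof. by []. Qed.

Lemma lebesgue_split (A X : set R) : measurable A ->
  completed_lebesgue_measure X = completed_lebesgue_measure (X `&` A) +
    completed_lebesgue_measure (X `&` ~` A).
Proof. by move=> mA; exact: (@sub_caratheodory _ _ _ (wlength idfun) A mA X). Qed.

Lemma traceable_cara : traceable `<=` fm.-caratheodory.
Proof.
move=> A mA X; rewrite /= /filling_measure -esumD; last 2 first.
- by move=> v _; apply: esum_ge0 => w _; rewrite mule_ge0 ?wt_ge0 ?outer_measure_ge0.
- by move=> v _; apply: esum_ge0 => w _; rewrite mule_ge0 ?wt_ge0 ?outer_measure_ge0.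
apply: eq_esum => v _; rewrite -esumD; last 2 first.
- by move=> w _; rewrite mule_ge0 ?wt_ge0 ?outer_measure_ge0.
- by move=> w _; rewrite mule_ge0 ?wt_ge0 ?outer_measure_ge0.
apply: eq_esum => w vw; rewrite -ge0_muleDr ?outer_measure_ge0//.
congr (_ * _); rewrite (lebesgue_split (tr X v w) (mA v w vw)).
congr (completed_lebesgue_measure _ + completed_lebesgue_measure _).
  by rewrite !traceE preimage_setI setIACA setIid.
rewrite !traceE preimage_setI; apply/seteqP; split=> t /=.
  by move=> [[t01 Xt] nA]; split => //; split => // At; exact: nA.
by move=> [t01 [Xt nA]]; split => // -[].
Qed.

Lemma traceable_fun (phi : coords -> \bar R) :
  (forall v w, E v w ->
    measurable_fun I01 (fun t => phi (edge_pt v w t))) ->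
  measurable_fun setT (phi : g_sigma_algebraType traceable -> \bar R).
Proof.
move=> mphi _ B mB; rewrite setTI; apply: sub_sigma_algebra => v w vw.
by rewrite traceE; exact: mphi.
Qed.

Lemma edges_esum (a : Z * int -> Z * int -> \bar R) : (forall v w, 0 <= a v w) ->
  \esum_(v in vert) \esum_(w in E v) a v w = \esum_(e in edges) a e.1 e.2.
Proof.
move=> a0; rewrite esum_esum//; congr (esum _ _).
by apply/seteqP; split=> -[v w] /=; [move=> []|move=> vw; split => //; case: vw].
Qed.

Lemma filling_repr : exists (k : nat -> R) (gam : nat -> R -> coords),
  [/\ forall n, (0 <= k n)%R,
      forall n, exists v w, E v w /\ gam n = edge_pt v w &
      forall a : (R -> coords) -> \bar R, (forall g, 0 <= a g) ->
        \esum_(e in edges) (wt e.1 e.2 * a (edge_pt e.1 e.2)) =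
        \sum_(n <oo) (k n)%:E * a (gam n)] .
Proof.
have [en [enD enE]] := @esum_enum R _ _ edges_countable.
exists (fun n => if en n is Some e then fine (wt e.1 e.2) else 0%R).
pose z0 : Z := point.
exists (fun n => if en n is Some e then edge_pt e.1 e.2
  else edge_pt (nearv 0 z0) (nearv (0 + 1) z0)).
split.
- by move=> n; case: (en n) => [e|]//; rewrite fine_ge0 ?wt_ge0.
- move=> n; case e : (en n) => [[v w]|].
    by exists v, w; split => //; exact: (enD _ _ e).
  by exists (nearv 0 z0), (nearv (0 + 1) z0); split => //; exact: edge_nearS.
- move=> a a0; rewrite enE; last by move=> i _; rewrite mule_ge0 ?wt_ge0.
  apply: eq_eseriesr => n _; case: (en n) => [e|]; last by rewrite mul0e.
  by rewrite fineK ?wt_fin.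
Qed.

Lemma edge_traceable v w : E v w ->
  measurable_fun I01 (edge_pt v w : R -> g_sigma_algebraType traceable).
Proof.
move=> vw _ A mA; rewrite -traceE.
have : traceable A by rewrite -(sigma_algebra_id traceable_sigma).
exact.
Qed.

Lemma filling_integral (phi : coords -> \bar R) :
  measurable_fun setT (phi : g_sigma_algebraType traceable -> \bar R) ->
  (forall x, 0 <= phi x) ->
  om_integral fm setT phi =
  \esum_(e in edges) (wt e.1 e.2 *
    \int[leb]_(t in `[0%R, 1%R]) phi (edge_pt e.1 e.2 t)).
Proof.
move=> mphi phi0; have [k [gam [k0 gamE kE]]] := filling_repr.
have mgam n : measurable_fun I01 (gam n : R -> g_sigma_algebraType traceable).
  by have [v [w [vw ->]]] := gamE n; exact: edge_traceable.
have I0 (f : coords -> \bar R) : (forall x, 0 <= f x) ->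
    forall g : R -> coords, 0 <= \int[leb]_(t in `[0%R, 1%R]) f (g t).
  by move=> f0 g; apply: integral_ge0.
have H (f : coords -> \bar R) (n : nat) : (forall x, 0 <= f x) ->
    measurable_fun setT (f : g_sigma_algebraType traceable -> \bar R) ->
    \int[leb]_(t in `[0%R, 1%R]) ((k n)%:E * f (gam n t)) =
    (k n)%:E * \int[leb]_(t in `[0%R, 1%R]) f (gam n t).
  move=> f0 mf; rewrite ge0_integralZl ?lee_fin//.
  exact: (measurableT_comp mf (mgam n)).
rewrite (@om_integral_repr _ _ fm _ traceable_cara `[0%R, 1%R]%classic
  (fun n _ => k n) gam)//.
- rewrite (kE _ (I0 _ phi0)); apply: eq_eseriesr => n _; exact: H.
move=> A mA; have tA : traceable A by rewrite -(sigma_algebra_id traceable_sigma).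
have mI : measurable_fun setT (fun x : g_sigma_algebraType traceable => (\1_A x)%:E : \bar R).
  by apply/measurable_EFinP.
have i0 x : 0 <= (\1_A x)%:E :> \bar R by rewrite lee_fin.
transitivity (\sum_(n <oo) (k n)%:E *
    \int[leb]_(t in `[0%R, 1%R]) (\1_A (gam n t))%:E); last first.
  by apply: eq_eseriesr => n _; rewrite -(H (fun x => (\1_A x)%:E)).
rewrite -(kE _ (I0 _ i0)) /= /filling_measure (edges_esum (a := fun v w =>
  (nu (vball alpha tau v) + nu (vball alpha tau w)) *
  completed_lebesgue_measure (tr A v w))); last first.
  by move=> v w; rewrite mule_ge0 ?wt_ge0 ?outer_measure_ge0.
apply: eq_esum => -[v w] vw /=; congr (_ * _).
transitivity (\int[leb]_(t in `[0%R, 1%R]) (\1_(tr A v w) t)%:E); last first.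
  apply: eq_integral => t /set_mem t01; rewrite !indicE; congr (_%:R%:E); congr nat_of_bool.
  by apply/idP/idP => /set_mem At; apply/mem_set; [move: At; rewrite traceE => -[]|rewrite traceE].
rewrite integral_indic; [|exact: measurable_itv|exact: tA].
by rewrite traceE setIAC setIid completed_lebesgueE// -traceE; exact: tA.
Qed.

(** * The weighted measure on the completion *)

Variable beta : R.
Local Notation wm := (weighted_measure alpha tau S iota nu beta).
Local Notation mu := (uniformized_measure alpha tau S iota nu beta).

Let dens_beta (x : coords) := (alpha `^ (- (beta * height x)))%:E : \bar R.

Let clip01 (t : R) : R := (Num.max 0 (Num.min 1 t))%R.

Let clip01_id (t : R) : (0 <= t <= 1)%R -> clip01 t = t.
Proof. by move=> /andP[t0 t1]; rewrite /clip01 min_r// max_r. Qed.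

Let clip01_itv (t : R) : (0 <= clip01 t <= 1)%R.
Proof. by rewrite /clip01 le_max lexx/= ge_max ler01 ge_min lexx. Qed.

Let clip01_lip (s t : R) : (`|clip01 s - clip01 t| <= `|s - t|)%R.
Proof.
rewrite ler_norml; have := ler_norm (s - t); have := ler_norm (t - s).
by rewrite (distrC t) /clip01 !minEle !maxEle; do ![case: ifP]; lra.
Qed.

Lemma edge_continuous v w : E v w ->
  continuous (fun t : R => iota (edge_pt v w (clip01 t))).
Proof.
move=> vw x; apply/cvg_ballP => e e0.
pose M := Num.max (dens (vertex_pt v)) (dens (vertex_pt w)).
have M0 : (0 < M)%R by rewrite lt_max dens_gt0.
have dM t : (0 <= t <= 1)%R -> (dens (edge_pt v w t) <= M)%R.
  by move=> /andP[t0 t1]; rewrite /M -(edge_pt0 v w) -(edge_pt1 v w) dens_quasi.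
near=> t; rewrite ballEmdist/=.
apply: le_lt_trans (dY_edge vw (clip01_itv x) (clip01_itv t)) _.
apply: (@le_lt_trans _ _ (`|x - t| * M)%R).
  apply: ler_pM => //; [by rewrite le_max ltW ?dens_gt0|].
  by rewrite ge_max !dM ?clip01_itv.
rewrite -ltr_pdivlMr//; near: t.
by apply: (@cvgr_dist_lt _ _ _ _ _ id); first [exact: cvg_id|rewrite divr_gt0].
Unshelve. all: by end_near. Qed.

Lemma edge_measurable v w : E v w ->
  measurable_fun I01 (fun t => iota (edge_pt v w t) : borel Y).
Proof.
move=> vw; apply: (eq_measurable_fun (fun t : R => iota (edge_pt v w (clip01 t)) : borel Y)).
  by move=> t /set_mem; rewrite /= in_itv/= => t01; rewrite clip01_id.
apply: (@measurable_funS _ _ _ _ setT) => //.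
apply: (@measurability _ _ R (borel Y) setT _ (@open Y)) => //.
move=> _ [U oU <-]; rewrite setTI; apply: open_measurable.
by have /continuousP := edge_continuous vw; exact.
Qed.

Lemma edge_height_measurable v w : E v w ->
  measurable_fun I01 (fun t => alpha `^ (- (beta * height (edge_pt v w t))))%R.
Proof.
move=> [_ _ vw _ _]; apply: (@measurable_funS _ _ _ _ setT) => //.
apply: (measurableT_comp (measurable_powRr alpha)).
rewrite (_ : (fun t : R => _) =
  (fun t => - (beta * ((1 - t) * v.2%:~R + t * w.2%:~R)))%R); last first.
  by apply/funext => t; rewrite height_edge.
apply: continuous_measurable_fun => x; apply: cvgN; apply: cvgM; first exact: cvg_cst.
apply: cvgD; apply: cvgM; try exact: cvg_cst; last exact: cvg_id.
by apply: cvgB; [exact: cvg_cst|exact: cvg_id].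
Qed.

(** The integrand that expresses [mu] through [filling_measure], cut off outside the filling because
    [weighted_measure] integrates over the filling only. *)
Let phiF (F : Y -> \bar R) : coords -> \bar R :=
  (fun x => dens_beta x * F (iota x)) \_ fill.

Let phiF_edge F v w t : E v w -> (0 <= t <= 1)%R ->
  phiF F (edge_pt v w t) = dens_beta (edge_pt v w t) * F (iota (edge_pt v w t)).
Proof. by move=> vw t01; rewrite /phiF patchE mem_set//; exact: filling_edge. Qed.

Let phiF_ge0 F x : (forall y, 0 <= F y) -> 0 <= phiF F x.
Proof.
by move=> F0; rewrite /phiF patchE; case: ifP => // _; rewrite mule_ge0// lee_fin powR_ge0.
Qed.

Let phiF_meas F : borel_fun F ->
  measurable_fun setT (phiF F : g_sigma_algebraType traceable -> \bar R).
Proof.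
move=> mF; apply: traceable_fun => v w vw.
apply: (eq_measurable_fun (fun t => dens_beta (edge_pt v w t) * F (iota (edge_pt v w t)))).
  by move=> t /set_mem; rewrite /= in_itv/= => t01; rewrite phiF_edge.
apply: emeasurable_funM.
  by apply/measurable_EFinP; exact: edge_height_measurable.
exact: (measurableT_comp mF (edge_measurable vw)).
Qed.

Lemma weightedE (A : set (borel Y)) :
  wm A = om_integral fm setT (phiF (fun y => (\1_A y)%:E)).
Proof.
rewrite /weighted_measure /om_integral integral_mkcond; apply: eq_integral => x _.
rewrite /phiF !patchE indicE in_setI.
have [fx|//] := boolP (x \in fill).
have -> : (x \in iota @^-1` A) = (iota x \in A) by apply/idP/idP => /set_mem ?; exact: mem_set.
by case: (iota x \in A) => /=; rewrite ?mule1 ?mule0.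
Qed.

Let wm_set (A : set (borel Y)) : measurable A ->
  measurable (fill `&` iota @^-1` A : set (g_sigma_algebraType traceable)).
Proof.
move=> mA; apply: sub_sigma_algebra => v w vw; rewrite traceE.
have -> : `[0%R, 1%R] `&` edge_pt v w @^-1` (fill `&` iota @^-1` A) =
    `[0%R, 1%R] `&` (fun t => iota (edge_pt v w t) : borel Y) @^-1` A.
  apply/seteqP; split=> t [t01]; first by move=> [_ At]; split.
  by move=> At; split => //; split => //; apply: filling_edge => //; rewrite /= in_itv in t01.
by apply: edge_measurable.
Qed.

Let wm0 : wm set0 = 0.
Proof. by rewrite /weighted_measure preimage_set0 setI0 /om_integral integral_set0. Qed.

Let wm_ge0 A : 0 <= wm A.
Proof. by apply: integral_ge0 => x _; rewrite lee_fin powR_ge0. Qed.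

Let dens_beta_meas :
  measurable_fun setT (dens_beta : g_sigma_algebraType traceable -> \bar R).
Proof.
by apply: traceable_fun => v w vw; apply/measurable_EFinP; exact: edge_height_measurable.
Qed.

Let wm_sigma : semi_sigma_additive (wm : set (borel Y) -> \bar R).
Proof.
move=> F mF tF mUF.
have mdb : measurable_fun [set: caratheodory_type fm] dens_beta.
  exact: (om_measurable_sigma traceable_cara).
have cara (A : set (borel Y)) : measurable A ->
    measurable (fill `&` iota @^-1` A : set (caratheodory_type fm)).
  by move=> mA; apply: (sigma_caratheodory traceable_cara); exact: wm_set.
pose G i := fill `&` iota @^-1` F i : set (caratheodory_type fm).
have db0 x : 0 <= dens_beta x by rewrite lee_fin powR_ge0.
rewrite /weighted_measure /om_integral preimage_bigcup setI_bigcupr.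
apply: (@semi_sigma_additive_nng_induced _ _ _ _ _ mdb db0 G).
- by move=> i; exact: cara.
- move=> a b _ _ [x [[_ Fa] [_ Fb]]]; apply: tF => //.
  by exists (iota x).
- by apply: bigcup_measurable => i _; exact: cara.
Qed.

HB.instance Definition _ := isMeasure.Build _ (borel Y) R
  (wm : set (borel Y) -> \bar R) wm0 wm_ge0 wm_sigma.

Lemma mu_borel (A : set Y) : borel_set A -> mu A = wm A.
Proof. by move=> mA; rewrite /= /uniformized_measure measurable_mu_extE. Qed.

Lemma borel_cara_mu : (@open Y) `<=` mu.-caratheodory.
Proof.
move=> A oA; apply: (@caratheodory_measurable_mu_ext _ _ (borel Y) wm).
exact: sub_sigma_algebra.
Qed.

Lemma mu_integral (F : Y -> \bar R) : borel_fun F -> (forall y, 0 <= F y) ->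
  om_integral mu setT F = \esum_(e in edges) (wt e.1 e.2 *
    \int[leb]_(t in `[0%R, 1%R])
      (dens_beta (edge_pt e.1 e.2 t) * F (iota (edge_pt e.1 e.2 t)))).
Proof.
move=> mF F0; have [k [gam [k0 gamE kE]]] := filling_repr.
have mgam n : measurable_fun I01 (fun t => iota (gam n t) : borel Y).
  by have [v [w [vw ->]]] := gamE n; exact: edge_measurable.
have mh n : measurable_fun I01 (fun t => k n * alpha `^ (- (beta * height (gam n t))))%R.
  have [v [w [vw ->]]] := gamE n; apply: measurable_funM; first exact: measurable_cst.
  exact: edge_height_measurable.
have H (f : Y -> \bar R) n : borel_fun f -> (forall y, 0 <= f y) ->
    (k n)%:E * \int[leb]_(t in `[0%R, 1%R]) phiF f (gam n t) =
    \int[leb]_(t in `[0%R, 1%R])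
      ((k n * alpha `^ (- (beta * height (gam n t))))%:E * f (iota (gam n t))).
  move=> mf f0; have [v [w [vw gE]]] := gamE n.
  rewrite -ge0_integralZl ?lee_fin//.
  - apply: eq_integral => t /set_mem; rewrite /= in_itv/= => t01.
    by rewrite gE phiF_edge// muleA EFinM.
  - rewrite gE; exact: (measurableT_comp (phiF_meas mf) (edge_traceable vw)).
  - by move=> t _; exact: phiF_ge0.
have a0 (f : Y -> \bar R) : (forall y, 0 <= f y) ->
    forall g : R -> coords, 0 <= \int[leb]_(t in `[0%R, 1%R]) phiF f (g t).
  by move=> f0 g; apply: integral_ge0 => t _; exact: phiF_ge0.
rewrite (@om_integral_repr _ _ mu _ borel_cara_mu `[0%R, 1%R]%classic
  (fun n t => k n * alpha `^ (- (beta * height (gam n t))))%R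
  (fun n t => iota (gam n t)))//.
- transitivity (\esum_(e in edges) (wt e.1 e.2 *
      \int[leb]_(t in `[0%R, 1%R]) phiF F (edge_pt e.1 e.2 t))).
    by rewrite (kE _ (a0 _ F0)); apply: eq_eseriesr => n _; rewrite H.
  apply: eq_esum => -[v w] vw /=; congr (_ * _); apply: eq_integral => t /set_mem.
  by rewrite /= in_itv/= => t01; rewrite phiF_edge.
- by move=> n t _; rewrite mulr_ge0// powR_ge0.
move=> A mA.
have mI : borel_fun (fun y => (\1_A y)%:E : \bar R) by apply/measurable_EFinP.
have I0 y : 0 <= (\1_A y)%:E :> \bar R by rewrite lee_fin.
transitivity (wm A); first exact: mu_borel.
rewrite weightedE filling_integral; last 2 first.
- exact: phiF_meas.
- by move=> x; exact: phiF_ge0.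
by rewrite (kE _ (a0 _ I0)); apply: eq_eseriesr => n _; rewrite H.
Qed.

(** A single term of the sum in [mu_integral]; the height on the edge is at most v.2 + 1. *)
Lemma mu_edge_ge (F : Y -> \bar R) v w : (0 <= beta)%R -> E v w -> borel_fun F ->
  (forall y, 0 <= F y) ->
  wt v w * ((alpha `^ (- (beta * (v.2%:~R + 1))))%:E *
    \int[leb]_(t in `[0%R, 1%R]) F (iota (edge_pt v w t))) <=
  om_integral mu setT F.
Proof.
move=> b0 vw mF F0; rewrite mu_integral//.
pose a (e : (Z * int) * (Z * int)) := wt e.1 e.2 *
  \int[leb]_(t in `[0%R, 1%R]) (dens_beta (edge_pt e.1 e.2 t) * F (iota (edge_pt e.1 e.2 t))).
apply: (@le_trans _ _ (a (v, w))); last first.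
  apply: ereal_sup_ubound; exists [set (v, w)]; last by rewrite fsbig_set1.
  by split => // e ->.
have [_ _ ne _ _] := vw.
have me : measurable_fun I01 (fun t => F (iota (edge_pt v w t))).
  exact: (measurableT_comp mF (edge_measurable vw)).
rewrite /a /=; apply: lee_wpmul2l; first exact: wt_ge0.
rewrite -ge0_integralZl//; last by rewrite lee_fin powR_ge0.
apply: ge0_le_integral => //.
- by move=> t _; rewrite mule_ge0// lee_fin powR_ge0.
- by apply: emeasurable_funM => //; exact: measurable_cst.
- apply: emeasurable_funM => //; apply/measurable_EFinP; exact: edge_height_measurable.
move=> t; rewrite /= in_itv/= => /andP[t0 t1].
rewrite lee_wpmul2r// lee_fin pw_le// lerN2 ler_wpM2l// height_edge//.
have : (w.2%:~R - v.2%:~R <= 1 :> R)%R.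
  by have := edge_levels vw; rewrite distrC; exact/le_trans/ler_norm.
by move=> /(ler_wpM2l t0); lra.
Qed.

(** Arc length is explicit, linear on horizontal edges and exponential in the parameter on vertical
    ones; [f] is its inverse. The last clause holds because the density is at most sc v.2 on the
    edge. The restriction to half edges comes from [dY_horizontal]. *)
Lemma edge_curve v w s0 t0 : E v w -> w.2 = v.2 \/ w.2 = (v.2 + 1)%R ->
  (0 <= s0 -> s0 < t0 -> t0 <= 1 -> t0 <= 1 / 2 \/ 1 / 2 <= s0 ->
  exists (L : R) (f : R -> R), [/\ 0 < L /\ measurable_fun setT f,
    arclength_curve dY L (fun y => iota (edge_pt v w (f y))),
    f 0 = s0 /\ f L = t0,
    forall y, 0 <= y <= L -> s0 <= f y <= t0 &
    forall x y, 0 <= x <= L -> 0 <= y <= L ->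
      (sc v.2)^-1 * `|x - y| <= `|f x - f y|])%R.
Proof.
move=> vw [wv|wv] s00 st t01 h; have sc0 := sc_gt0 v.2.
  exists ((t0 - s0) * sc v.2)%R, (fun y => s0 + y / sc v.2)%R.
  have itv y : (0 <= y <= (t0 - s0) * sc v.2 -> 0 <= y / sc v.2 <= t0 - s0)%R.
    by move=> /andP[y0 yL]; rewrite ler_pdivrMr// yL divr_ge0// ltW.
  split.
  - split; first by rewrite mulr_gt0// subr_gt0.
    apply: measurable_funD; first exact: measurable_cst.
    by apply: measurable_funM; [exact: measurable_id|exact: measurable_cst].
  - apply: isometric_arclength; first by rewrite mulr_ge0 ?subr_ge0// ltW.
    move=> x y x0 xy yL.
    have yl : (y / sc v.2 <= t0 - s0)%R by rewrite ler_pdivrMr.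
    have xl : (0 <= x / sc v.2)%R by rewrite divr_ge0// ltW.
    have xyl : (x / sc v.2 <= y / sc v.2)%R by rewrite ler_pM2r ?invr_gt0.
    rewrite dY_horizontal//.
    + have -> : (s0 + y / sc v.2 - (s0 + x / sc v.2) = (y - x) / sc v.2)%R by ring.
      by rewrite divfK// gt_eqF.
    + lra.
    + lra.
    + lra.
    + by case: h => h; [left|right]; lra.
  - by split; [rewrite mul0r addr0|rewrite mulfK ?gt_eqF//; ring].
  - by move=> y /itv /andP[? ?]; lra.
  - move=> x y _ _; have -> : (s0 + x / sc v.2 - (s0 + y / sc v.2) = (sc v.2)^-1 * (x - y))%R.
      by ring.
    by rewrite normrM ger0_norm// invr_ge0 ltW.
pose D t := dens (edge_pt v w t).
have DE t : D t = (alpha `^ (- (v.2%:~R + t)))%R by rewrite /D dens_vertical.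
have a0 : (0 < alpha)%R by rewrite (lt_trans ltr01).
(* By [dY_vertical], the distance from the parameter [s0] to [t] is (D s0 - D t) / ln alpha; solving
   for [t] gives [f]. *)
pose f y := (- (ln (D s0 - y * la) / la) - v.2%:~R)%R.
pose L := ((D s0 - D t0) / la)%R.
have D0 t : (0 < D t)%R by rewrite DE pw_gt0.
have Dlt : (D t0 < D s0)%R by rewrite !DE pw_lt// ltrN2 ltrD2l.
have L0 : (0 < L)%R by rewrite divr_gt0// subr_gt0.
have LE : (L * la = D s0 - D t0)%R by rewrite divfK// gt_eqF.
have arg y : (0 <= y <= L -> D t0 <= D s0 - y * la <= D s0)%R.
  move=> /andP[y0 yL]; have := ler_wpM2r (ltW la_gt0) yL; rewrite LE.
  by have := mulr_ge0 y0 (ltW la_gt0); lra.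
have Df y : (0 <= y <= L -> D (f y) = D s0 - y * la)%R.
  move=> /arg/andP[h1 h2]; rewrite DE /f.
  have -> : (- (v.2%:~R + (- (ln (D s0 - y * la) / la) - v.2%:~R)) = ln (D s0 - y * la) / la)%R.
    by ring.
  by rewrite pw_lnK// (lt_le_trans (D0 t0)).
have Dinj s t : (D s <= D t -> t <= s)%R.
  move=> Dst; rewrite leNgt; apply/negP => st'.
  by move: Dst; rewrite !DE leNgt pw_lt// ltrN2 ltrD2l.
have fitv y : (0 <= y <= L -> s0 <= f y <= t0)%R.
  move=> yL; have /andP[h1 h2] := arg _ yL.
  by apply/andP; split; apply: Dinj; rewrite Df.
have f0 : f 0%R = s0.
  apply/eqP; rewrite eq_le; apply/andP; split; apply: Dinj; rewrite Df ?mul0r ?subr0// lexx ltW//.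
have fL : f L = t0.
  have hL : (0 <= L <= L)%R by rewrite lexx ltW.
  apply/eqP; rewrite eq_le; apply/andP; split; apply: Dinj; rewrite Df// LE; lra.
have fmono x y : (0 <= x -> x <= y -> y <= L -> f x <= f y)%R.
  move=> x0 xy yL; apply: Dinj; rewrite !Df ?(le_trans x0)// ?yL ?x0 ?(le_trans xy)//.
  by rewrite lerB// ler_wpM2r// ltW.
have key x y : (0 <= x -> x <= y -> y <= L ->
    dY (iota (edge_pt v w (f x))) (iota (edge_pt v w (f y))) = y - x)%R.
  move=> x0 xy yL; have /andP[x1 x2] := fitv x ltac:(rewrite x0/=; lra).
  have /andP[y1 y2] := fitv y ltac:(rewrite yL andbT; lra).
  rewrite dY_vertical//; [|lra|exact: fmono|lra].
  rewrite -/(D (f x)) -/(D (f y)) !Df ?x0 ?yL ?(le_trans x0)//= ?(le_trans xy)//.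
  have -> : (D s0 - x * la - (D s0 - y * la) = (y - x) * la)%R by ring.
  by rewrite mulfK// gt_eqF.
exists L, f; split => //.
- split => //; apply: measurable_funB; last exact: measurable_cst.
  apply: measurableT_comp => //; apply: measurable_funM; last exact: measurable_cst.
  apply: (measurableT_comp (@measurable_ln R)); apply: measurable_funB.
    exact: measurable_cst.
  by apply: measurable_funM; [exact: measurable_id|exact: measurable_cst].
- by apply: isometric_arclength => //; exact: ltW.
- have H x y : (0 <= x -> x <= y -> y <= L -> (sc v.2)^-1 * (y - x) <= f y - f x)%R.
    move=> x0 xy yL; rewrite mulrC ler_pdivrMr//.
    have /andP[x1 x2] := fitv x ltac:(rewrite x0/=; lra).
    have fxy := fmono _ _ x0 xy yL.
    rewrite -key//; apply: le_trans (dY_edge vw _ _) _; [lra| |].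
      by have /andP[y1 y2] := fitv y ltac:(rewrite yL andbT; lra); lra.
    rewrite distrC ger0_norm ?subr_ge0// ler_wpM2l ?subr_ge0//.
    rewrite -/(D (f x)) -/(D (f y)) ge_max !DE !pw_le// lerN2; lra.
  move=> x y /andP[x0 xL] /andP[y0 yL].
  have [xy|/ltW yx] := leP x y.
    rewrite distrC ger0_norm ?subr_ge0// (distrC (f x)) ger0_norm ?subr_ge0 ?fmono//; exact: H.
  by rewrite ger0_norm ?subr_ge0// ger0_norm ?subr_ge0 ?fmono//; exact: H.
Qed.

(** * Line integrals over pieces of edges *)

Hypothesis beta_ge0 : (0 <= beta)%R.

(** Clamped so as to be measurable on the whole line, as [integral_expanding] requires. *)
Let edge_ext (F : Y -> \bar R) v w (t : R) := F (iota (edge_pt v w (clip01 t))).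

Let edge_ext_meas F v w : E v w -> borel_fun F ->
  measurable_fun [set: R] (edge_ext F v w).
Proof.
move=> vw mF; apply: (measurableT_comp mF).
apply: (@measurability _ _ R (borel Y) setT _ (@open Y)) => //.
move=> _ [U oU <-]; rewrite setTI; apply: open_measurable.
by have /continuousP := edge_continuous vw; exact.
Qed.

Let edge_extE F v w (D : set R) : (D `<=` I01)%classic ->
  \int[leb]_(t in D) edge_ext F v w t = \int[leb]_(t in D) F (iota (edge_pt v w t)).
Proof.
move=> D01; apply: eq_integral => t /set_mem/D01; rewrite /= in_itv/= => t01.
by rewrite /edge_ext clip01_id.
Qed.

Lemma sub_I01 (s t : R) : (0 <= s)%R -> (t <= 1)%R -> (`[s, t] `<=` I01)%classic.
Proof. by move=> s0 t1 x; rewrite /= !in_itv/= => /andP[? ?]; lra. Qed.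

Lemma line_edge_le F v w s0 t0 L (f : R -> R) : E v w -> borel_fun F -> (forall y, 0 <= F y) ->
  (0 <= s0)%R -> (t0 <= 1)%R -> measurable_fun [set: R] f ->
  (forall y, 0 <= y <= L -> s0 <= f y <= t0)%R ->
  (forall x y, 0 <= x <= L -> 0 <= y <= L ->
      (sc v.2)^-1 * `|x - y| <= `|f x - f y|)%R ->
  line_integral L (fun y => iota (edge_pt v w (f y))) F <=
  (sc v.2)%:E * \int[leb]_(t in `[s0, t0]) F (iota (edge_pt v w t)).
Proof.
move=> vw mF F0 s00 t01 mf fitv fexp.
rewrite -(edge_extE F v w (sub_I01 s00 t01)) /line_integral.
have -> : \int[leb]_(t in `[0%R, L]) F (iota (edge_pt v w (f t))) =
    \int[leb]_(t in `[0%R, L]) edge_ext F v w (f t).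
  apply: eq_integral => t /set_mem; rewrite /= in_itv/= => /fitv/andP[h1 h2].
  by rewrite /edge_ext clip01_id//; lra.
rewrite -[X in X%:E * _]invrK; apply: integral_expanding => //.
- by rewrite invr_gt0 sc_gt0.
- exact: edge_ext_meas.
- by move=> x; exact: F0.
Qed.

Lemma integral_edge_rev F v w s t : E v w -> borel_fun F -> (forall y, 0 <= F y) ->
  (0 <= s)%R -> (t <= 1)%R ->
  \int[leb]_(r in `[(1 - t)%R, (1 - s)%R]) F (iota (edge_pt w v r)) <=
  \int[leb]_(r in `[s, t]) F (iota (edge_pt v w r)).
Proof.
move=> vw mF F0 s0 t1; rewrite -(edge_extE F v w (sub_I01 s0 t1)).
have -> : \int[leb]_(r in `[(1 - t)%R, (1 - s)%R]) F (iota (edge_pt w v r)) =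
    \int[leb]_(r in `[(1 - t)%R, (1 - s)%R]) edge_ext F v w (1 - r)%R.
  apply: eq_integral => r /set_mem; rewrite /= in_itv/= => /andP[h1 h2].
  by rewrite /edge_ext clip01_id ?(edge_ptC v w) ?subKr//; lra.
rewrite -[leRHS]mul1e -[X in X%:E * _]invr1.
apply: (@integral_expanding _ _ _ 1%R (fun r => 1 - r)%R) => //.
- by apply: measurable_funB; [exact: measurable_cst|exact: measurable_id].
- move=> x y _ _; have -> : (1 - x - (1 - y) = y - x)%R by ring.
  by rewrite mul1r distrC.
- by move=> x; rewrite /= in_itv/= => /andP[? ?]; lra.
- exact: edge_ext_meas.
- by move=> x; exact: F0.
Qed.

Lemma le_integral_edge F v w s t s' t' : E v w -> borel_fun F -> (forall y, 0 <= F y) ->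
  (0 <= s')%R -> (s' <= s)%R -> (t <= t')%R -> (t' <= 1)%R ->
  \int[leb]_(r in `[s, t]) F (iota (edge_pt v w r)) <=
  \int[leb]_(r in `[s', t']) F (iota (edge_pt v w r)).
Proof.
move=> vw mF F0 s'0 ss tt t'1.
have h1 : (`[s, t] `<=` I01)%classic by apply: sub_I01; [exact: le_trans s'0 ss|exact: le_trans tt t'1].
rewrite -(edge_extE F v w h1) -(edge_extE F v w (sub_I01 s'0 t'1)).
apply: ge0_subset_integral => //.
- exact: measurable_funS (edge_ext_meas vw mF).
- by move=> x _; exact: F0.
- by move=> x; rewrite /= !in_itv/= => /andP[? ?]; lra.
Qed.

Lemma integral_edge_split F v w s r t : E v w -> borel_fun F -> (forall y, 0 <= F y) ->
  (0 <= s)%R -> (s <= r)%R -> (r <= t)%R -> (t <= 1)%R ->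
  \int[leb]_(x in `[s, t]) F (iota (edge_pt v w x)) =
  \int[leb]_(x in `[s, r]) F (iota (edge_pt v w x)) +
  \int[leb]_(x in `[r, t]) F (iota (edge_pt v w x)).
Proof.
move=> vw mF F0 s0 sr rt t1.
have r0 := le_trans s0 sr; have r1 := le_trans rt t1.
rewrite -(edge_extE F v w (sub_I01 s0 t1)) -(edge_extE F v w (sub_I01 s0 r1)).
rewrite -(edge_extE F v w (sub_I01 r0 t1)).
by apply: integral_itv_split => //; [exact: edge_ext_meas|move=> x; exact: F0].
Qed.

(** * Young's inequality and the modulus of edges *)

Variable p : R.
Hypothesis p_ge1 : (1 <= p)%R.

Let p_gt0 : (0 < p)%R. Proof. exact: lt_le_trans ltr01 p_ge1. Qed.

(** Takes the place of Hölder's inequality throughout, with [c] chosen according to the purpose. For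
    x > c it follows from x = x^(1-p) x^p, as x^(1-p) is nonincreasing. *)
Lemma young (x : \bar R) c : (0 < c)%R -> 0 <= x ->
  x <= c%:E + (c `^ (1 - p))%:E * x `^ p.
Proof.
move=> c0; case: x => [x| |]//; last first.
  by move=> _; rewrite poweRyr ?gt_eqF// gt0_muley ?lte_fin ?powR_gt0// addey// leey.
rewrite lee_fin => x0; rewrite poweR_EFin -EFinM -EFinD lee_fin.
have [xc|cx] := leP x c; first by rewrite (le_trans xc)// lerDl mulr_ge0// powR_ge0.
have x0' := lt_trans c0 cx.
apply: (@le_trans _ _ (c `^ (1 - p) * x `^ p)%R); last by rewrite lerDr ltW.
have xE : (x = x `^ (1 - p) * x `^ p)%R.
  by rewrite -powRD ?subrK ?powRr1 ?(ltW x0')// gt_eqF// implybT.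
rewrite {1}xE ler_wpM2r ?powR_ge0//.
rewrite -opprB !powRN lef_pV2 ?posrE ?powR_gt0//.
by rewrite ge0_ler_powR ?subr_ge0// ?nnegrE ltW.
Qed.

Lemma borel_pow (F : Y -> \bar R) : borel_fun F -> borel_fun (fun x => F x `^ p : \bar R).
Proof. by move=> mF; exact: (measurableT_comp (@measurable_poweR R p) mF). Qed.

Lemma edge_young F v w c : E v w -> borel_fun F -> (forall y, 0 <= F y) -> (0 < c)%R ->
  \int[leb]_(t in `[0%R, 1%R]) F (iota (edge_pt v w t)) <=
  c%:E + (c `^ (1 - p))%:E *
    \int[leb]_(t in `[0%R, 1%R]) (F (iota (edge_pt v w t)) `^ p).
Proof.
move=> vw mF F0 c0.
have me : measurable_fun I01 (fun t => F (iota (edge_pt v w t))).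
  exact: (measurableT_comp mF (edge_measurable vw)).
have mep : measurable_fun I01 (fun t => F (iota (edge_pt v w t)) `^ p).
  exact: (measurableT_comp (borel_pow mF) (edge_measurable vw)).
have -> : c%:E = \int[leb]_(t in `[0%R, 1%R]) c%:E.
  rewrite integral_cst//= lebesgue_measure_itv/= lte_fin ltr01.
  by rewrite -EFinB subr0 mule1.
have pc : 0 <= (c `^ (1 - p))%:E :> \bar R by rewrite lee_fin powR_ge0.
rewrite -ge0_integralZl//; last by move=> t _; exact: poweR_ge0.
rewrite -ge0_integralD//.
- apply: ge0_le_integral => //.
  + by apply: emeasurable_funD => //; apply: emeasurable_funM => //; exact: measurable_cst.
  + by move=> t _; exact: young.
- by move=> t _; rewrite lee_fin ltW.
- by move=> t _; rewrite mule_ge0// poweR_ge0.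
- by apply: emeasurable_funM => //; exact: measurable_cst.
Qed.

Lemma lp_edge_fin F v w : E v w -> borel_fun F -> (forall y, 0 <= F y) ->
  om_integral mu setT (fun x => F x `^ p) < +oo ->
  \int[leb]_(t in `[0%R, 1%R]) (F (iota (edge_pt v w t)) `^ p) < +oo /\
  \int[leb]_(t in `[0%R, 1%R]) F (iota (edge_pt v w t)) < +oo.
Proof.
move=> vw mF F0 Ffin.
have h := mu_edge_ge beta_ge0 vw (borel_pow mF) (fun y => poweR_ge0 (F y) p).
have {}h := le_lt_trans h Ffin.
set I := \int[leb]_(t in _) _ in h *.
have I0 : 0 <= I by apply: integral_ge0 => t _; exact: poweR_ge0.
have If : I < +oo.
  rewrite ltNge; apply/negP; rewrite leye_eq => /eqP Ie.
  move: h; rewrite Ie gt0_muley ?lte_fin ?pw_gt0// gt0_muley ?ltxx//.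
  by have /andP[] := wt_pos_fin v w.
split => //; apply: le_lt_trans (edge_young vw mF F0 ltr01) _.
by rewrite powR1 mul1e lte_add_pinfty// ltry.
Qed.

(* Young's inequality turns admissibility for a curve along an edge into a positive
   lower bound for the energy. *)
Lemma edge_nonexceptional Gamma v w s0 t0 L (f : R -> R) : E v w ->
  (0 <= s0)%R -> (t0 <= 1)%R -> measurable_fun [set: R] f ->
  (forall y, 0 <= y <= L -> s0 <= f y <= t0)%R ->
  (forall x y, 0 <= x <= L -> 0 <= y <= L ->
      (sc v.2)^-1 * `|x - y| <= `|f x - f y|)%R ->
  modulus mu p Gamma = 0 -> ~ Gamma (L, fun y => iota (edge_pt v w (f y))).
Proof.
move=> vw s00 t01 mf fitv fexp mod0 Gc.
(* With this [c] the constant term of Young's inequality accounts for exactly one half of the lower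
   bound 1. *)
pose c := ((sc v.2)^-1 / 2)%R; have sc0 := sc_gt0 v.2.
have c0 : (0 < c)%R by rewrite divr_gt0// invr_gt0.
pose a := (alpha `^ (- (beta * (v.2%:~R + 1))))%R.
have a0 : (0 < a)%R by rewrite pw_gt0.
pose W := fine (wt v w).
have WE : wt v w = W%:E by rewrite /W fineK// wt_fin.
have W0 : (0 < W)%R by rewrite -lte_fin -WE; have /andP[] := wt_pos_fin v w.
pose K := (sc v.2 * c `^ (1 - p))%R.
have K0 : (0 < K)%R by rewrite mulr_gt0// powR_gt0.
have : (((W * a) / K / 2)%R)%:E <= modulus mu p Gamma.
  apply: le_ereal_inf_tmp => _ [h [mh h0 hG] <-].
  have h1 := hG _ Gc; rewrite /= in h1.
  have h2 := line_edge_le vw mh h0 s00 t01 mf fitv fexp.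
  have h3 := le_integral_edge vw mh h0 (lexx 0%R) s00 t01 (lexx 1%R).
  have h4 := edge_young vw mh h0 c0.
  have h5 := mu_edge_ge beta_ge0 vw (borel_pow mh) (fun y => poweR_ge0 (h y) p).
  apply: le_trans h5; rewrite -/a.
  set I := \int[leb]_(t in _) (h _ `^ p) in h4 *.
  have I0 : 0 <= I by apply: integral_ge0 => t _; exact: poweR_ge0.
  have h6 : 1 <= (sc v.2)%:E * (c%:E + (c `^ (1 - p))%:E * I).
    apply: le_trans h1 (le_trans h2 _); rewrite lee_pmul2l//.
    exact: le_trans h3 h4.
  rewrite WE; clear h4; clearbody I; case: I I0 h6 => [I| |]//.
    rewrite lee_fin => I0; rewrite -(EFinM (c `^ (1 - p)) I) -EFinD -!EFinM !lee_fin.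
    rewrite mulrDr mulrA -/K /c mulrA divff ?gt_eqF// => h6.
    rewrite [leLHS]mulrAC -mulrA [leRHS]mulrA ler_pM2l ?mulr_gt0//.
    by rewrite ler_pdivrMr// (mulrC I); move: h6; lra.
  by move=> _ _; rewrite !gt0_muley ?lte_fin// leey.
by rewrite mod0 lee_fin leNgt !mulr_gt0// ?invr_gt0// ?mulr_gt0.
Qed.

Lemma modulus_set0 : modulus mu p set0 = 0.
Proof.
apply/eqP; rewrite eq_le; apply/andP; split; last first.
  apply: le_ereal_inf_tmp => _ [h _ <-]; apply: integral_ge0 => x _; exact: poweR_ge0.
apply: ereal_inf_lbound; exists (fun=> 0).
  by split => //; exact: measurable_cst.
by apply: integral0_eq => x _; rewrite poweR_EFin powR0// gt_eqF.
Qed.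

Lemma upper_weak_upper_gradient u g :
  upper_gradient u g -> weak_upper_gradient mu p u g.
Proof.
move=> [mg g0 gu]; split => //; exists set0; split => //.
- exact: modulus_set0.
- by move=> c pc _; exact: gu.
Qed.

(** * The function [u] along edges *)

Section weak_gradient.
Variables (u g : Y -> \bar R).
Hypothesis wug : weak_upper_gradient mu p u g.
Hypothesis gp : om_integral mu setT (fun x => g x `^ p) < +oo.

Let mg : borel_fun g. Proof. by case: wug. Qed.
Let g0 y : 0 <= g y. Proof. by case: wug. Qed.

Lemma gradient_half v w s0 t0 : E v w -> w.2 = v.2 \/ w.2 = (v.2 + 1)%R ->
  (0 <= s0)%R -> (s0 < t0)%R -> (t0 <= 1)%R -> (t0 <= 1 / 2 \/ 1 / 2 <= s0)%R ->
  `|u (iota (edge_pt v w s0)) - u (iota (edge_pt v w t0))| <=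
  (sc v.2)%:E * \int[leb]_(t in `[s0, t0]) g (iota (edge_pt v w t)).
Proof.
move=> vw lev s00 st t01 h.
have [L [f [[L0 mf] arc [f0 fL] fitv fexp]]] := edge_curve vw lev s00 st t01 h.
have [_ _ [Gamma [_ mod0 gu]]] := wug.
have nG := edge_nonexceptional vw s00 t01 mf fitv fexp mod0.
have := gu (L, _) (conj L0 arc) nG; rewrite /gradient_ineq /= f0 fL => /le_trans; apply.
exact: line_edge_le.
Qed.

Let int_fin v w s t : E v w -> (0 <= s)%R -> (t <= 1)%R ->
  \int[leb]_(r in `[s, t]) g (iota (edge_pt v w r)) < +oo.
Proof.
move=> vw s0 t1; have [_] := lp_edge_fin vw mg g0 gp; apply: le_lt_trans.
exact: le_integral_edge.
Qed.

Let half_fin v w s0 t0 : E v w -> w.2 = v.2 \/ w.2 = (v.2 + 1)%R ->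
  (0 <= s0)%R -> (s0 < t0)%R -> (t0 <= 1)%R -> (t0 <= 1 / 2 \/ 1 / 2 <= s0)%R ->
  u (iota (edge_pt v w s0)) \is a fin_num /\ u (iota (edge_pt v w t0)) \is a fin_num.
Proof.
move=> vw lev s00 st t01 h; apply: abse_sub_fin.
apply: le_lt_trans (gradient_half vw lev s00 st t01 h) _.
by rewrite lte_mul_pinfty ?lee_fin ?ltW ?sc_gt0// int_fin.
Qed.

Lemma edge_orient v w : E v w ->
  (w.2 = v.2 \/ w.2 = (v.2 + 1)%R) \/ v.2 = (w.2 + 1)%R.
Proof.
move=> [_ _ _ h _]; have : w.2 = v.2 \/ w.2 = (v.2 + 1)%R \/ v.2 = (w.2 + 1)%R by lia.
by tauto.
Qed.

(** The left side of the gradient inequality is infinite as soon as one value of [u] is, while the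
    integral of [g] over an edge is finite. Every point lies on a nontrivial piece of a half
    edge. *)
Lemma u_fin x : fill x -> u (iota x) \is a fin_num.
Proof.
move=> fx; have [v [w [t [vw t01 ->]]]] := fillingP fx.
have H v' w' t' : E v' w' -> (0 <= t' <= 1)%R -> w'.2 = v'.2 \/ w'.2 = (v'.2 + 1)%R ->
    u (iota (edge_pt v' w' t')) \is a fin_num.
  move=> vw' /andP[t0 t1] lev; have [th|ht|te] := ltgtP t' (1 / 2)%R.
  - have h2 : (1 / 2 <= 1 :> R)%R by lra.
    by have [] := half_fin vw' lev t0 th h2 (or_introl (lexx _)).
  - have h2 : (0 <= 1 / 2 :> R)%R by lra.
    by have [] := half_fin vw' lev h2 ht t1 (or_intror (lexx _)).
  - have h2 : (0 < t')%R by rewrite te divr_gt0.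
    by have [] := half_fin vw' lev (lexx 0%R) h2 t1 (or_introl (eq_ind _ (fun x => x <= _)%R (lexx _) _ (esym te))).
have [lev|lev] := edge_orient vw; first exact: H.
by rewrite edge_ptC; apply: H; [exact: edge_sym|lra|right].
Qed.

Definition uval x := fine (u (iota x)).

Let uval_sub x y : fill x -> fill y ->
  (`|uval x - uval y|%R)%:E = `|u (iota x) - u (iota y)|.
Proof. by move=> fx fy; rewrite -abse_EFin EFinB /uval !fineK ?u_fin. Qed.

(** The factor alpha covers both orientations: an edge that leads to a coarser level is reversed,
    and the scales of its ends differ by at most this factor. *)
Lemma uval_edge v w s t : E v w -> (0 <= s)%R -> (s <= t)%R -> (t <= 1)%R ->
  (`|uval (edge_pt v w s) - uval (edge_pt v w t)|%R)%:E <=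
  (alpha * sc v.2)%:E * \int[leb]_(r in `[s, t]) g (iota (edge_pt v w r)).
Proof.
have I0 v' w' s' t' : 0 <= \int[leb]_(r in `[s', t']) g (iota (edge_pt v' w' r)).
  exact: integral_ge0.
have half v' w' s' t' : E v' w' -> w'.2 = v'.2 \/ w'.2 = (v'.2 + 1)%R ->
    (0 <= s')%R -> (s' <= t')%R -> (t' <= 1)%R -> (t' <= 1 / 2 \/ 1 / 2 <= s')%R ->
    (`|uval (edge_pt v' w' s') - uval (edge_pt v' w' t')|%R)%:E <=
    (sc v'.2)%:E * \int[leb]_(r in `[s', t']) g (iota (edge_pt v' w' r)).
  move=> vw lev s0 st t1 h; have [<-|ne] := eqVneq s' t'.
    by rewrite subrr normr0 mule_ge0// lee_fin ltW// sc_gt0.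
  rewrite uval_sub; [|by apply: filling_edge => //; lra|by apply: filling_edge => //; lra].
  by apply: gradient_half => //; rewrite lt_neqAle ne.
have H v' w' s' t' : E v' w' -> w'.2 = v'.2 \/ w'.2 = (v'.2 + 1)%R ->
    (0 <= s')%R -> (s' <= t')%R -> (t' <= 1)%R ->
    (`|uval (edge_pt v' w' s') - uval (edge_pt v' w' t')|%R)%:E <=
    (sc v'.2)%:E * \int[leb]_(r in `[s', t']) g (iota (edge_pt v' w' r)).
  move=> vw lev s0 st t1.
  have [th|/ltW th] := leP t' (1 / 2)%R; first by apply: half => //; left.
  have [sh|/ltW sh] := leP (1 / 2)%R s'; first by apply: half => //; right.
  rewrite (integral_edge_split vw mg g0 s0 sh th t1) ge0_muleDr//.
  apply: le_trans (leeD (half _ _ _ _ vw lev s0 sh _ (or_introl (lexx _)))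
    (half _ _ _ _ vw lev _ th t1 (or_intror (lexx _)))); [|lra|lra].
  by rewrite -EFinD lee_fin ler_distD.
move=> vw s0 st t1.
have a1 : (sc v.2 <= alpha * sc v.2)%R by rewrite ler_peMl ?powR_ge0 ?ltW.
have [lev|lev] := edge_orient vw.
  apply: le_trans (H _ _ _ _ vw lev s0 st t1) _.
  by rewrite lee_wpmul2r ?lee_fin.
have wv := edge_sym vw.
rewrite distrC (edge_ptC v w s) (edge_ptC v w t).
have b1 : (0 <= 1 - t)%R by lra.
have b2 : (1 - t <= 1 - s)%R by lra.
have b3 : (1 - s <= 1)%R by lra.
apply: le_trans (H w v _ _ wv (or_intror lev) b1 b2 b3) _.
apply: (@le_trans _ _ ((sc w.2)%:E * \int[leb]_(r in `[s, t]) g (iota (edge_pt v w r)))).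
  by rewrite lee_wpmul2l ?lee_fin ?(ltW (sc_gt0 _))// integral_edge_rev.
by rewrite lee_wpmul2r// lee_fin; have [] := edge_sc vw.
Qed.

End weak_gradient.

(** * Vertical rays ending at boundary points *)

Section ray.
Variable z : Z.

Let lev (y : R) : R := (- (ln (y * la) / la))%R.

Let lev_pw y : (0 < y)%R -> (alpha `^ (- lev y) = y * la)%R.
Proof. by move=> y0; rewrite /lev opprK pw_lnK// mulr_gt0. Qed.

Let lev_mono x y : (0 < x)%R -> (x <= y)%R -> (lev y <= lev x)%R.
Proof.
move=> x0 xy; rewrite lerN2 ler_pM2r ?invr_gt0// ler_ln ?posrE ?mulr_gt0//.
  by rewrite ler_pM2r.
exact: lt_le_trans x0 xy.
Qed.

Let lev_sc (n : int) : lev (sc n / la) = n%:~R.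
Proof.
by rewrite /lev divfK ?gt_eqF// ln_powR mulNr mulNr opprK mulfK// gt_eqF.
Qed.

Let step k := edge_pt (nearv k z) (nearv (k + 1) z).

Let stepE k t : dens (step k t) = (alpha `^ (- (k%:~R + t)))%R.
Proof. by rewrite dens_vertical//; exact: edge_nearS. Qed.

(* The vertical geodesic ending at [j z], parametrized by the distance to [j z]:
   the point at height [h] is at distance [alpha `^ (- h) / ln alpha]. *)
Definition ray (y : R) : Y := if (y <= 0)%R then j z else
  iota (step (Num.floor (lev y)) (lev y - (Num.floor (lev y))%:~R)).

Let rayE k y : (0 < y)%R -> (k%:~R <= lev y)%R -> (lev y < k%:~R + 1)%R ->
  ray y = iota (step k (lev y - k%:~R)).
Proof.
move=> y0 kl lk; rewrite /ray leNgt y0/=.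
suff -> : Num.floor (lev y) = k by [].
by apply: floor_def; rewrite kl rmorphD.
Qed.

Let frac_itv y : (0 <= lev y - (Num.floor (lev y))%:~R < 1)%R.
Proof. by have := real_floor_itv (num_real (lev y)); rewrite rmorphD/=; lra. Qed.

Let ray_pt y : (0 < y)%R -> exists k t, [/\ (0 <= t < 1)%R, lev y = (k%:~R + t)%R,
  ray y = iota (step k t) & dens (step k t) = (y * la)%R].
Proof.
move=> y0; have := frac_itv y; set k := Num.floor _ => h.
exists k, (lev y - k%:~R)%R; have e : (lev y = k%:~R + (lev y - k%:~R))%R by rewrite subrKC.
by split => //; [rewrite /ray leNgt y0|rewrite stepE -e lev_pw].
Qed.

Let step_fill k t : (0 <= t < 1)%R -> fill (step k t).
Proof. by move=> /andP[t0 /ltW t1]; apply: filling_edge (edge_nearS k z) _; rewrite t0. Qed.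

Let dY_down k t : (0 <= t < 1)%R ->
  dY (iota (step k t)) (vpt (nearv (k + 1) z)) =
  ((dens (step k t) - sc (k + 1)) / la)%R.
Proof.
move=> /andP[t0 /ltW t1]; rewrite -(edge_pt1 (nearv k z)).
by rewrite (dY_vertical (edge_nearS k z))// !stepE rmorphD.
Qed.

Let dY_up k t : (0 <= t < 1)%R ->
  dY (vpt (nearv k z)) (iota (step k t)) = ((sc k - dens (step k t)) / la)%R.
Proof.
move=> /andP[t0 /ltW t1]; rewrite -(edge_pt0 _ (nearv (k + 1) z)).
by rewrite (dY_vertical (edge_nearS k z))// -/(step k 0%R) (stepE k 0%R) addr0.
Qed.

Let ray_dist0 y : (0 < y)%R -> dY (j z) (ray y) = y.
Proof.
move=> y0; have [k [t [t01 _ -> dE]]] := ray_pt y0.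
apply/eqP; rewrite eq_le; apply/andP; split; last first.
  by have := dens_j z (step_fill k t01); rewrite dE mulfK// gt_eqF.
apply: le_trans (metric_triangle _ (vpt (nearv (k + 1) z)) _) _.
rewrite [X in (_ + X <= _)%R]metric_sym dY_down// dE.
apply: le_trans (lerD (dY_j_near _ _) (lexx _)) _.
by rewrite -mulrDl addrC subrK mulfK// gt_eqF.
Qed.

(** The lower bound is the test function density / ln alpha; the upper bound adds up vertical edges,
    those strictly between the two points by [dY_near]. *)
Let ray_dist x y : (0 < x)%R -> (x <= y)%R -> dY (ray x) (ray y) = (y - x)%R.
Proof.
move=> x0 xy; have y0 := lt_le_trans x0 xy.
have [k [s [s01 lx -> dx]]] := ray_pt x0; have [m [t [t01 ly -> dy]]] := ray_pt y0.
have := lev_mono x0 xy; rewrite lx ly => mtks.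
apply/eqP; rewrite eq_le; apply/andP; split; last first.
  have := rho_lip_dist rho_lip_dens (step_fill m t01) (step_fill k s01).
  rewrite dx dy !mulfK ?gt_eqF// metric_sym; exact/le_trans/ler_norm.
have [mk|km] := ltP m k.
  apply: le_trans (metric_triangle _ (vpt (nearv k z)) _) _.
  rewrite metric_sym dY_up// dx.
  apply: le_trans (lerD (lexx _) (metric_triangle _ (vpt (nearv (m + 1) z)) _)) _.
  rewrite [X in (_ + (_ + X) <= _)%R]metric_sym dY_down// dy.
  have [i kE] : exists i : nat, k = (m + 1 + i%:Z)%R.
    by apply: int_le_ex; rewrite lezD1.
  have := dY_near z (m + 1)%R i; rewrite -kE metric_sym => h.
  apply: le_trans (lerD (lexx _) (lerD h (lexx _))) _.
  rewrite -!mulrDl ler_pdivrMr//; lra.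
have mk : m = k.
  apply/eqP; rewrite eq_le km andbT leNgt; apply/negP => kltm.
  have : (k%:~R + 1 <= m%:~R :> R)%R by rewrite -(intrD R k 1%R) ler_int lezD1.
  by move: s01 t01 mtks; lra.
subst m; have ts : (t <= s)%R by move: mtks; rewrite lerD2l.
rewrite metric_sym (dY_vertical (edge_nearS k z))//; [|lra|lra].
by rewrite -/(step k t) -/(step k s) dx dy -mulrBl mulfK// gt_eqF.
Qed.

Let ray_iso L x y : (0 <= x)%R -> (x <= y)%R -> (y <= L)%R -> dY (ray x) (ray y) = (y - x)%R.
Proof.
move=> x0 xy _; have [xp|xz] := ltP 0%R x; first exact: ray_dist.
have -> : x = 0%R by apply/eqP; rewrite eq_le x0 xz.
rewrite subr0 {1}/ray lexx; have [yp|yz] := ltP 0%R y; first exact: ray_dist0.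
have -> : y = 0%R by apply/eqP; rewrite eq_le yz (le_trans x0).
by rewrite /ray lexx mdistxx.
Qed.

Lemma ray_top n : ray (sc n / la) = vpt (nearv n z).
Proof.
have h : (0 < sc n / la)%R by rewrite divr_gt0 ?sc_gt0.
have e := lev_sc n.
have e1 : (n%:~R <= lev (sc n / la))%R by rewrite e.
have e2 : (lev (sc n / la) < n%:~R + 1)%R by rewrite e ltrDl.
by rewrite (rayE h e1 e2) e subrr /step edge_pt0.
Qed.

Let ray_meas L : measurable_fun (`[0%R, L]%classic : set R) (ray : R -> borel Y).
Proof.
pose c (t : R) := (Num.max 0 t)%R.
apply: (eq_measurable_fun (fun t => ray (c t) : borel Y)).
  by move=> t /set_mem; rewrite /= in_itv/= => /andP[t0 _]; rewrite /c max_r.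
apply: (@measurable_funS _ _ _ _ setT) => //.
apply: (@measurability _ _ R (borel Y) setT _ (@open Y)) => //.
move=> _ [U oU <-]; rewrite setTI; apply: open_measurable.
suff /continuousP : continuous (fun t : R => ray (c t)) by exact.
move=> x; apply/cvg_ballP => e e0; near=> t; rewrite ballEmdist/=.
have cx s : (0 <= c s)%R by rewrite le_max lexx.
apply: (@le_lt_trans _ _ `|x - t|%R); last first.
  by near: t; apply: (@cvgr_dist_lt _ _ _ _ _ id); first [exact: cvg_id|by []].
have := ler_norm (x - t); have := ler_norm (t - x); rewrite (distrC t).
have [h|/ltW h] := leP (c x) (c t).
  rewrite (ray_iso (cx _) h (lexx _)); move: h; rewrite /c !maxEle.
  by do ![case: ifP]; lra.
rewrite metric_sym (ray_iso (cx _) h (lexx _)); move: h; rewrite /c !maxEle.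
by do ![case: ifP]; lra.
Unshelve. all: by end_near. Qed.

(** The ray is cut at its vertices. On each piece it runs along one edge of level [k], where passing
    from arc length to the edge parameter expands by at least 1 / sc k. *)
Lemma ray_integral (F : Y -> \bar R) n : borel_fun F -> (forall y, 0 <= F y) ->
  line_integral (sc n / la) ray F <=
  \sum_(i <oo) (sc (n + i%:Z))%:E *
    \int[leb]_(t in `[0%R, 1%R]) F (iota (edge_pt (nearv (n + i%:Z) z) (nearv (n + i%:Z + 1) z) t)).
Proof.
move=> mF F0; pose b (i : nat) := (sc (n + i%:Z) / la)%R.
have b0 i : (0 < b i)%R by rewrite divr_gt0 ?sc_gt0.
have bS i : (b i.+1 <= b i)%R.
  by rewrite ler_pM2r ?invr_gt0// sc_homo//; lia.
have bmono i k : (i <= k)%N -> (b k <= b i)%R.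
  by move=> ik; rewrite ler_pM2r ?invr_gt0// sc_homo//; lia.
have bL : b 0%N = (sc n / la)%R by rewrite /b addr0.
have mFr (D : set R) : (D `<=` `[0%R, b 0%N])%classic -> measurable D ->
    measurable_fun D (fun y => F (ray y)).
  move=> D0 mD; apply: (measurable_funS _ D0) => //.
  have mr : measurable_fun (`[0%R, b 0%N]%classic : set R) (ray : R -> borel Y).
    by move=> mI; exact: ray_meas.
  exact: (measurableT_comp mF mr).
rewrite /line_integral -bL -integral_itv_obnd_cbnd; last first.
  by apply: mFr => // y; rewrite /= !in_itv/= => /andP[/ltW -> ->].
have cov : `]0%R, b 0%N]%classic = \bigcup_i `]b i.+1, b i]%classic.
  apply/seteqP; split=> y; rewrite /= in_itv/=; last first.
    by move=> [i _]; rewrite /= in_itv/= => /andP[h1 h2]; rewrite (lt_trans (b0 i.+1))// (le_trans h2)// bmono.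
  move=> /andP[y0 yb].
  have ex : exists i, (b i.+1 < y)%R.
    have [N NP] := sc_small (mulr_gt0 y0 la_gt0).
    exists (N + `|n|)%N; rewrite ltr_pdivrMr//; apply: le_lt_trans (NP N (leqnn _)).
    by rewrite sc_homo//; clear; lia.
  exists (ex_minn ex) => //=; case: ex_minnP => i bi imin; rewrite in_itv/= bi/=.
  case: i bi imin => [_ _|i bi imin]; first exact: yb.
  by rewrite leNgt; apply/negP => /imin; rewrite ltnn.
rewrite cov ge0_integral_bigcup//; last 2 first.
- by rewrite -cov; apply: mFr => // y; rewrite /= !in_itv/= => /andP[/ltW -> ->].
- move=> i k _ _ [y []]; rewrite /= !in_itv/= => /andP[h1 h2] /andP[h3 h4].
  apply/eqP; rewrite eqn_leq; apply/andP; split; rewrite leqNgt; apply/negP => /bmono h.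
    by have := lt_le_trans h3 (le_trans h2 h); rewrite ltxx.
  by have := lt_le_trans h1 (le_trans h4 h); rewrite ltxx.
apply: lee_nneseries => [i _ _|i _]; first exact: integral_ge0.
set k := (n + i%:Z)%R; have vw := edge_nearS k z.
rewrite -(edge_extE F (nearv k z) (nearv (k + 1) z) (sub_I01 (lexx 0%R) (lexx 1%R))).
have bSk : b i.+1 = (sc (k + 1) / la)%R by rewrite /b /k; congr (sc _ / _)%R; lia.
have bk : b i = (sc k / la)%R by [].
pose f y := (lev y - k%:~R)%R.
have fitv y : (b i.+1 <= y <= b i)%R -> (0 <= f y <= 1)%R.
  move=> /andP[h1 h2]; have y0 := lt_le_trans (b0 i.+1) h1.
  have := lev_mono y0 h2; have := lev_mono (b0 i.+1) h1.
  by rewrite bSk bk !lev_sc /f rmorphD/=; lra.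
apply: (@le_trans _ _ (\int[leb]_(y in `[b i.+1, b i])
    edge_ext F (nearv k z) (nearv (k + 1) z) (f y))).
  have -> : \int[leb]_(y in `]b i.+1, b i]) F (ray y) =
      \int[leb]_(y in `]b i.+1, b i]) edge_ext F (nearv k z) (nearv (k + 1) z) (f y).
    apply: eq_integral => y /set_mem; rewrite /= in_itv/= => /andP[h1 h2].
    have y0 := lt_trans (b0 i.+1) h1.
    have fy : (0 <= f y <= 1)%R by apply: fitv; rewrite h2 ltW.
    rewrite /edge_ext clip01_id// (rayE (k := k))//.
      by have := lev_mono y0 h2; rewrite bk lev_sc.
    rewrite ltNge; apply/negP => hk; move: h1; rewrite ltNge => /negP; apply.
    have := @pw_le R alpha alpha_gt1 (- lev y)%R (- (k%:~R + 1))%R.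
    rewrite lerN2 lev_pw// => /(_ hk) h; rewrite bSk ler_pdivlMr//.
    by rewrite rmorphD.
  rewrite le_eqVlt integral_itv_obnd_cbnd ?eqxx//.
  apply: (@measurable_funS _ _ _ _ setT) => //.
  apply: (measurableT_comp (edge_ext_meas vw mF)).
  rewrite /f /lev.
  apply: measurable_funB; last exact: measurable_cst.
  apply: measurableT_comp => //; apply: measurable_funM; last exact: measurable_cst.
  apply: (measurableT_comp (@measurable_ln R)).
  by apply: measurable_funM; [exact: measurable_id|exact: measurable_cst].
rewrite -[X in X%:E * _]invrK; apply: integral_expanding => //.
- by rewrite invr_gt0 sc_gt0.
- rewrite /f /lev.
  apply: measurable_funB; last exact: measurable_cst.
  apply: measurableT_comp => //; apply: measurable_funM; last exact: measurable_cst.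
  apply: (measurableT_comp (@measurable_ln R)).
  by apply: measurable_funM; [exact: measurable_id|exact: measurable_cst].
- have H x y : (b i.+1 <= x -> x <= y -> y <= b i -> (sc k)^-1 * (y - x) <= f x - f y)%R.
    move=> bx xy yb; have x0 := lt_le_trans (b0 i.+1) bx; have y0 := lt_le_trans x0 xy.
    rewrite mulrC ler_pdivrMr ?sc_gt0//.
    have := pw_diff_ge alpha_gt1 (lev_mono x0 xy); rewrite !lev_pw//.
    rewrite -mulrBl mulfK ?gt_eqF// => /le_trans; apply.
    have -> : (f x - f y = lev x - lev y)%R by rewrite /f; ring.
    apply: ler_wpM2l; first by rewrite subr_ge0 lev_mono.
    by rewrite -ler_pdivlMr// -bk.
  move=> x y /andP[x1 x2] /andP[y1 y2].
  have [xy|/ltW yx] := leP x y.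
    rewrite (distrC x) [X in (_ * X)%R]ger0_norm ?subr_ge0//.
    exact: le_trans (H _ _ x1 xy y2) (ler_norm _).
  rewrite [X in (_ * X)%R]ger0_norm ?subr_ge0// (distrC (f x)).
  exact: le_trans (H _ _ y1 yx x2) (ler_norm _).
- exact: edge_ext_meas.
- by move=> x; exact: F0.
Qed.

Lemma ray_gradient u g n : upper_gradient u g ->
  `|u (j z) - u (vpt (nearv n z))| <=
  \sum_(i <oo) (sc (n + i%:Z))%:E *
    \int[leb]_(t in `[0%R, 1%R]) g (iota (edge_pt (nearv (n + i%:Z) z) (nearv (n + i%:Z + 1) z) t)).
Proof.
move=> [mg g0 gu]; have L0 : (0 < sc n / la)%R by rewrite divr_gt0 ?sc_gt0.
have arc : arclength_curve dY (sc n / la)%R ray.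
  by apply: isometric_arclength; [exact: ltW|exact: ray_iso].
have := gu (_, ray) (conj L0 arc); rewrite /gradient_ineq/= ray_top {1}/ray lexx.
move=> /le_trans; apply; exact: ray_integral.
Qed.

End ray.

(** * Balls for the two metrics on [Z] *)

Local Notation dZ := (boundary_dist j).
Local Notation half v := (dball mdist (v : Z * int).1 (sc (v : Z * int).2 / 2)).
Local Notation nhalf v := (nu (half v)).

Lemma dZ_dball_sub x s : (dball dZ x s `<=` dball mdist x (bilip * s))%classic.
Proof.
move=> y; rewrite /dball/= => h; apply: le_lt_trans (mdist_le_dZ x y) _.
by rewrite ltr_pM2l ?bilip_gt0.
Qed.

Let bilip'a_gt0 : (0 < bilip' * alpha)%R.
Proof. by rewrite mulr_gt0 ?bilip'_gt0// (lt_trans ltr01). Qed.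

Lemma dball_dZ_sub x s : (dball mdist x s `<=` dball dZ x (bilip' * alpha * s))%classic.
Proof.
move=> y; rewrite /dball/= => h; apply: le_lt_trans (dZ_le_mdist x y) _.
by rewrite ltr_pM2l.
Qed.

Lemma dZ_triangle b a c : (dZ a c <= dZ a b + dZ b c)%R.
Proof. exact: metric_triangle. Qed.

Lemma dZ_sym a b : dZ a b = dZ b a.
Proof. exact: metric_sym. Qed.

Lemma dZ_dball_open x s : open (dball dZ x s).
Proof.
rewrite openE => y; rewrite /dball/= => xy.
have e0 : (0 < (s - dZ x y) / (bilip' * alpha))%R by rewrite divr_gt0// subr_gt0.
apply/nbhs_ballP; exists ((s - dZ x y) / (bilip' * alpha))%R => //= w; rewrite ballEmdist/=.
move=> /dball_dZ_sub; rewrite /dball/= mulrC divfK ?gt_eqF// => h.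
by apply: le_lt_trans (dZ_triangle y _ _) _; lra.
Qed.

Lemma dZ_dball_cara x s : nu.-caratheodory (dball dZ x s).
Proof. by case: nu_reg => + _; apply; apply: sub_sigma_algebra; exact: dZ_dball_open. Qed.

Lemma dZ_ball_pos_fin x s : (0 < s)%R -> 0 < nu (dball dZ x s) < +oo.
Proof.
move=> s0.
have h1 : (0 < s / (bilip' * alpha))%R by rewrite divr_gt0.
have h2 : (0 < bilip * s)%R by rewrite mulr_gt0 ?bilip_gt0.
have /andP[p1 _] := nu_ball x h1; have /andP[_ p2] := nu_ball x h2.
rewrite (lt_le_trans p1) ?(le_lt_trans _ p2)//; apply: le_outer_measure.
  exact: dZ_dball_sub.
by move=> y /dball_dZ_sub; rewrite mulrC divfK// gt_eqF.
Qed.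

Lemma bilip_ge1 : (1 <= bilip)%R.
Proof. by rewrite /bilip; have := mulr_gt0 tau_gt0 (lt_trans ltr01 alpha_gt1); move: tau_gt3; lra. Qed.

Lemma bilip'_ge1 : (1 <= bilip')%R.
Proof. by rewrite /bilip' lerDr ltW// divr_gt0. Qed.

(** * Consequences of relative lower volume decay *)

Section volume.
Variables (Clow Q : R).
Hypothesis Clow_ge1 : (1 <= Clow)%R.
Hypothesis Q_gt0 : (0 < Q)%R.
Hypothesis decay : relative_lower_volume_decay dZ nu Clow Q.

Let Clow_gt0 : (0 < Clow)%R. Proof. exact: lt_le_trans Clow_ge1. Qed.

Lemma decay_le x r' r : (0 < r')%R -> (r' <= r)%R ->
  (Clow^-1 * (r' / r) `^ Q)%:E * nu (dball dZ x r) <= nu (dball dZ x r').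
Proof.
move=> r'0 rr; have := decay x r'0 rr.
have /andP[] := dZ_ball_pos_fin x (lt_le_trans r'0 rr).
case: (nu (dball dZ x r)) => [V| |]// V0 _; rewrite lte_fin in V0.
by rewrite inver gt_eqF// lee_pdivlMr.
Qed.

Lemma decay_dbl x L s : (1 <= L)%R -> (0 < s)%R ->
  nu (dball dZ x (L * s)) <= (Clow * L `^ Q)%:E * nu (dball dZ x s).
Proof.
move=> L1 s0; have L0 := lt_le_trans ltr01 L1.
have sL : (s <= L * s)%R by rewrite ler_peMl// ltW.
have := decay_le x s0 sL.
have -> : (s / (L * s) = L^-1)%R by field; rewrite !gt_eqF.
by rewrite powRV ?(ltW L0)// -invfM lee_pdivrMl// mulr_gt0// powR_gt0.
Qed.

(** Growth constant for balls of the original metric: the decay for [boundary_dist], transported by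
    the two biLipschitz inclusions. *)
Definition dbl K := (Clow * (bilip * bilip' * alpha * K) `^ Q)%R.

Lemma dbl_ge0 K : (0 <= dbl K)%R.
Proof. by rewrite mulr_ge0 ?powR_ge0// ltW. Qed.

Lemma ball_dbl K a s : (1 <= K)%R -> (0 < s)%R ->
  nball a (K * s) <= (dbl K)%:E * nball a s.
Proof.
move=> K1 s0; have b0 := bilip_gt0; have a1 := ltW alpha_gt1.
have L1 : (1 <= bilip * bilip' * alpha * K)%R.
  apply: mulr_ege1 => //; apply: mulr_ege1 => //.
  by apply: mulr_ege1; [exact: bilip_ge1|exact: bilip'_ge1].
have r'0 : (0 < s / bilip)%R by rewrite divr_gt0.
apply: (@le_trans _ _ (nu (dball dZ a (bilip * bilip' * alpha * K * (s / bilip))))).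
  have -> : (bilip * bilip' * alpha * K * (s / bilip) = bilip' * alpha * (K * s))%R.
    by field; rewrite gt_eqF.
  by apply: le_outer_measure; exact: dball_dZ_sub.
apply: le_trans (decay_dbl a L1 r'0) _; apply: lee_wpmul2l; first exact: dbl_ge0.
apply: le_outer_measure; have := @dZ_dball_sub a (s / bilip).
by rewrite [(bilip * _)%R]mulrC divfK// gt_eqF.
Qed.

(** The ball of radius (k + 1) r about [a] contains the ball of radius [r] about [z]. *)
Lemma ball_lower z r k a s : (0 < r)%R -> (0 <= k)%R -> (dZ z a <= k * r)%R ->
  (0 < s)%R -> (s <= (k + 1) * bilip * r)%R ->
  nu (dball dZ z r) <= (Clow * ((k + 1) * bilip * r / s) `^ Q)%:E * nball a s.
Proof.
move=> r0 k0 za s0 sr; have b0 := bilip_gt0.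
have L1 : (1 <= (k + 1) * bilip * r / s)%R by rewrite ler_pdivlMr// mul1r.
have r'0 : (0 < s / bilip)%R by rewrite divr_gt0.
apply: (@le_trans _ _ (nu (dball dZ a ((k + 1) * bilip * r / s * (s / bilip))))).
  have -> : ((k + 1) * bilip * r / s * (s / bilip) = (k + 1) * r)%R.
    by field; rewrite !gt_eqF.
  apply: le_outer_measure => x; rewrite /dball/= => zx.
  by have := dZ_triangle z a x; rewrite (dZ_sym a z); lra.
apply: le_trans (decay_dbl a L1 r'0) _; apply: lee_wpmul2l.
  by rewrite lee_fin mulr_ge0 ?powR_ge0// ltW.
apply: le_outer_measure; have := @dZ_dball_sub a (s / bilip).
by rewrite [(bilip * _)%R]mulrC divfK// gt_eqF.
Qed.

(** * Packing sums over vertices *)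

Section packing_sum.
Variables (b : R) (P : set (Z * int)) (k0 : int) (A : set Z).
Hypothesis b_gt0 : (0 < b)%R.
Hypothesis P_vert : (P `<=` vert)%classic.
Hypothesis P_level : forall v, P v -> (k0 <= v.2)%R.
Hypothesis P_sub : forall v, P v -> (half v `<=` A)%classic.
Hypothesis A_cara : nu.-caratheodory A.

Definition geom (b : R) : R := ((1 - alpha `^ (- b))^-1)%R.

Lemma pw_lt1 c : (0 < c)%R -> (alpha `^ (- c) < 1)%R.
Proof. by move=> c0; rewrite -(powRr0 alpha) pw_lt// oppr_lt0. Qed.

Lemma geom_gt0 c : (0 < c)%R -> (0 < geom c)%R.
Proof. by move=> /pw_lt1; rewrite invr_gt0; lra. Qed.

Lemma geom_series c : (0 < c)%R ->
  \sum_(i <oo) ((alpha `^ (- c)) ^+ i)%:E <= (geom c)%:E.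
Proof.
move=> c0; apply: lime_le.
  by apply: is_cvg_nneseries => n _ _; rewrite lee_fin exprn_ge0// powR_ge0.
apply: nearW => n; rewrite sumEFin lee_fin.
have q0 := @pw_gt0 R alpha alpha_gt1 (- c)%R.
have := @geometric_le_lim R n 1%R _ ler01 q0; rewrite gtr0_norm// pw_lt1//.
by move=> /(_ isT); rewrite /series/= mul1r; under eq_bigr do rewrite mul1r.
Qed.

(** Half balls of one level are disjoint, so each level contributes at most one vertex whose half
    ball contains [x], and the scales form a geometric series. *)
Lemma overlap x : \esum_(v in P) (sc v.2 `^ b * \1_(half v) x)%:E <=
  (sc k0 `^ b * geom b)%:E.
Proof.
rewrite (_ : \esum_(v in P) _ = \esum_(v in P `&` [set v | half v x]) (sc v.2 `^ b)%:E); last first.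
  rewrite esum_mkcondr; apply: eq_esum => v _; rewrite indicE.
  have [h|h] := pselect (half v x).
    by rewrite !mem_set// mulr1.
  by rewrite !memNset// mulr0.
set P' := P `&` _; pose l (v : Z * int) := `|v.2 - k0|%N.
have lE v : P' v -> v.2 = (k0 + (l v)%:Z)%R.
  by move=> [/P_level kv _]; rewrite /l gez0_abs ?subr_ge0// subrKC.
have linj : set_inj P' l.
  move=> v w /set_mem Pv /set_mem Pw lvw.
  have e : v.2 = w.2 by rewrite (lE v Pv) (lE w Pw) lvw.
  case: Pv Pw => /P_vert Pv vx [/P_vert Pw wx].
  rewrite [v]surjective_pairing [w]surjective_pairing e; congr (_, _).
  apply: (@net_half_disj w.2) => //; first by rewrite -e.
  by exists x; split => //; move: vx; rewrite /= e.
pose q := (alpha `^ (- b))%R.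
rewrite (eq_esum (b := fun v => (sc k0 `^ b)%:E * (q ^+ l v)%:E)); last first.
  move=> v Pv; rewrite -EFinM -powR_mulrn ?powR_ge0// -!powRrM -pwD//.
  by congr (_ `^ _)%:E; rewrite (lE v Pv) intrD; ring.
have q0 n : 0 <= (q ^+ n)%:E :> \bar R by rewrite lee_fin exprn_ge0// powR_ge0.
apply: le_trans (le_esumZ _ _ _) _ => //; first by rewrite lee_fin powR_ge0.
rewrite EFinM; apply: lee_wpmul2l; first by rewrite lee_fin powR_ge0.
rewrite -(esum_image _ _ (fun n : nat => (q ^+ n)%:E) linj).
apply: (@le_trans _ _ (\esum_(i in setT) (q ^+ i)%:E)); first exact: le_esum_sub.
by rewrite -nneseries_esumT// geom_series.
Qed.

(** Discrete to continuous: [M v] times the measure of the half ball is at most the integral of [m]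
    over it. Sum and integral are exchanged, and [overlap] bounds the resulting weight at each
    point. *)
Lemma packing_sum (M : Z * int -> \bar R) (m : Z -> \bar R) :
  om_measurable nu m -> (forall x, 0 <= m x) -> (forall v, P v -> 0 <= M v) ->
  (forall v x, P v -> half v x -> M v <= m x) ->
  \esum_(v in P) (sc v.2 `^ b)%:E * (M v * nhalf v) <=
  (sc k0 `^ b * geom b)%:E * om_integral nu A m.
Proof.
move=> mm m0 M0 Mm.
pose f (v : Z * int) x := (sc v.2 `^ b * \1_(half v) x)%:E * (m \_ A) x.
have mA0 x : 0 <= (m \_ A) x by rewrite patchE; case: ifP.
have f0 v x : 0 <= f v x by rewrite mule_ge0// lee_fin mulr_ge0// ?powR_ge0.
have cP : countable P by apply: sub_countable vert_countable; exact: subset_card_le.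
have mmA : om_measurable nu (m \_ A).
  apply: (proj1 (@measurable_restrictT _ _ (caratheodory_type nu) _ A m A_cara)).
  exact: measurable_funTS.
have mf v : om_measurable nu (f v).
  apply: emeasurable_funM => //; apply/measurable_EFinP.
  apply: measurable_funM; first exact: measurable_cst.
  by apply: measurable_indic; exact: dball_cara.
apply: (@le_trans _ _ (om_integral nu setT (fun x => \esum_(v in P) f v x))).
  rewrite /om_integral ge0_integral_esum//; last by move=> v _; exact: mf.
  apply: le_esum => v Pv.
  rewrite (_ : (fun x => f v x) = (fun x => (sc v.2 `^ b)%:E * ((m \_ A) \_ (half v)) x)); last first.
    apply/funext => x; rewrite /f EFinM -muleA; congr (_ * _).
    by rewrite (patchE (m \_ A)) indicE; case: ifP => _; rewrite ?mul1e ?mul0e.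
  rewrite ge0_integralZl//; last 3 first.
  - apply: (proj1 (@measurable_restrictT _ _ (caratheodory_type nu) _ (half v) (m \_ A) (dball_cara _ _))).
    exact: measurable_funTS.
  - by move=> x _; rewrite patchE; case: ifP.
  - by rewrite lee_fin powR_ge0.
  apply: lee_wpmul2l; first by rewrite lee_fin powR_ge0.
  rewrite -integral_mkcond -integral_cst; last exact: dball_cara.
  apply: ge0_le_integral => //.
  - exact: dball_cara.
  - by move=> x _; exact: M0.
  - exact: measurable_funTS.
  - move=> x hx; rewrite patchE mem_set; last exact: P_sub hx.
    exact: Mm.
rewrite [in leRHS]/om_integral integral_mkcond -ge0_integralZl//; last first.
  by rewrite lee_fin mulr_ge0 ?powR_ge0// ltW// geom_gt0.
apply: ge0_le_integral => //.
- by move=> x _; apply: esum_ge0 => v _.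
- by apply: (@measurable_fun_esum _ _ (caratheodory_type nu)) => // v _; exact: mf.
- by apply: emeasurable_funM => //; exact: measurable_cst.
move=> x _; rewrite /f.
rewrite (eq_esum (b := fun v => (m \_ A) x * (sc v.2 `^ b * \1_(half v) x)%:E)); last first.
  by move=> v _; rewrite muleC.
apply: le_trans (le_esumZ _ _ _) _ => //.
  by move=> v; rewrite lee_fin mulr_ge0// ?powR_ge0.
by rewrite [leRHS]muleC; apply: lee_wpmul2l => //; exact: overlap.
Qed.

End packing_sum.

(** Enlarged by [K], the half ball of a vertex has radius 3 tau alpha times its scale; this covers
    the vballs of the vertex and of its neighbors, and also the half balls of the neighbors. *)
Let K := (6 * tau * alpha)%R.

Definition star_cst : R := (2 * dbl K * (alpha * alpha * geom 1 * dbl K))%R.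

(** A measured form of bounded degree: the half balls of the neighbors, whose scales are comparable
    to that of [v], are packed into an enlarged ball about [v]. *)
Lemma star_sum v : vert v -> \esum_(w in E v) wt v w <= star_cst%:E * nhalf v.
Proof.
move=> vv; have a0 := lt_trans ltr01 alpha_gt1; have t0 := tau_gt0.
have ta : (3 < tau * alpha)%R by apply: lt_le_trans tau_gt3 _; rewrite ler_peMr// ltW.
have K1 : (1 <= K)%R by rewrite /K; lra.
have sv := sc_gt0 v.2.
have hw w : E v w -> wt v w <= (2 * dbl K)%:E * nhalf w.
  move=> vw; have [sc1 sc2] := edge_sc vw; have sw := sc_gt0 w.2.
  have -> : (2 * dbl K = dbl K + dbl K)%R by ring.
  have w2 : (0 < sc w.2 / 2)%R by rewrite divr_gt0.
  have KE : (K * (sc w.2 / 2) = 3 * (tau * alpha * sc w.2))%R by rewrite /K; lra.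
  have tw : (tau * sc w.2 <= tau * alpha * sc w.2)%R.
    by rewrite ler_wpM2r ?ler_peMr ?ltW.
  have tv : (tau * sc v.2 <= tau * alpha * sc w.2)%R by rewrite -mulrA ler_wpM2l// ltW.
  rewrite EFinD ge0_muleDl ?lee_fin ?dbl_ge0//.
  apply: leeD; apply: le_trans (ball_dbl _ K1 w2); apply: le_outer_measure.
    move=> x; rewrite vball_dball /dball/= KE => vx.
    apply: le_lt_trans (metric_triangle _ v.1 _) _.
    by have := edge_dist vw; rewrite (metric_sym w.1); lra.
  by move=> x; rewrite vball_dball /dball/= KE; have := mulr_gt0 t0 sw; lra.
pose A := dball mdist v.1 (K * (sc v.2 / 2)).
have b1 := @ltr01 R.
have PV : (E v `<=` vert)%classic by move=> w [].
have PL w : E v w -> (v.2 - 1 <= w.2)%R by move=> [_ _ _ h _]; move: h; clear; lia.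
have PA w : E v w -> (half w `<=` A)%classic.
  move=> vw x; rewrite /A /dball/= => wx; have [sc1 sc2] := edge_sc vw.
  apply: le_lt_trans (metric_triangle _ w.1 _) _; have := edge_dist vw.
  have : (tau * sc w.2 <= tau * alpha * sc v.2)%R by rewrite -mulrA ler_wpM2l// ltW.
  have : (tau * sc v.2 <= tau * alpha * sc v.2)%R by rewrite ler_wpM2r ?ler_peMr ?ltW.
  have : (3 * sc w.2 <= tau * alpha * sc v.2)%R.
    rewrite -mulrA; apply: ler_pM => //; [exact: ltW (sc_gt0 _)|exact: ltW].
  have -> : (K * (sc v.2 / 2) = 3 * (tau * alpha * sc v.2))%R by rewrite /K; lra.
  by have := sc_gt0 w.2; lra.
have := @packing_sum 1%R (E v) (v.2 - 1)%R A b1 PV PL PA (dball_cara _ _)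
  (fun=> 1) (fun=> 1) (measurable_cst _) (fun=> lee01) (fun _ _ => lee01) (fun _ _ _ _ => lexx _).
rewrite /om_integral integral_cst; last exact: dball_cara.
have sv2 : (0 < sc v.2 / 2)%R by rewrite divr_gt0.
have AK : nu A <= (dbl K)%:E * nhalf v by exact: ball_dbl.
have svm : (sc (v.2 - 1) = alpha * sc v.2)%R by rewrite sc_succ subrK.
have c0 : (0 <= (2 * dbl K * (alpha / sc v.2))%:E :> \bar R).
  rewrite lee_fin; apply: mulr_ge0; last by apply: divr_ge0; exact: ltW.
  by apply: mulr_ge0 => //; exact: dbl_ge0.
have g0 := ltW (geom_gt0 b1).
move=> h; apply: (@le_trans _ _ (\esum_(w in E v) ((2 * dbl K * (alpha / sc v.2))%:E *
    ((sc w.2 `^ 1)%:E * (1 * nhalf w))))).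
  apply: le_esum => w vw; apply: le_trans (hw w vw) _.
  rewrite mul1e muleA -EFinM; apply: lee_wpmul2r; first exact: outer_measure_ge0.
  rewrite lee_fin powRr1 ?powR_ge0// -(mulrA (2 * dbl K)%R) ler_peMr//.
    by apply: mulr_ge0 => //; exact: dbl_ge0.
  by have [sc1 _] := edge_sc vw; rewrite mulrAC ler_pdivlMr// mul1r.
apply: le_trans (le_esumZ _ c0 _) _.
  by move=> w; rewrite mule_ge0 ?lee_fin ?powR_ge0// mul1e outer_measure_ge0.
apply: le_trans (lee_wpmul2l _ h) _ => //.
rewrite mul1e powRr1 ?powR_ge0// svm.
apply: (@le_trans _ _ ((2 * dbl K * (alpha / sc v.2))%:E * ((alpha * sc v.2 * geom 1)%:E * ((dbl K)%:E * nhalf v)))).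
  apply: lee_wpmul2l => //.
  by apply: lee_wpmul2l => //; rewrite lee_fin !mulr_ge0// ltW.
rewrite !muleA -!EFinM; apply: lee_wpmul2r; first exact: outer_measure_ge0.
rewrite lee_fin /star_cst le_eqVlt; apply/orP; left; apply/eqP; field.
by rewrite gt_eqF.
Qed.

Lemma star_cst_ge0 : (0 <= star_cst)%R.
Proof.
have a0 := ltW (lt_trans ltr01 alpha_gt1); have g0 := ltW (geom_gt0 (@ltr01 R)).
have := dbl_ge0 K; rewrite /star_cst; move: (dbl K) (geom 1) g0 => d g g0 d0.
by rewrite !mulr_ge0.
Qed.

Lemma edges_esum_star (P : set (Z * int)) (a : Z * int -> \bar R) : (P `<=` vert)%classic ->
  (forall v, 0 <= a v) ->
  \esum_(e in edges) (if e.1 \in P then a e.1 * wt e.1 e.2 else 0) <=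
  star_cst%:E * \esum_(v in P) (a v * nhalf v).
Proof.
move=> PV a0; pose f v w := if v \in P then a v * wt v w else 0.
have f0 v w : 0 <= f v w by rewrite /f; case: ifP => // _; rewrite mule_ge0// wt_ge0.
rewrite -(edges_esum f0).
apply: (@le_trans _ _ (\esum_(v in vert) if v \in P then star_cst%:E * (a v * nhalf v) else 0)).
  apply: le_esum => v vv; rewrite /f; case: ifP => vP; last by rewrite esum1.
  apply: le_trans (le_esumZ _ (a0 v) (wt_ge0 v)) _.
  by rewrite muleCA; apply: lee_wpmul2l => //; exact: star_sum.
rewrite -esum_mkcondr; apply: (@le_trans _ _ (\esum_(v in P) star_cst%:E * (a v * nhalf v))).
  by apply: le_esum_sub => v [].
apply: le_esumZ; first by rewrite lee_fin star_cst_ge0.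
by move=> v; rewrite mule_ge0// outer_measure_ge0.
Qed.

Lemma mass_le b (P : set (Z * int)) k0 (A : set Z) (M : Z * int -> \bar R) (m : Z -> \bar R) :
  (0 < b)%R -> (P `<=` vert)%classic -> (forall v, P v -> k0 <= v.2)%R ->
  (forall v, P v -> (half v `<=` A)%classic) -> nu.-caratheodory A ->
  om_measurable nu m -> (forall x, 0 <= m x) -> (forall v, 0 <= M v) ->
  (forall v x, P v -> half v x -> M v <= m x) ->
  \esum_(e in edges) (if e.1 \in P then (sc e.1.2 `^ b)%:E * M e.1 * wt e.1 e.2 else 0) <=
  (star_cst * (sc k0 `^ b * geom b))%:E * om_integral nu A m.
Proof.
move=> b0 PV PL PA cA mm m0 M0 Mm.
apply: le_trans (@edges_esum_star P (fun v => (sc v.2 `^ b)%:E * M v) PV _) _.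
  by move=> v; rewrite mule_ge0// lee_fin powR_ge0.
rewrite (EFinM star_cst) -[leRHS]muleA; apply: lee_wpmul2l; first by rewrite lee_fin star_cst_ge0.
under eq_esum => v _ do rewrite -muleA.
exact: (@packing_sum b P k0 A).
Qed.

(** The factor 3 belongs to tau > 3: adjacent vertices at least [depth] levels below n0 have
    projections closer than 2 tau sc n0 / 3, which is less than (tau - 1) sc n0, so their ancestors
    at level n0 are equal or adjacent. *)
Lemma depth_ex : exists m : nat, (3 <= alpha `^ m%:R)%R.
Proof.
by have [k kP] := pw_unbounded alpha_gt1 3%R; exists k; apply/ltW/kP.
Qed.

Definition depth := projT1 (cid depth_ex).

Lemma depthP : (3 <= alpha `^ depth%:R)%R. Proof. by rewrite /depth; case: cid. Qed.

Lemma dens_le_max v w t : E v w -> (0 <= t <= 1)%R ->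
  (dens (edge_pt v w t) <= Num.max (sc v.2) (sc w.2))%R.
Proof.
move=> vw /andP[t0 t1]; have [vv ww _ _ _] := vw.
by have := dens_quasi vw t0 t1; rewrite edge_pt0 edge_pt1 !dens_vertex.
Qed.

(** * A summable profile for the interpolation *)

Section potential.
Variables (th de : R).
Hypothesis th_gt0 : (0 < th)%R.
Hypothesis de_gt0 : (0 < de)%R.

Let a0 : (0 < alpha)%R. Proof. exact: lt_trans ltr01 alpha_gt1. Qed.

(** This is x^th for x <= 1 and x^(-de) for x >= 1: geometric decay on both sides of the crossover
    between the two bounds for the energy of an edge. *)
Definition profile (x : R) : R := (x `^ th * (Num.min 1 x^-1) `^ (th + de))%R.

(** The summands pay for the terms with x <= 1, for those with x > 1, and for the single step that
    crosses 1. *)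
Definition profile_cst : R := (geom th + (alpha `^ de - 1)^-1 + 1)%R.

(* The increments of this potential dominate the profile, so that profile sums telescope. *)
Let psi (x : R) : R := if (x <= 1)%R then (geom th * x `^ th)%R
  else (profile_cst - (alpha `^ de - 1)^-1 * x `^ (- de))%R.

Let ad_gt0 : (0 < alpha `^ de - 1)%R.
Proof. by rewrite subr_gt0 -(powRr0 alpha) pw_lt. Qed.

Let pw_le1 (x s : R) : (0 < x)%R -> (x <= 1)%R -> (0 < s)%R -> (x `^ s <= 1)%R.
Proof.
move=> x0 x1 s0; have e : (1 `^ s = 1 :> R)%R by rewrite powR1.
rewrite -[leRHS]e.
by apply: ge0_ler_powR => //; rewrite ?nnegrE ltW.
Qed.

Let pwN_le1 (x s : R) : (1 < x)%R -> (0 < s)%R -> (x `^ (- s) <= 1)%R.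
Proof.
move=> x1 s0; have x0 := lt_trans ltr01 x1.
rewrite powRN -powRV ?(ltW x0)//; apply: pw_le1 => //; first by rewrite invr_gt0.
by rewrite invf_le1// ltW.
Qed.

Let psi_step x : (0 < x)%R -> (profile x <= psi x - psi (x / alpha))%R.
Proof.
move=> x0; have g0 := geom_gt0 th_gt0.
have ai0 : (0 < alpha^-1)%R by rewrite invr_gt0.
have g1 : (geom th * (1 - alpha `^ (- th)) = 1)%R.
  by rewrite /geom mulVf// subr_eq0 gt_eqF// pw_lt1.
have e1 s : ((x / alpha) `^ s = x `^ s * alpha `^ (- s))%R.
  by rewrite powRM ?(ltW x0) ?(ltW ai0)// powRV ?(ltW a0)// powRN.
have c2 : (0 < (alpha `^ de - 1)^-1)%R by rewrite invr_gt0.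
have xa : (x / alpha <= x)%R by rewrite ler_pdivrMr// ler_peMr// ltW.
rewrite /profile /psi; have [x1|x1] := leP x 1%R.
  rewrite (le_trans xa x1) e1 min_l ?powR1 ?mulr1; last by rewrite invf_ge1.
  rewrite le_eqVlt; apply/orP; left; apply/eqP.
  by rewrite -[LHS]mulr1 -g1; ring.
have -> : (x `^ th * (Num.min 1 x^-1) `^ (th + de) = x `^ (- de))%R.
  rewrite min_r; last by rewrite invf_le1// ltW.
  rewrite powRV ?(ltW x0)// -powRN -powRD; last by rewrite (gt_eqF x0) implybT.
  by congr (_ `^ _)%R; ring.
have xd := pwN_le1 x1 de_gt0; have xd0 := powR_ge0 x (- de).
have [xa1|xa1] := leP (x / alpha)%R 1%R.
  have xa0 : (0 < x / alpha)%R by rewrite divr_gt0.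
  have := ler_wpM2l (ltW g0) (pw_le1 xa0 xa1 th_gt0).
  have := ler_wpM2l (ltW c2) xd.
  by rewrite /profile_cst; lra.
rewrite e1 opprK opprB; set c := ((alpha `^ de - 1)^-1)%R.
have : (c * (alpha `^ de - 1) = 1)%R by rewrite mulVf// gt_eqF.
move=> /(congr1 (fun s => s * x `^ (- de))%R); rewrite mul1r; lra.
Qed.

Lemma profile_sum x n : (0 < x)%R ->
  (\sum_(i < n) profile (x * alpha `^ (- i%:R)) <= profile_cst)%R.
Proof.
move=> x0; have g0 := geom_gt0 th_gt0.
have c2 : (0 < (alpha `^ de - 1)^-1)%R by rewrite invr_gt0.
have psi_le t : (0 < t)%R -> (0 <= psi t <= profile_cst)%R.
  move=> t0; rewrite /psi; have [t1|t1] := leP t 1%R.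
    have := ler_wpM2l (ltW g0) (pw_le1 t0 t1 th_gt0).
    by rewrite mulr_ge0 ?powR_ge0 ?(ltW g0)//= /profile_cst; lra.
  have := ler_wpM2l (ltW c2) (pwN_le1 t1 de_gt0).
  have : (0 <= (alpha `^ de - 1)^-1 * t `^ (- de))%R by rewrite mulr_ge0 ?powR_ge0// ltW.
  by rewrite /profile_cst; lra.
have xn (i : nat) : (0 < x * alpha `^ (- i%:R))%R by rewrite mulr_gt0// powR_gt0.
pose h (i : nat) := psi (x * alpha `^ (- i%:R))%R.
have hS i : (profile (x * alpha `^ (- i%:R)) <= h i - h i.+1)%R.
  rewrite /h; have -> : (x * alpha `^ (- i.+1%:R) = x * alpha `^ (- i%:R) / alpha)%R.
    rewrite -mulrA -[X in (_ / X)%R](powRr1 (ltW a0)) -powRN -(pwD alpha_gt1).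
    by congr (_ * _ `^ _)%R; rewrite -natr1; ring.
  exact: psi_step.
apply: le_trans (telescope_le hS n) _; have := psi_le _ (xn 0%N); have := psi_le _ (xn n).
by rewrite -!/(h _); move: (h 0%N) (h n) => c d; lra.
Qed.

End potential.

(** * A fixed ball; [n0] is the coarsest level whose scale fits its radius *)

Section ball.
Variables (z : Z) (r : R) (n0 : int).
Hypothesis r_gt0 : (0 < r)%R.
Hypothesis n0_le : (bilip' * sc n0 <= r)%R.
Hypothesis n0_gt : (r < alpha * bilip' * sc n0)%R.

Local Notation n1 := (n0 + depth%:Z)%R.
Local Notation inB x := (dY (j z) (iota x) < r)%R.
Local Notation in2B x := (dY (j z) (iota x) < 2 * r)%R.

(** A vertex of hatB at level n0 or deeper may project outside [B], but by no more than its distance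
    sc n0 / ln alpha to its projection. *)
Definition central (a : Z) := (dZ z a < r + sc n0 / la)%R.

Lemma central_vertex v : vert v -> (n0 <= v.2)%R -> inB (vertex_pt v) -> central v.1.
Proof.
move=> vv nv vB; apply: le_lt_trans (metric_triangle _ (vpt v) _) _.
have := dY_j_near v.1 v.2; rewrite nearvK// (metric_sym (vpt v)) /= => h.
have : (sc v.2 / la <= sc n0 / la)%R by rewrite ler_pM2r ?invr_gt0// sc_homo.
by lra.
Qed.

Lemma central_ball a : dball dZ z r a -> central a.
Proof.
rewrite /dball/= => h; apply: lt_le_trans h _.
by rewrite lerDl divr_ge0 ?powR_ge0 ?ltW.
Qed.

(** The excesses over [r] are twice sc n0 / ln alpha and once sc n0. Together they make bilip' sc
    n0, which is at most [r]; this is the reason for the choice of n0. *)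
Lemma central_edge a i w t : central a -> (n0 <= i)%R -> E (nearv i a) w ->
  (n0 <= w.2)%R -> (0 <= t <= 1)%R -> in2B (edge_pt (nearv i a) w t).
Proof.
move=> ca ni vw nw t01; have /= h1 := dY_j_near a i.
have h2 := metric_triangle (j z) (j a) (iota (edge_pt (nearv i a) w t)).
have h3 := metric_triangle (j a) (vpt (nearv i a)) (iota (edge_pt (nearv i a) w t)).
have z01 : (0 <= (0 : R) <= 1)%R by rewrite lexx ler01.
have h4 : (dY (vpt (nearv i a)) (iota (edge_pt (nearv i a) w t)) <= sc n0)%R.
  rewrite -(edge_pt0 _ w); apply: le_trans (dY_edge vw z01 t01) _.
  rewrite sub0r normrN; have /andP[t0 t1] := t01; rewrite ger0_norm//.
  apply: (@le_trans _ _ (1 * sc n0)%R); last by rewrite mul1r.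
  apply: ler_pM => //; first by rewrite le_max ltW// dens_gt0.
  have H q : (0 <= q <= 1)%R -> (dens (edge_pt (nearv i a) w q) <= sc n0)%R.
    move=> q01; apply: le_trans (dens_le_max vw q01) _.
    by rewrite ge_max !sc_homo.
  by rewrite ge_max !H.
have h5 : (sc i / la <= sc n0 / la)%R by rewrite ler_pM2r ?invr_gt0// sc_homo.
move: ca; rewrite /central /boundary_dist => ca.
have : (sc n0 / la + sc n0 / la + sc n0 <= r)%R.
  apply: le_trans n0_le; rewrite /bilip' mulrDl mul1r mulrAC; lra.
by lra.
Qed.

(** Edges of 2 hatB that are not much finer than the ball. Each of them carries a fixed fraction of
    the mass, which is what [conn_uval] exploits. *)
Definition core (v w : Z * int) := [/\ E v w, (v.2 <= n1)%R, (w.2 <= n1)%R &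
  forall t, (0 <= t <= 1)%R -> in2B (edge_pt v w t)].

Lemma core_sym v w : core v w -> core w v.
Proof.
move=> [vw v1 w1 h]; split => //; first exact: edge_sym.
by move=> t t01; rewrite edge_ptC; apply: h; lra.
Qed.

Definition conn v w := exists2 s, path (fun v w => `[< core v w >]) v s & last v s = w.

Lemma conn_refl v : conn v v. Proof. by exists [::]. Qed.

Lemma conn_trans v u w : conn v u -> conn u w -> conn v w.
Proof.
move=> [s ps <-] [s' ps' <-]; exists (s ++ s'); last by rewrite last_cat.
by rewrite cat_path ps.
Qed.

Lemma conn1 v w : core v w -> conn v w.
Proof. by move=> vw; exists [:: w] => //=; rewrite andbT; exact/asboolP. Qed.

Lemma conn_sym v w : conn v w -> conn w v.
Proof.
move=> [s + <-]; elim: s v => [|x s IH] v /=; first by move=> _; exact: conn_refl.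
by move=> /andP[/asboolP/core_sym/conn1 xv /IH]; move/conn_trans; apply.
Qed.

Lemma conn_same a b : central a -> (mdist a b < (tau - 1) * sc n0)%R ->
  conn (nearv n0 a) (nearv n0 b).
Proof.
move=> ca /near_adj[->|vw]; first exact: conn_refl.
apply: conn1; split => //=; do ?by rewrite lerDl.
by move=> t t01; exact: central_edge.
Qed.

Lemma conn_vertical a (k : nat) : central a -> (k <= depth)%N ->
  conn (nearv n0 a) (nearv (n0 + k%:Z) a).
Proof.
move=> ca; elim: k => [_|k IH kd]; first by rewrite addr0; exact: conn_refl.
apply: conn_trans (IH (ltnW kd)) _.
have -> : (n0 + k.+1%:Z = n0 + k%:Z + 1)%R by rewrite -addrA -PoszD addn1.
apply: conn1; split => /=.
- exact: edge_nearS.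
- by rewrite lerD2l lez_nat ltnW.
- by rewrite -addrA lerD2l -PoszD lez_nat addn1.
- move=> t t01; apply: central_edge => //=; first by rewrite lerDl.
    exact: edge_nearS.
  by rewrite -addrA lerDl.
Qed.

(* Collapses deep vertices to their ancestors at level [n0], so that chains in [hatB]
   become chains of edges of bounded level. *)
Definition flat (v : Z * int) := if (n1 <= v.2)%R then nearv n0 v.1 else v.

Let sc_n0E : (sc n0 = alpha `^ depth%:R * sc n1)%R.
Proof.
rewrite -(pwD alpha_gt1); congr (_ `^ _)%R.
by rewrite intrD (_ : (depth%:Z)%:~R = depth%:R :> R)//; ring.
Qed.

Lemma sc_n1 : (3 * sc n1 <= sc n0)%R.
Proof. by rewrite sc_n0E ler_wpM2r ?powR_ge0 ?depthP. Qed.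

(** If both ends are deep, their ancestors are equal or adjacent by the choice of [depth]. If only
    one is, it lies exactly at level n1, and vertical core edges join it to its ancestor. *)
Lemma conn_flat_step v w : E v w ->
  (forall t, (0 <= t <= 1)%R -> inB (edge_pt v w t)) -> conn (flat v) (flat w).
Proof.
move=> vw vwB; have [vv ww _ lev _] := vw.
have vB : inB (vertex_pt v) by rewrite -(edge_pt0 _ w); apply: vwB; rewrite lexx ler01.
have wB : inB (vertex_pt w) by rewrite -(edge_pt1 v); apply: vwB; rewrite lexx ler01.
have n01 : (n0 <= n1)%R by rewrite lerDl.
have corevw : (v.2 <= n1)%R -> (w.2 <= n1)%R -> core v w.
  move=> v1 w1; split => // t t01; apply: lt_trans (vwB t t01) _.
  by rewrite ltr_pMl// ltr1n.
have down x : vert x -> inB (vertex_pt x) -> x.2 = n1 -> conn (nearv n0 x.1) x.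
  move=> vx xB x1.
  have cx : central x.1 by apply: central_vertex; rewrite ?x1.
  have := conn_vertical cx (leqnn _).
  by rewrite -x1 nearvK.
rewrite /flat; case: ifPn => hv; case: ifPn => hw.
- apply: conn_same; first by apply: central_vertex => //; exact: le_trans hv.
  apply: lt_le_trans (edge_dist vw) _.
  apply: (@le_trans _ _ (tau * sc n1 + tau * sc n1)%R).
    by apply: lerD; rewrite ler_pM2l ?tau_gt0// sc_homo.
  have := sc_n1; have := tau_gt3; have := sc_gt0 n0.
  have := ler_wpM2l (ltW tau_gt0) sc_n1.
  have := ler_wpM2r (ltW (sc_gt0 n0)) (ltW tau_gt3).
  by lra.
- have e : v.2 = n1 by move: hv hw lev; clear; lia.
  apply: conn_trans (down v vv vB e) _; apply/conn1/corevw; first by rewrite e.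
  by move: hw; rewrite -ltNge => /ltW.
- have e : w.2 = n1 by move: hv hw lev; clear; lia.
  apply: conn_trans (conn_sym (down w ww wB e)); apply/conn1/corevw; last by rewrite e.
  by move: hv; rewrite -ltNge => /ltW.
- by apply/conn1/corevw; [move: hv|move: hw]; rewrite -ltNge => /ltW.
Qed.

Local Notation v0 := (nearv n0 z).

(** By [ball_reach] the vertex is joined inside hatB to a deep vertex over [z], and this chain is
    flattened edge by edge. *)
Lemma conn_flat v : vert v -> inB (vertex_pt v) -> conn v0 (flat v).
Proof.
move=> vv vB; have [N NP] := ball_reach (filling_vertex vv) vB.
pose M := maxn N `|n1|%N; have := NP M (leq_maxl _ _).
have n1M : (n1 <= M%:Z)%R by rewrite /M; clear; lia.
have n0M : (n0 <= M%:Z)%R by apply: le_trans n1M; rewrite lerDl.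
move=> /(reach_vertex vv).
elim=> [|{}v' w _ IH vw vwB]; last by apply: conn_trans IH _; exact: conn_flat_step.
rewrite /flat/= n1M; apply: conn_same.
  by apply: central_ball; rewrite /dball/= /boundary_dist mdistxx.
rewrite metric_sym; apply: lt_le_trans (near_lt _ _) _.
apply: (@le_trans _ _ (1 * sc n0)%R); first by rewrite mul1r sc_homo.
by rewrite ler_wpM2r ?powR_ge0//; move: tau_gt3; lra.
Qed.

Lemma conn_ball a : dball dZ z r a -> conn v0 (nearv n0 a).
Proof.
move=> aB; have e0 : (0 < r - dZ z a)%R by rewrite subr_gt0.
have [N NP] := near_dist a e0; pose M := maxn N `|n1|%N.
have n1M : (n1 <= M%:Z)%R by rewrite /M; clear; lia.
have n0M : (n0 <= M%:Z)%R by apply: le_trans n1M; rewrite lerDl.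
have vB : inB (vertex_pt (nearv M%:Z a)).
  apply: le_lt_trans (metric_triangle _ (j a) _) _.
  by have := NP M (leq_maxl _ _); rewrite /boundary_dist; lra.
have := conn_flat (vert_nearv _ _) vB; rewrite /flat/= n1M => /conn_trans; apply.
apply: conn_sym; apply: conn_same; first exact: central_ball.
rewrite metric_sym; apply: lt_le_trans (near_lt _ _) _.
apply: (@le_trans _ _ (1 * sc n0)%R); first by rewrite mul1r sc_homo.
by rewrite ler_wpM2r ?powR_ge0//; move: tau_gt3; lra.
Qed.

(** At a point of 2 hatB the density is at most 2 r ln alpha by [dens_j]. Hence an edge through it
    has scale at most Kla r and projects within k1 r of [z], and the half balls of its ends lie
    within k2 r. *)
Let Kla := (2 * alpha * la)%R.
Let k1 := (2 * (1 + alpha * la + alpha))%R.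
Let k2 := (k1 + bilip' * alpha * Kla)%R.

Let a0 : (0 < alpha)%R. Proof. exact: lt_trans ltr01 alpha_gt1. Qed.
Let Kla_gt0 : (0 < Kla)%R. Proof. by rewrite !mulr_gt0. Qed.
Let k1_ge1 : (1 <= k1)%R.
Proof. by rewrite /k1; have := a0; have := mulr_gt0 a0 la_gt0; lra. Qed.
Let k2_ge1 : (1 <= k2)%R.
Proof. by apply: le_trans k1_ge1 _; rewrite lerDl ltW// mulr_gt0. Qed.

Lemma meet_bound v w t : E v w -> (0 <= t <= 1)%R -> in2B (edge_pt v w t) ->
  (sc v.2 <= Kla * r)%R /\ (dZ z v.1 <= k1 * r)%R.
Proof.
move=> vw t01 tB; have [vv _ _ _ _] := vw; have [s1 s2] := edge_sc vw.
have fx := filling_edge vw t01.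
have h1 : (dens (edge_pt v w t) <= 2 * r * la)%R.
  by rewrite -ler_pdivrMr//; apply: le_trans (dens_j z fx) _; exact: ltW.
have h2 : (sc v.2 <= alpha * dens (edge_pt v w t))%R.
  have := dens_ge_min vw t01; move=> /(ler_wpM2l (ltW a0)); apply: le_trans.
  by rewrite minEle; case: ifP => // _; rewrite ler_peMl ?powR_ge0// ltW.
have h3 : (sc v.2 <= Kla * r)%R.
  apply: le_trans h2 _; rewrite /Kla.
  have -> : (2 * alpha * la * r = alpha * (2 * r * la))%R by ring.
  by rewrite ler_wpM2l// ltW.
split=> //; have /andP[t0 t1] := t01.
have z01 : (0 <= (0 : R) <= 1)%R by rewrite lexx ler01.
have h4 : (dY (iota (edge_pt v w t)) (vpt v) <= Kla * r)%R.
  rewrite -(edge_pt0 _ w); apply: le_trans (dY_edge vw t01 z01) _.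
  rewrite subr0 ger0_norm// -[leRHS]mul1r; apply: ler_pM => //.
    by rewrite le_max ltW// dens_gt0.
  rewrite ge_max edge_pt0 dens_vertex// h3 andbT; apply: le_trans h1 _.
  rewrite /Kla; have -> : (2 * alpha * la * r = alpha * (2 * r * la))%R by ring.
  by rewrite ler_peMl ?mulr_ge0// ltW.
have h5 : (dY (vpt v) (j v.1) <= 2 * alpha * r)%R.
  rewrite metric_sym; have := dY_j_near v.1 v.2; rewrite nearvK//= => /le_trans; apply.
  rewrite ler_pdivrMr//; apply: le_trans h3 _.
  by rewrite /Kla le_eqVlt; apply/orP; left; apply/eqP; ring.
have h6 := metric_triangle (j z) (iota (edge_pt v w t)) (j v.1).
have h7 := metric_triangle (iota (edge_pt v w t)) (vpt v) (j v.1).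
rewrite /boundary_dist /k1; have -> : (2 * (1 + alpha * la + alpha) * r =
  2 * r + Kla * r + 2 * alpha * r)%R by rewrite /Kla; ring.
by move: tB; rewrite /= in h4 h5 h6 h7 *; lra.
Qed.

Lemma dens_betaE x : dens_beta x = (dens x `^ beta)%:E.
Proof. by rewrite /dens_beta mulrC -mulNr powRrM. Qed.

Lemma dens_beta_ge v w t : E v w -> (0 <= t <= 1)%R ->
  ((Num.min (sc v.2) (sc w.2)) `^ beta)%:E <= dens_beta (edge_pt v w t).
Proof.
move=> vw t01; rewrite dens_betaE lee_fin ge0_ler_powR ?nnegrE ?dens_ge_min//.
  by rewrite le_min !powR_ge0.
by rewrite ltW ?dens_gt0.
Qed.

Lemma dens_beta_le v w t : E v w -> (0 <= t <= 1)%R ->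
  dens_beta (edge_pt v w t) <= (alpha `^ beta * sc v.2 `^ beta)%:E.
Proof.
move=> vw t01; rewrite dens_betaE lee_fin -powRM ?powR_ge0 ?(ltW a0)//.
rewrite ge0_ler_powR ?nnegrE ?mulr_ge0 ?powR_ge0 ?(ltW a0) ?(ltW (dens_gt0 _))//.
apply: le_trans (dens_le_max vw t01) _; have [_ s2] := edge_sc vw.
by rewrite ge_max s2 andbT ler_peMl ?powR_ge0// ltW.
Qed.

Lemma edge_dens_ge (F : Y -> \bar R) v w d : E v w -> borel_fun F -> (forall x, 0 <= F x) ->
  (0 <= d)%R -> (forall t, (0 <= t <= 1)%R -> d%:E <= dens_beta (edge_pt v w t)) ->
  d%:E * \int[leb]_(t in `[0%R, 1%R]) F (iota (edge_pt v w t)) <=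
  \int[leb]_(t in `[0%R, 1%R]) (dens_beta (edge_pt v w t) * F (iota (edge_pt v w t))).
Proof.
move=> vw mF F0 d0 dl.
have mFe : measurable_fun I01 (fun t => F (iota (edge_pt v w t))).
  exact: (measurableT_comp mF (edge_measurable vw)).
rewrite -ge0_integralZl//; apply: ge0_le_integral => //.
- by move=> t _; rewrite mule_ge0.
- by apply: emeasurable_funM => //; exact: measurable_cst.
- apply: emeasurable_funM => //.
  by apply/measurable_EFinP; exact: edge_height_measurable.
by move=> t; rewrite /= in_itv/= => t01; apply: lee_wpmul2r => //; exact: dl.
Qed.

Let P2 : set (Z * int) := [set v | [/\ vert v, (sc v.2 <= Kla * r)%R & (dZ z v.1 <= k1 * r)%R]].
Let A2 := dball dZ z (k2 * r).

Definition mass_cst := (star_cst * (Kla `^ beta * geom beta))%R.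

Lemma mass_cst_ge0 : (0 < beta)%R -> (0 <= mass_cst)%R.
Proof.
move=> b0; have g0 := geom_gt0 b0; have s0 := star_cst_ge0.
rewrite /mass_cst; apply: mulr_ge0 => //.
by rewrite mulr_ge0 ?powR_ge0// ltW.
Qed.

Lemma half_sub v : P2 v -> (half v `<=` A2)%classic.
Proof.
move=> [_ sv zv] x /dball_dZ_sub; rewrite /A2 /dball/= => h.
apply: le_lt_trans (dZ_triangle v.1 z x) _.
have : (bilip' * alpha * (sc v.2 / 2) <= bilip' * alpha * (Kla * r))%R.
  by rewrite ler_wpM2l ?(ltW bilip'a_gt0)//; have := sc_gt0 v.2; lra.
have -> : (k2 * r = k1 * r + bilip' * alpha * (Kla * r))%R by rewrite /k2; ring.
by lra.
Qed.

Lemma mass_2B (M : Z * int -> \bar R) (m : Z -> \bar R) : (0 < beta)%R ->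
  om_measurable nu m -> (forall x, 0 <= m x) -> (forall v, 0 <= M v) ->
  (forall v x, P2 v -> half v x -> M v <= m x) ->
  \esum_(e in edges) (if e.1 \in P2 then (sc e.1.2 `^ beta)%:E * M e.1 * wt e.1 e.2 else 0) <=
  (mass_cst * r `^ beta)%:E * om_integral nu A2 m.
Proof.
move=> b0 mm m0 M0 Mm.
have [k /andP[k1' k2']] := scale_ex (mulr_gt0 Kla_gt0 r_gt0).
have PL v : P2 v -> (k + 1 <= v.2)%R.
  move=> [_ sv _]; rewrite lezD1 ltNge; apply/negP => vk.
  by have := lt_le_trans k2' (le_trans (sc_homo vk) sv); rewrite ltxx.
apply: le_trans (@mass_le beta P2 (k + 1)%R A2 M m b0 _ PL half_sub (dZ_dball_cara _ _) mm m0 M0 Mm) _.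
  by move=> v [].
apply: lee_wpmul2r; first by apply: integral_ge0 => x _.
have -> : (mass_cst * r `^ beta = star_cst * (Kla `^ beta * r `^ beta * geom beta))%R.
  by rewrite /mass_cst; ring.
rewrite lee_fin ler_wpM2l ?star_cst_ge0// ler_wpM2r ?(ltW (geom_gt0 b0))//.
rewrite -powRM ?(ltW Kla_gt0) ?(ltW r_gt0)//.
by apply: ge0_ler_powR => //; rewrite nnegrE ?powR_ge0// ltW// mulr_gt0.
Qed.

Local Notation hat2B := (dball dY (j z) (2 * r)).
Local Notation nuB := (nu (dball dZ z r)).

Let ind2B (x : Y) : \bar R := (\1_hat2B x)%:E.

Lemma borel_ind2B : borel_fun ind2B.
Proof.
apply/measurable_EFinP; apply: measurable_indic.
by apply: sub_sigma_algebra; exact: mball_open.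
Qed.

Definition mass_cst' := (alpha `^ beta * mass_cst * (Clow * k2 `^ Q))%R.

Lemma mass_ind : (0 < beta)%R ->
  om_integral mu setT ind2B <= (mass_cst' * r `^ beta)%:E * nuB.
Proof.
move=> b0; rewrite (mu_integral borel_ind2B); last by move=> x; rewrite lee_fin.
apply: (@le_trans _ _ (\esum_(e in edges) ((alpha `^ beta)%:E *
    (if e.1 \in P2 then (sc e.1.2 `^ beta)%:E * 1 * wt e.1 e.2 else 0)))).
  apply: le_esum => -[v w] /= vw; have {}vw : E v w := vw.
  case: ifPn => vP.
    rewrite mule1 muleA -EFinM [leRHS]muleC; apply: lee_wpmul2l; first exact: wt_ge0.
    apply: (@le_trans _ _ (\int[leb]_(t in `[0%R, 1%R]) (alpha `^ beta * sc v.2 `^ beta)%:E)).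
      apply: ge0_le_integral => //.
      - by move=> t _; rewrite mule_ge0 ?lee_fin ?powR_ge0.
      - apply: emeasurable_funM.
          by apply/measurable_EFinP; exact: edge_height_measurable.
        exact: (measurableT_comp borel_ind2B (edge_measurable vw)).
      - move=> t; rewrite /= in_itv/= => t01; rewrite -[leRHS]mule1.
        apply: lee_pmul; [by rewrite lee_fin powR_ge0|by rewrite lee_fin|exact: dens_beta_le|].
        by rewrite lee_fin indicE; case: (_ \in _).
    rewrite integral_cst//= lebesgue_measure_itv/= lte_fin ltr01.
    by rewrite -EFinB subr0 mule1.
  rewrite mule0 integral0_eq ?mule0// => t; rewrite /= in_itv/= => t01.
  rewrite /ind2B indicE memNset ?mule0// => tB; move/negP: vP; apply; apply/mem_set.
  by have [? ?] := meet_bound vw t01 tB; split => //; case: vw.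
apply: le_trans (le_esumZ _ _ _) _; first by rewrite lee_fin powR_ge0.
  move=> e; case: ifP => // _; rewrite mule1 mule_ge0 ?wt_ge0// lee_fin powR_ge0//.
have m1 : om_measurable nu (fun=> 1) by exact: measurable_cst.
have := @mass_2B (fun=> 1) (fun=> 1) b0 m1 (fun=> lee01) (fun=> lee01) (fun _ _ _ _ => lexx _).
rewrite /om_integral integral_cst; last exact: dZ_dball_cara.
rewrite mul1e => h.
apply: le_trans (lee_wpmul2l _ h) _; first by rewrite lee_fin powR_ge0.
have kd := @decay_dbl z k2 r k2_ge1 r_gt0.
apply: (@le_trans _ _ ((alpha `^ beta)%:E * ((mass_cst * r `^ beta)%:E * ((Clow * k2 `^ Q)%:E * nuB)))).
  apply: lee_wpmul2l; first by rewrite lee_fin powR_ge0.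
  by apply: lee_wpmul2l => //; rewrite lee_fin mulr_ge0 ?mass_cst_ge0 ?powR_ge0.
rewrite !muleA -!EFinM; apply: lee_wpmul2r; first exact: outer_measure_ge0.
by rewrite lee_fin /mass_cst' le_eqVlt; apply/orP; left; apply/eqP; ring.
Qed.

(** * Oscillation of [u] at the scale of the ball *)

Variable theta : R.
Hypothesis theta_gt0 : (0 < theta)%R.
Hypothesis theta_lt1 : (theta < 1)%R.
Hypothesis betaE : beta = (p * (1 - theta))%R.
Variables (u g : Y -> \bar R) (y : R).
Hypothesis wug : weak_upper_gradient mu p u g.
Hypothesis gp : om_integral mu setT (fun x => g x `^ p) < +oo.
Hypothesis y_gt0 : (0 < y)%R.
Hypothesis gy : om_integral mu hat2B (fun x => g x `^ p) <= (y `^ p)%:E * nuB.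

Let beta_gt0 : (0 < beta)%R.
Proof. by rewrite betaE mulr_gt0// subr_gt0. Qed.

Let mg : borel_fun g. Proof. by case: wug. Qed.
Let g_ge0 x : 0 <= g x. Proof. by case: wug. Qed.

Let g1 : Y -> \bar R := g \_ hat2B.

Let g1_ge0 x : 0 <= g1 x. Proof. by rewrite /g1 patchE; case: ifP. Qed.

Let mg1 : borel_fun g1.
Proof.
apply: (proj1 (@measurable_restrictT _ _ (borel Y) _ hat2B g _)).
  by apply: sub_sigma_algebra; exact: mball_open.
exact: measurable_funTS.
Qed.

Let g1E x : hat2B x -> g1 x = g x.
Proof. by move=> xB; rewrite /g1 patchE mem_set. Qed.

Let g1pE : (fun x => g1 x `^ p) = (fun x => g x `^ p) \_ hat2B.
Proof.
apply/funext => x; rewrite /g1 !patchE; case: ifP => // _.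
by rewrite poweR_EFin powR0// gt_eqF.
Qed.

Let V := fine nuB.

Let nuBE : nuB = V%:E.
Proof.
by have /andP[/ltW ? ?] := dZ_ball_pos_fin z r_gt0; rewrite /V fineK// ge0_fin_numE.
Qed.

Let V_gt0 : (0 < V)%R.
Proof. by have := dZ_ball_pos_fin z r_gt0; rewrite nuBE lte_fin => /andP[]. Qed.

Let g1_int : om_integral mu setT (fun x => g1 x `^ p) <= (y `^ p * V)%:E.
Proof. by move: gy; rewrite nuBE g1pE /om_integral [X in X <= _ -> _]integral_mkcond. Qed.

(** Balances the two terms of [F]: by [c0p] both integrals are of order c0 r^beta nu(B). *)
Let c0 := (y * r `^ (theta - 1))%R.

Let c0_gt0 : (0 < c0)%R. Proof. by rewrite mulr_gt0// powR_gt0. Qed.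

Let c0p : (c0 `^ (1 - p) * y `^ p = c0 * r `^ beta)%R.
Proof.
rewrite powRB; last by rewrite (gt_eqF c0_gt0) implybT.
rewrite powRr1 ?(ltW c0_gt0)// {2}/c0 powRM ?powR_ge0 ?(ltW y_gt0)//.
rewrite -powRrM -[in (_ * p)%R]opprB mulNr powRN [((1 - theta) * p)%R]mulrC -betaE.
by field; rewrite !gt_eqF ?powR_gt0.
Qed.

(** Majorizes [g] on 2 hatB by Young's inequality. Its integral is bounded linearly, so
    contributions of distinct edges add up without a count of the edges. *)
Let F x : \bar R := c0%:E * ind2B x + (c0 `^ (1 - p))%:E * g1 x `^ p.

Let ind_ge0 x : 0 <= ind2B x. Proof. by rewrite lee_fin. Qed.

Let F_ge0 x : 0 <= F x.
Proof.
by rewrite adde_ge0// mule_ge0 ?poweR_ge0 ?lee_fin ?powR_ge0// ltW.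
Qed.

Let mF : borel_fun F.
Proof.
apply: emeasurable_funD; apply: emeasurable_funM; do ?exact: measurable_cst.
  exact: borel_ind2B.
exact: borel_pow.
Qed.

Let gF x : hat2B x -> g x <= F x.
Proof.
move=> xB; apply: le_trans (young c0_gt0 (g_ge0 x)) _.
by rewrite /F /ind2B indicE mem_set// mule1 g1E.
Qed.

Definition path_cst' := (1 + mass_cst')%R.

Let F_int : om_integral mu setT F <= (c0 * path_cst' * r `^ beta * V)%:E.
Proof.
have m1 : om_measurable mu ind2B := om_measurable_sigma borel_cara_mu borel_ind2B.
have m2 : om_measurable mu (fun x => g1 x `^ p) := om_measurable_sigma borel_cara_mu (borel_pow mg1).
have mT : mu.-caratheodory setT by exact: (@measurableT _ (caratheodory_type mu)).
rewrite /F (om_integral_lin mT) ?powR_ge0 ?(ltW c0_gt0)//; last by move=> x; exact: poweR_ge0.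
apply: (@le_trans _ _ (c0%:E * ((mass_cst' * r `^ beta)%:E * V%:E) +
  (c0 `^ (1 - p))%:E * (y `^ p * V)%:E)).
  apply: leeD; apply: lee_wpmul2l; rewrite ?lee_fin ?powR_ge0 ?(ltW c0_gt0)//.
  by rewrite -nuBE; exact: mass_ind.
rewrite -!EFinM -EFinD lee_fin [(c0 `^ _ * _)%R]mulrA c0p.
by rewrite le_eqVlt /path_cst'; apply/orP; left; apply/eqP; ring.
Qed.

Let uv := uval u.
Let Phi v w := wt v w * \int[leb]_(t in `[0%R, 1%R])
  (dens_beta (edge_pt v w t) * F (iota (edge_pt v w t))).

Let Phi_ge0 v w : 0 <= Phi v w.
Proof.
rewrite mule_ge0 ?wt_ge0// integral_ge0// => t _.
by rewrite mule_ge0// lee_fin powR_ge0.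
Qed.

(** A path without repeated vertices uses each oriented edge at most once, so its terms form a part
    of the sum over all edges. *)
Let path_Phi v s : path (fun v w => `[< core v w >]) v s -> uniq (v :: s) ->
  \sum_(e <- zip (v :: s) s) Phi e.1 e.2 <= om_integral mu setT F.
Proof.
move=> ps us; rewrite (mu_integral mF F_ge0).
have uz : uniq (zip (v :: s) s) by apply: zip_uniqr; case/andP: us.
rewrite (fsbig_seq _ _ uz); apply: ereal_sup_ubound; exists [set` zip (v :: s) s] => //.
split; first exact: finite_seq.
move=> [a b] /=; elim: s v ps {us uz} => [|x s IH] v //= /andP[/asboolP[vx _ _ _] ps].
by rewrite inE => /orP[/eqP[-> ->]//|]; exact: IH.
Qed.

Let rho := (alpha * bilip' * alpha `^ depth%:R)%R.
Let rho_gt0 : (0 < rho)%R.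
Proof. by apply: mulr_gt0; [rewrite mulr_gt0// bilip'_gt0|rewrite powR_gt0]. Qed.

Let sc_n1_ge : (r / rho <= sc n1)%R.
Proof.
rewrite ler_pdivrMr// (_ : sc n1 * rho = alpha * bilip' * sc n0)%R ?ltW//.
by rewrite /rho sc_n0E; ring.
Qed.

Let sc_n1_le : (sc n1 <= r)%R.
Proof.
apply: (@le_trans _ _ (sc n0)); first by rewrite sc_homo// lerDl.
by apply: le_trans n0_le; rewrite ler_peMl ?powR_ge0 ?bilip'_ge1.
Qed.

Definition low_cst := (Clow * ((k1 + 1) * bilip * rho) `^ Q)%R.

Lemma low_cst_gt0 : (0 < low_cst)%R.
Proof.
apply: mulr_gt0 => //; rewrite powR_gt0// mulr_gt0// mulr_gt0 ?bilip_gt0//.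
by have := k1_ge1; lra.
Qed.

(** The projection of [v] is within k1 r of [z], and its vball contains a ball of radius sc n1,
    which is comparable to [r]; [ball_lower] applies. *)
Lemma core_wt v w : E v w -> (v.2 <= n1)%R -> in2B (vertex_pt v) ->
  (V / low_cst)%:E <= wt v w.
Proof.
move=> vw v1 vB.
have t0 : (0 <= (0 : R) <= 1)%R by rewrite lexx ler01.
have [_ zv] : (sc v.2 <= Kla * r)%R /\ (dZ z v.1 <= k1 * r)%R.
  by apply: (meet_bound vw t0); rewrite edge_pt0.
have k10 := le_trans ler01 k1_ge1.
have := @ball_lower z r k1 v.1 (sc n1) r_gt0 k10 zv (sc_gt0 _).
have c1 : (1 <= (k1 + 1) * bilip)%R.
  by apply: mulr_ege1; [lra|exact: bilip_ge1].
have c10 := lt_le_trans ltr01 c1.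
have -> : (sc n1 <= (k1 + 1) * bilip * r)%R.
  by apply: le_trans sc_n1_le _; rewrite ler_peMl// ltW.
move=> /(_ isT); rewrite nuBE => h.
rewrite EFinM muleC lee_pdivrMl ?low_cst_gt0//.
apply: (le_trans h); apply: lee_pmul.
- by rewrite lee_fin mulr_ge0 ?powR_ge0// ltW.
- exact: outer_measure_ge0.
- rewrite lee_fin /low_cst ler_pM2l// ge0_ler_powR ?nnegrE ?(ltW Q_gt0)//.
  + by rewrite divr_ge0 ?powR_ge0// mulr_ge0// ltW.
  + by rewrite mulr_ge0// ltW.
  rewrite -mulrA ler_pM2l// ler_pdivrMr ?sc_gt0// mulrC -ler_pdivrMr//.
- rewrite /wt; apply: (@le_trans _ _ (nu (vball alpha tau v))).
    rewrite vball_dball; apply: le_outer_measure => x; rewrite /dball/= => h'.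
    by apply: lt_sc_tau; apply: lt_le_trans h' _; rewrite sc_homo.
  by rewrite leeDl// outer_measure_ge0.
Qed.

Definition path_cst : R :=
  (alpha * Kla * path_cst' * low_cst * rho `^ beta)%R.

(** On a core edge the density of [mu] is at least V / low_cst times (r / rho)^beta, so the plain
    integral over the edge is controlled by the weighted one. *)
Let core_edge v w : core v w ->
  (V / low_cst * (r / rho) `^ beta)%:E * (`|uv (vertex_pt v) - uv (vertex_pt w)|%R)%:E <=
  (alpha * (Kla * r))%:E * Phi v w.
Proof.
move=> [vw v1 w1 vwB].
have t0 : (0 <= (0 : R) <= 1)%R by rewrite lexx ler01.
have vB : in2B (vertex_pt v) by rewrite -(edge_pt0 _ w); exact: vwB.
have [sv _] : (sc v.2 <= Kla * r)%R /\ (dZ z v.1 <= k1 * r)%R.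
  by apply: (meet_bound vw t0); rewrite edge_pt0.
have h := uval_edge wug gp vw (lexx 0%R) ler01 (lexx 1%R).
rewrite edge_pt0 edge_pt1 in h.
set J := \int[leb]_(r in _) _ in h.
have mFe : measurable_fun I01 (fun t => F (iota (edge_pt v w t))).
  exact: (measurableT_comp mF (edge_measurable vw)).
have JF : J <= \int[leb]_(t in `[0%R, 1%R]) F (iota (edge_pt v w t)).
  apply: ge0_le_integral => //.
  - exact: (measurableT_comp mg (edge_measurable vw)).
  - by move=> t; rewrite /= in_itv/= => t01; apply: gF; exact: vwB.
have J0 : 0 <= J by apply: integral_ge0 => t _; exact: g_ge0.
set JJ := \int[leb]_(t in _) _ in JF.
have {}h : (`|uv (vertex_pt v) - uv (vertex_pt w)|%R)%:E <= (alpha * (Kla * r))%:E * JJ.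
  apply: (le_trans h); apply: lee_pmul => //; rewrite lee_fin ?mulr_ge0 ?powR_ge0 ?(ltW a0)//.
  by rewrite ler_wpM2l// ltW.
have k0 : (0 <= V / low_cst * (r / rho) `^ beta)%R.
  by rewrite mulr_ge0 ?powR_ge0// divr_ge0 ?ltW ?low_cst_gt0.
apply: le_trans (lee_wpmul2l _ h) _; first by rewrite lee_fin.
rewrite muleCA; apply: lee_wpmul2l.
  by rewrite lee_fin !mulr_ge0 ?ltW.
rewrite EFinM -muleA; apply: lee_pmul.
- by rewrite lee_fin divr_ge0 ?ltW ?low_cst_gt0.
- by rewrite mule_ge0 ?lee_fin ?powR_ge0// integral_ge0.
- exact: core_wt.
apply: edge_dens_ge => //; first exact: powR_ge0.
move=> t t01; apply: le_trans (dens_beta_ge vw t01).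
rewrite lee_fin ge0_ler_powR ?nnegrE//.
- by rewrite divr_ge0// ltW.
- by rewrite le_min !powR_ge0.
by apply: le_trans sc_n1_ge _; rewrite le_min !sc_homo.
Qed.

Lemma conn_uval v w : conn v w ->
  (`|uv (vertex_pt v) - uv (vertex_pt w)| <= path_cst * y * r `^ theta)%R.
Proof.
(* The path is made simple, as [path_Phi] requires. *)
move=> [s ps <-]; case: (shortenP ps) => {ps}s' ps us _.
set kap := (V / low_cst * (r / rho) `^ beta)%R.
have kap0 : (0 < kap)%R.
  by rewrite mulr_gt0 ?powR_gt0 ?divr_gt0 ?low_cst_gt0.
have H : kap%:E * (`|uv (vertex_pt v) - uv (vertex_pt (last v s'))|%R)%:E <=
    (alpha * (Kla * r))%:E * \sum_(e <- zip (v :: s') s') Phi e.1 e.2.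
  elim: s' v ps {us} => [|x s' IH] v /=; first by rewrite subrr normr0 mule0 big_nil mule0.
  move=> /andP[/asboolP vx ps]; rewrite big_cons ge0_muleDr//; last first.
    by apply: sume_ge0 => e _; exact: Phi_ge0.
  apply: le_trans (leeD (core_edge vx) (IH x ps)); rewrite -/kap.
  rewrite -!EFinM -EFinD lee_fin -mulrDr ler_pM2l//.
  exact: ler_distD.
have {}H : kap%:E * (`|uv (vertex_pt v) - uv (vertex_pt (last v s'))|%R)%:E <=
    (alpha * (Kla * r))%:E * (c0 * path_cst' * r `^ beta * V)%:E.
  apply: (le_trans H); apply: lee_wpmul2l; first by rewrite lee_fin !mulr_ge0 ?ltW.
  exact: le_trans (path_Phi ps us) F_int.
move: H; rewrite -!EFinM lee_fin -ler_pdivlMl// => /le_trans; apply.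
rewrite le_eqVlt; apply/orP; left; apply/eqP.
have rr : (r `^ theta = r * r `^ (theta - 1))%R.
  by rewrite -[X in (X * _)%R]powRr1 ?(ltW r_gt0)// -powRD ?subrKC// (gt_eqF r_gt0) implybT.
have e : ((r / rho) `^ beta = r `^ beta / rho `^ beta)%R.
  by rewrite powRM ?invr_ge0 ?(ltW r_gt0) ?(ltW rho_gt0)// powRV// ltW.
rewrite rr /kap e /path_cst /c0.
have l0 := low_cst_gt0.
by field; rewrite !gt_eqF ?powR_gt0.
Qed.

(** * Oscillation of [u] along vertical edges *)

Hypothesis ptQ : (p * theta < Q)%R.

Let g1p x : \bar R := g1 x `^ p.
Let g1p_ge0 x : 0 <= g1p x. Proof. exact: poweR_ge0. Qed.
Let mg1p : borel_fun g1p. Proof. exact: borel_pow. Qed.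

Let G v w := wt v w * \int[leb]_(t in `[0%R, 1%R])
  (dens_beta (edge_pt v w t) * g1p (iota (edge_pt v w t))).

Let G_ge0 v w : 0 <= G v w.
Proof.
rewrite mule_ge0 ?wt_ge0// integral_ge0// => t _.
by rewrite mule_ge0// lee_fin powR_ge0.
Qed.

Let G_sum : \esum_(e in edges) G e.1 e.2 <= (y `^ p * V)%:E.
Proof. by apply: le_trans g1_int; rewrite (mu_integral mg1p g1p_ge0). Qed.

Let G_le v w : E v w -> G v w <= (y `^ p * V)%:E.
Proof.
move=> vw; apply: le_trans G_sum; apply: ereal_sup_ubound.
exists [set (v, w)]; last by rewrite fsbig_set1.
by split => // e ->.
Qed.

Let vb (v : Z * int) : set Z := vball alpha tau v.
Let nvb (v : Z * int) := fine (nu (vb v)).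

Let nvbE v : nu (vb v) = (nvb v)%:E.
Proof. by have /andP[/ltW ? ?] := vball_pos_fin v; rewrite /nvb fineK// ge0_fin_numE. Qed.

Let nvb_gt0 v : (0 < nvb v)%R.
Proof. by have := vball_pos_fin v; rewrite -/(vb v) nvbE lte_fin => /andP[]. Qed.

Let cara_vb v : nu.-caratheodory (vb v).
Proof. by rewrite /vb vball_dball; exact: dball_cara. Qed.

(* Redistributes the [g ^ p]-mass of each edge over the ball of its first endpoint. *)
Definition spread (a : Z) : \bar R := \esum_(e in edges)
  (((nvb e.1)^-1 * \1_(vb e.1) a)%:E * G e.1 e.2).

Let term_ge0 (v w : Z * int) (a : Z) : 0 <= ((nvb v)^-1 * \1_(vb v) a)%:E * G v w.
Proof. by rewrite mule_ge0// lee_fin mulr_ge0 ?invr_ge0 ?(ltW (nvb_gt0 _)). Qed.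

Lemma spread_ge0 a : 0 <= spread a.
Proof. by apply: esum_ge0 => e _; exact: term_ge0. Qed.

Let term_meas v w : om_measurable nu (fun a => ((nvb v)^-1 * \1_(vb v) a)%:E * G v w).
Proof.
apply: emeasurable_funM; last exact: measurable_cst.
apply/measurable_EFinP; apply: measurable_funM; first exact: measurable_cst.
by apply: measurable_indic; exact: cara_vb.
Qed.

Lemma spread_meas : om_measurable nu spread.
Proof.
apply: (@measurable_fun_esum _ _ (caratheodory_type nu)); first exact: edges_countable.
- by move=> e _; exact: term_meas.
- by move=> e a _; exact: term_ge0.
Qed.

Lemma spread_int : om_integral nu setT spread <= (y `^ p * V)%:E.
Proof.
rewrite /om_integral ge0_integral_esum; first last.
- by move=> e a _; exact: term_ge0.
- by move=> e _; exact: term_meas.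
- exact: edges_countable.
apply: le_trans G_sum; apply: le_esum => e _.
under eq_integral => a _ do rewrite EFinM -muleA.
have n0' : (0 <= (nvb e.1)^-1)%R by rewrite invr_ge0 ltW.
rewrite ge0_integralZl//; last 2 first.
- apply: emeasurable_funM; last exact: measurable_cst.
  by apply/measurable_EFinP; apply: measurable_indic; exact: cara_vb.
- by move=> a _; rewrite mule_ge0// lee_fin.
rewrite ge0_integralZr//; last first.
- by apply/measurable_EFinP; apply: measurable_indic; exact: cara_vb.
rewrite integral_indic//; last exact: cara_vb.
rewrite setIT [X in _ * (X * _)](_ : _ = (nvb e.1)%:E); last exact: nvbE.
by rewrite muleA -EFinM mulVf ?gt_eqF// mul1e.
Qed.

Let spread_ge v w a : E v w -> vb v a -> G v w <= (nvb v)%:E * spread a.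
Proof.
move=> vw va; rewrite -lee_pdivrMl//; apply: ereal_sup_ubound.
exists [set (v, w)]; first by split => // e ->.
by rewrite fsbig_set1 /= indicE mem_set// mulr1.
Qed.

Let J v w := \int[leb]_(t in `[0%R, 1%R]) g1p (iota (edge_pt v w t)).

Let J_ge0 v w : 0 <= J v w. Proof. by apply: integral_ge0 => t _. Qed.

(** Passes from the energy of an edge to the plain mean of g^p on it: the density is at least sc v.2
    / alpha there. *)
Let J_G v w X : E v w -> (0 <= X)%R -> G v w <= wt v w * X%:E ->
  J v w <= (alpha `^ beta * sc v.2 `^ (- beta) * X)%:E.
Proof.
move=> vw X0 GX; have sv := sc_gt0 v.2; have [s1 s2] := edge_sc vw.
have sa : (0 <= sc v.2 / alpha)%R by rewrite divr_ge0 ?powR_ge0// ltW.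
have := @edge_dens_ge g1p v w ((sc v.2 / alpha) `^ beta)%R vw mg1p g1p_ge0 (powR_ge0 _ _).
have H t : (0 <= t <= 1)%R -> ((sc v.2 / alpha) `^ beta)%:E <= dens_beta (edge_pt v w t).
  move=> t01; apply: le_trans (dens_beta_ge vw t01).
  rewrite lee_fin ge0_ler_powR ?nnegrE//; first by rewrite le_min !powR_ge0.
  rewrite le_min ler_pdivrMr// ler_pdivrMr// (mulrC (sc w.2)) s1 andbT.
  by rewrite ler_peMr ?powR_ge0// ltW.
move=> /(_ H) h.
have wf := wt_fin v w; have /andP[w0 _] := wt_pos_fin v w.
have : wt v w * (((sc v.2 / alpha) `^ beta)%:E * J v w) <= wt v w * X%:E.
  by apply: le_trans GX; apply: lee_wpmul2l => //; exact: wt_ge0.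
rewrite -(fineK wf) lee_pmul2l//; last first.
  by rewrite lte_fin fine_gt0// w0 ltey_eq wf.
have e : (((sc v.2 / alpha) `^ beta)^-1 = alpha `^ beta * sc v.2 `^ (- beta))%R.
  rewrite powRM ?powR_ge0 ?invr_ge0 ?(ltW a0)// powRV ?(ltW a0)// powRN.
  by rewrite invfM invrK mulrC.
by rewrite -lee_pdivlMl ?powR_gt0 ?divr_gt0// e -EFinM.
Qed.

(** Absorbs the constant of the volume decay into the base of the power with exponent [Q]. *)
Let Lam := (Clow `^ Q^-1 * (k1 + 1) * bilip)%R.

Let Lam_ge1 : (1 <= Lam)%R.
Proof.
apply: mulr_ege1; last exact: bilip_ge1.
apply: mulr_ege1; last by have := k1_ge1; lra.
have e : (1 `^ Q^-1 = 1 :> R)%R by rewrite powR1.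
rewrite -[leLHS]e; apply: ge0_ler_powR => //; rewrite ?nnegrE ?invr_ge0//.
  exact: ltW.
exact: ltW.
Qed.

Let Lam_gt0 : (0 < Lam)%R. Proof. exact: lt_le_trans Lam_ge1. Qed.

(** The bound for coarse levels: the edge has at most the total energy y^p nu(B), and nu(B) is at
    most (Lam r / sc v.2)^Q times the weight of the edge. *)
Let J_far v w : E v w -> (dZ z v.1 <= k1 * r)%R -> (sc v.2 <= r)%R ->
  J v w <= (alpha `^ beta * sc v.2 `^ (- beta) * (y `^ p * (Lam * r / sc v.2) `^ Q))%:E.
Proof.
move=> vw zv sr; have sv := sc_gt0 v.2.
have k10 := le_trans ler01 k1_ge1.
apply: J_G => //; first by rewrite mulr_ge0 ?powR_ge0.
apply: le_trans (G_le vw) _; rewrite [X in _ <= _ * X]EFinM muleCA EFinM.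
apply: lee_wpmul2l; first by rewrite lee_fin powR_ge0.
have sk : (sc v.2 <= (k1 + 1) * bilip * r)%R.
  apply: (le_trans sr); rewrite ler_peMl ?(ltW r_gt0)//.
  by apply: mulr_ege1; [lra|exact: bilip_ge1].
have := @ball_lower z r k1 v.1 (sc v.2) r_gt0 k10 zv sv sk.
rewrite -nuBE muleC => /le_trans; apply; apply: lee_pmul.
- exact: outer_measure_ge0.
- by rewrite lee_fin mulr_ge0 ?powR_ge0// ltW.
- rewrite /wt; apply: (@le_trans _ _ (nu (vball alpha tau v))).
    by rewrite vball_dball; apply: le_outer_measure => x; exact: lt_sc_tau.
  by rewrite leeDl// outer_measure_ge0.
have b0 := bilip_gt0.
have k1' : (0 <= (k1 + 1) * bilip)%R by rewrite mulr_ge0 ?(ltW b0)//; lra.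
rewrite lee_fin le_eqVlt; apply/orP; left; apply/eqP.
have -> : (Lam * r / sc v.2 = Clow `^ Q^-1 * ((k1 + 1) * bilip * r / sc v.2))%R.
  by rewrite /Lam; ring.
rewrite powRM ?powR_ge0//; last by rewrite divr_ge0 ?powR_ge0// mulr_ge0// ltW.
by rewrite -powRrM mulVf ?gt_eqF// powRr1 // ltW.
Qed.

(** Young's inequality with [c] of the order of the [p]-th root of the mean of g^p yields Hölder's
    inequality up to a constant. *)
Let holder v w c C : E v w -> (0 < c)%R -> (0 <= C)%R -> J v w <= (C * c `^ p)%:E ->
  \int[leb]_(t in `[0%R, 1%R]) g1 (iota (edge_pt v w t)) <= ((1 + C) * c)%:E.
Proof.
move=> vw c0' C0 JC; apply: le_trans (edge_young vw mg1 g1_ge0 c0') _.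
have := lee_wpmul2l (_ : 0 <= (c `^ (1 - p))%:E) JC.
rewrite lee_fin powR_ge0 => /(_ isT) h.
apply: le_trans (leeD (lexx _) h) _; rewrite -EFinM -EFinD lee_fin.
rewrite mulrCA -powRD; last by rewrite (gt_eqF c0') implybT.
by rewrite subrK powRr1 ?(ltW c0')// le_eqVlt; apply/orP; left; apply/eqP; ring.
Qed.

(** The rate of decay towards coarse levels, positive exactly when p theta < Q. *)
Let de := (Q / p - theta)%R.

Let de_gt0 : (0 < de)%R.
Proof. by rewrite subr_gt0 ltr_pdivlMr// mulrC. Qed.

(** In terms of x = sc v.2 T / (Lam r), the fine bound is the smaller one for x <= 1 and the coarse
    bound for x >= 1; their minimum, raised to Q / p = theta + de, is the profile. *)
Let edge_profile v w a T : E v w -> vb v a -> (dZ z v.1 <= k1 * r)%R -> (sc v.2 <= r)%R ->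
  (0 < T)%R -> spread a <= (y `^ p * T `^ Q)%:E ->
  (alpha * sc v.2)%:E * \int[leb]_(t in `[0%R, 1%R]) g1 (iota (edge_pt v w t)) <=
  (alpha * (1 + alpha `^ beta) * y * (Lam * r) `^ theta * T `^ de *
    profile theta de (sc v.2 * T / (Lam * r)))%:E.
Proof.
move=> vw va zv sr T0 aT; have sv := sc_gt0 v.2.
have Lr : (0 < Lam * r)%R by rewrite mulr_gt0.
(* The energy of the edge per unit weight is at most y^p T^Q by [spread_ge] and y^p (Lam r / sc
   v.2)^Q by [J_far]; [N] selects the smaller. *)
pose N := Num.min T (Lam * r / sc v.2)%R.
have N0 : (0 < N)%R by rewrite lt_min T0 divr_gt0.
have pp : (p != 0)%R by rewrite gt_eqF.
(* The [p]-th root of the bound for the mean of g^p, up to the factor alpha^beta, as [cp]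
   records. *)
pose c := (y * sc v.2 `^ (theta - 1) * N `^ (Q / p))%R.
have c0' : (0 < c)%R by rewrite !mulr_gt0 ?powR_gt0.
have cp : (c `^ p = y `^ p * (sc v.2 `^ (- beta) * N `^ Q))%R.
  rewrite /c; move: (sc v.2) sv => s s0.
  rewrite powRM ?powR_ge0 ?mulr_ge0 ?powR_ge0 ?(ltW y_gt0)//.
  rewrite powRM ?powR_ge0 ?(ltW y_gt0)// -!powRrM divfK//.
  by rewrite -mulrA (_ : (theta - 1) * p = - beta)%R// betaE; ring.
have Jc : J v w <= (alpha `^ beta * c `^ p)%:E.
  rewrite cp /N; case: (leP T (Lam * r / sc v.2)%R) => h.
    apply: le_trans (J_G vw (_ : 0 <= y `^ p * T `^ Q)%R _) _.
    - by rewrite mulr_ge0 ?powR_ge0.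
    - apply: le_trans (spread_ge vw va) _; apply: lee_pmul => //.
      + by rewrite lee_fin ltW.
      + exact: spread_ge0.
      + by rewrite -nvbE /wt leeDl// outer_measure_ge0.
    - by rewrite lee_fin le_eqVlt; apply/orP; left; apply/eqP; ring.
  apply: le_trans (J_far vw zv sr) _.
  by rewrite lee_fin le_eqVlt; apply/orP; left; apply/eqP; ring.
have := holder vw c0' (powR_ge0 alpha beta) Jc.
have as0 : 0 <= (alpha * sc v.2)%:E by rewrite lee_fin mulr_ge0 ?(ltW sv)// ltW.
move=> /(lee_wpmul2l as0)/le_trans; apply.
rewrite -EFinM lee_fin le_eqVlt; apply/orP; left; apply/eqP.
set x := (sc v.2 * T / (Lam * r))%R.
have x0 : (0 < x)%R by rewrite divr_gt0// mulr_gt0.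
have NE : (N = T * Num.min 1 x^-1)%R.
  rewrite minr_pMr ?(ltW T0)// mulr1 /N; congr (Num.min _ _).
  by rewrite /x; field; rewrite !gt_eqF.
have sE : (sc v.2 = x * (Lam * r) / T)%R.
  by rewrite /x; field; rewrite !gt_eqF.
have m0 : (0 <= Num.min 1 x^-1)%R by rewrite le_min ler01 invr_ge0 ltW.
have s1 : (sc v.2 * sc v.2 `^ (theta - 1) = sc v.2 `^ theta)%R.
  by rewrite -[X in (X * _)%R]powRr1 ?powR_ge0// -powRD ?subrKC// (gt_eqF sv) implybT.
have sth : (sc v.2 `^ theta = x `^ theta * (Lam * r) `^ theta / T `^ theta)%R.
  have xl : (0 <= x * (Lam * r))%R by apply: mulr_ge0; exact: ltW.
  rewrite {1}sE powRM ?xl ?invr_ge0 ?(ltW T0)//.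
  by rewrite powRM ?(ltW x0) ?(ltW Lr)// powRV// ltW.
have NQ : (N `^ (Q / p) = T `^ theta * T `^ de * (Num.min 1 x^-1) `^ (Q / p))%R.
  rewrite NE powRM ?(ltW T0)//; congr (_ * _)%R.
  by rewrite -powRD ?subrKC// (gt_eqF T0) implybT.
have -> : (alpha * sc v.2 * ((1 + alpha `^ beta) * c) =
  alpha * (1 + alpha `^ beta) * y * (sc v.2 * sc v.2 `^ (theta - 1)) * N `^ (Q / p))%R.
  by rewrite /c; ring.
rewrite s1 sth NQ /profile subrKC.
by field; rewrite gt_eqF ?powR_gt0.
Qed.

Definition ray_cst : R :=
  (alpha * (1 + alpha `^ beta) * Lam `^ theta * profile_cst theta de)%R.

Let n0r : (sc n0 <= r)%R.
Proof. by apply: le_trans n0_le; rewrite ler_peMl ?powR_ge0 ?bilip'_ge1. Qed.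

(** The point [a] at which [spread] is controlled may differ from the foot [b] of the ray. For a
    vertex, [b] is its projection and [a] any point of its half ball; for boundary values, a = b. *)
Lemma ray_edges_sum a b T n : central b -> (0 < T)%R -> spread a <= (y `^ p * T `^ Q)%:E ->
  (forall i : nat, (i < n)%N -> vb (nearv (n0 + i%:Z) b) a) ->
  \sum_(i < n) (alpha * sc (n0 + i%:Z))%:E * \int[leb]_(t in `[0%R, 1%R])
     g1 (iota (edge_pt (nearv (n0 + i%:Z) b) (nearv (n0 + i%:Z + 1) b) t)) <=
  (ray_cst * y * r `^ theta * T `^ de)%:E.
Proof.
move=> cb T0 aT ab.
have Lr : (0 < Lam * r)%R by rewrite mulr_gt0.
pose x0 := (sc n0 * T / (Lam * r))%R.
have x00 : (0 < x0)%R by rewrite divr_gt0// mulr_gt0// sc_gt0.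
apply: (@le_trans _ _ (\sum_(i < n) (alpha * (1 + alpha `^ beta) * y * (Lam * r) `^ theta * T `^ de *
    profile theta de (x0 * alpha `^ (- i%:R)))%:E)).
  apply: lee_sum => i _.
  have vw := edge_nearS (n0 + i%:Z) b.
  have n0i : (n0 <= n0 + i%:Z)%R by rewrite lerDl.
  have n0i' : (n0 <= n0 + i%:Z + 1)%R by rewrite -addrA lerDl.
  have t0 : (0 <= (0 : R) <= 1)%R by rewrite lexx ler01.
  have [_ zv] := meet_bound vw t0 (central_edge cb n0i vw n0i' t0).
  have sr : (sc (n0 + i%:Z) <= r)%R by apply: le_trans n0r; rewrite sc_homo.
  apply: le_trans (edge_profile vw (ab i (ltn_ord i)) zv sr T0 aT) _.
  rewrite le_eqVlt; apply/orP; left; apply/eqP; congr (_ * profile _ _ _)%:E.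
  have -> : (sc (n0 + i%:Z) = sc n0 * alpha `^ (- i%:R))%R.
    rewrite -(pwD alpha_gt1); congr (_ `^ _)%R.
    by rewrite intrD (_ : (i%:Z)%:~R = i%:R :> R)//; ring.
  by rewrite /x0; ring.
rewrite sumEFin lee_fin -mulr_sumr.
have := @profile_sum theta de theta_gt0 de_gt0 x0 n x00.
set Sg := (\sum_(i < n) _)%R => h.
have -> : (ray_cst * y * r `^ theta * T `^ de = alpha * (1 + alpha `^ beta) * y *
    (Lam * r) `^ theta * T `^ de * profile_cst theta de)%R.
  by rewrite /ray_cst (powRM _ (ltW Lam_gt0) (ltW r_gt0)); ring.
rewrite ler_wpM2l// !mulr_ge0 ?powR_ge0 ?(ltW a0) ?(ltW y_gt0)//.
by rewrite addr_ge0// powR_ge0.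
Qed.

Lemma ray_uval a b T n : central b -> (0 < T)%R -> spread a <= (y `^ p * T `^ Q)%:E ->
  (forall i : nat, (i < n)%N -> vb (nearv (n0 + i%:Z) b) a) ->
  (`|uv (vertex_pt (nearv n0 b)) - uv (vertex_pt (nearv (n0 + n%:Z) b))| <=
    ray_cst * y * r `^ theta * T `^ de)%R.
Proof.
move=> cb T0 aT ab; rewrite -lee_fin; apply: le_trans (ray_edges_sum cb T0 aT ab).
move=> {ab aT}; elim: n => [|n IH]; first by rewrite addr0 subrr normr0 big_ord0 lexx.
rewrite big_ord_recr /=; apply: le_trans (leeD IH (lexx _)).
have vw := edge_nearS (n0 + n%:Z) b.
have n0i : (n0 <= n0 + n%:Z)%R by rewrite lerDl.
have n0i' : (n0 <= n0 + n%:Z + 1)%R by rewrite -addrA lerDl.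
have h := uval_edge wug gp vw (lexx 0%R) ler01 (lexx 1%R).
rewrite edge_pt0 edge_pt1 in h.
rewrite [X in _ <= _ + _ * X](_ : _ = \int[leb]_(t in `[0%R, 1%R])
    g (iota (edge_pt (nearv (n0 + n%:Z) b) (nearv (n0 + n%:Z + 1) b) t))); last first.
  apply: eq_integral => t /set_mem; rewrite /= in_itv/= => t01.
  by rewrite g1E//; exact: central_edge.
apply: le_trans (leeD (lexx _) h).
have -> : (n0 + n.+1%:Z = n0 + n%:Z + 1)%R by rewrite -addrA -PoszD addn1.
by rewrite -EFinD lee_fin; exact: ler_distD.
Qed.

Let de_le_Q : (de <= Q)%R.
Proof.
rewrite /de; have : (Q / p <= Q)%R by rewrite ler_pdivrMr// ler_peMr// ltW.
by have := theta_gt0; lra.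
Qed.

Let yp_gt0 : (0 < y `^ p)%R. Proof. by rewrite powR_gt0. Qed.

(** A value of [T] admissible for [spread a] at most [h]. The summand 1 keeps it at least 1, so that
    terms independent of [a] can be absorbed. *)
Definition level (h : R) : R := ((1 + h / y `^ p) `^ Q^-1)%R.

Lemma level_gt0 h : (0 <= h)%R -> (0 < level h)%R.
Proof. by move=> h0; rewrite powR_gt0// ltr_wpDr// divr_ge0// ltW. Qed.

Lemma level_pow h : (0 <= h)%R -> (level h `^ Q = 1 + h / y `^ p)%R.
Proof.
move=> h0; rewrite /level -powRrM mulVf ?gt_eqF// powRr1//.
by rewrite addr_ge0// divr_ge0// ltW.
Qed.

Lemma level_spread h : (0 <= h)%R -> (h <= y `^ p * level h `^ Q)%R.
Proof.
move=> h0; rewrite level_pow// mulrDr mulr1 mulrCA divff ?gt_eqF// mulr1.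
by rewrite lerDr ltW.
Qed.

Lemma level_ge1 h : (0 <= h)%R -> (1 <= level h)%R.
Proof.
move=> h0; have e : (1 `^ Q^-1 = 1 :> R)%R by rewrite powR1.
rewrite -[leLHS]e; apply: ge0_ler_powR; rewrite ?nnegrE ?invr_ge0 ?(ltW Q_gt0)//.
  by rewrite addr_ge0// divr_ge0// ltW.
by rewrite lerDl divr_ge0// ltW.
Qed.

Lemma level_de h : (0 <= h)%R -> (level h `^ de <= 1 + h / y `^ p)%R.
Proof. by move=> h0; rewrite -level_pow// ler_powR// level_ge1. Qed.

Let path_cst_ge0 : (0 <= path_cst)%R.
Proof.
have m0 := mass_cst_ge0 beta_gt0; have l0 := ltW low_cst_gt0.
have m0' : (0 <= path_cst')%R.
  apply: addr_ge0 => //; apply: mulr_ge0; apply: mulr_ge0 => //; do ?exact: powR_ge0.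
  exact: ltW.
by rewrite /path_cst; apply: mulr_ge0; [do 2 (apply: mulr_ge0 => //); exact/ltW/mulr_gt0|exact: powR_ge0].
Qed.

Let ray_cst_ge0 : (0 <= ray_cst)%R.
Proof.
rewrite /ray_cst; apply: mulr_ge0; last first.
  have c2 : (0 <= (alpha `^ de - 1)^-1)%R.
    by rewrite invr_ge0 subr_ge0 -(powRr0 alpha) pw_le// ltW.
  by rewrite /profile_cst; have := geom_gt0 theta_gt0; lra.
by rewrite !mulr_ge0 ?powR_ge0 ?addr_ge0 ?powR_ge0 ?(ltW a0).
Qed.

Let yr_ge0 : (0 <= y * r `^ theta)%R. Proof. by rewrite mulr_ge0 ?powR_ge0// ltW. Qed.

(** A deep vertex is followed along vertical edges to its ancestor at level n0, by [ray_uval]; at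
    the remaining levels core edges alone lead to the central vertex. *)
Lemma vertex_bound v a h : vert v -> inB (vertex_pt v) -> half v a -> (0 <= h)%R ->
  spread a <= h%:E ->
  (`|uv (vertex_pt v) - uv (vertex_pt v0)| <=
   (path_cst + ray_cst) * (y * r `^ theta) * (1 + h / y `^ p))%R.
Proof.
move=> vv vB va h0 ah.
have hy : (1 <= 1 + h / y `^ p)%R by rewrite lerDl divr_ge0// ltW.
have c := conn_uval (conn_sym (conn_flat vv vB)).
have p1 : (path_cst * y * r `^ theta <= path_cst * (y * r `^ theta) * (1 + h / y `^ p))%R.
  rewrite -(mulrA path_cst y) ler_peMr//; exact: mulr_ge0.
have p2 : (0 <= ray_cst * (y * r `^ theta) * (1 + h / y `^ p))%R.
  by apply: mulr_ge0; [exact: mulr_ge0|exact: le_trans ler01 hy].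
rewrite mulrDl mulrDl; move: c; rewrite /flat; case: ifPn => nv c; last by lra.
have nv0 : (n0 <= v.2)%R by apply: le_trans nv; rewrite lerDl.
have [n vn] := int_le_ex nv0.
have cv : central v.1 by exact: central_vertex.
have ab (i : nat) : (i < n)%N -> vb (nearv (n0 + i%:Z) v.1) a.
  move=> ilt; rewrite /vb vball_dball /dball/=.
  apply: le_lt_trans (metric_triangle _ v.1 _) _.
  have s1 := near_lt (n0 + i%:Z) v.1.
  have s2 : (sc v.2 <= sc (n0 + i%:Z))%R.
    by rewrite sc_homo// vn lerD2l lez_nat ltnW.
  have := ler_wpM2r (ltW (sc_gt0 (n0 + i%:Z))) (ltW tau_gt3).
  by move: va; rewrite /dball/=; have := sc_gt0 (n0 + i%:Z); lra.
have aT : spread a <= (y `^ p * level h `^ Q)%:E.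
  by apply: (le_trans ah); rewrite lee_fin; exact: level_spread.
have := ray_uval cv (level_gt0 h0) aT ab; rewrite -vn nearvK// => h3.
have h4 : (ray_cst * y * r `^ theta * level h `^ de <=
    ray_cst * (y * r `^ theta) * (1 + h / y `^ p))%R.
  rewrite -(mulrA ray_cst y); apply: ler_wpM2l; [exact: mulr_ge0|exact: level_de].
apply: le_trans (ler_distD (uv (vertex_pt (nearv n0 v.1))) _ _) _.
rewrite [leRHS]addrC; apply: lerD; last exact: le_trans c p1.
by rewrite distrC; exact: le_trans h3 h4.
Qed.

(** * The mean of [u] over hatB *)

Definition avg_cst' : R :=
  (path_cst + ray_cst + alpha * Kla `^ theta * (1 + alpha `^ beta))%R.

Lemma avg_cst'_ge0 : (0 <= avg_cst')%R.
Proof.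
apply: addr_ge0; first exact: addr_ge0.
apply: mulr_ge0; first by apply: mulr_ge0; [exact: ltW|exact: powR_ge0].
by apply: addr_ge0 => //; exact: powR_ge0.
Qed.

Let edge_bound v w t a h : E v w -> (0 <= t <= 1)%R -> inB (vertex_pt v) ->
  (forall s, (0 <= s <= t)%R -> inB (edge_pt v w s)) -> half v a -> (0 <= h)%R ->
  spread a <= h%:E ->
  (`|uv (edge_pt v w t) - uv (vertex_pt v0)| <=
   avg_cst' * (y * r `^ theta) * (1 + h / y `^ p))%R.
Proof.
move=> vw t01 vB segB va h0 ah; have [vv _ _ _ _] := vw; have /andP[t0 t1] := t01.
have h1 := vertex_bound vv vB va h0 ah.
have sv := sc_gt0 v.2.
have z0 : (0 <= (0 : R) <= 1)%R by rewrite lexx ler01.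
have [svK _] : (sc v.2 <= Kla * r)%R /\ (dZ z v.1 <= k1 * r)%R.
  apply: (meet_bound vw z0); rewrite edge_pt0; apply: lt_trans vB _.
  by rewrite ltr_pMl// ltr1n.
have vba : vb v a.
  rewrite /vb vball_dball; move: va; rewrite /dball/=.
  have := ler_wpM2r (ltW sv) (ltW tau_gt3); have := sv; lra.
pose c := (y * sc v.2 `^ (theta - 1))%R.
have c0' : (0 < c)%R by rewrite mulr_gt0// powR_gt0.
pose C := (alpha `^ beta * (h / y `^ p))%R.
have C0 : (0 <= C)%R by rewrite mulr_ge0 ?powR_ge0// divr_ge0// ltW.
have cp : (c `^ p = y `^ p * sc v.2 `^ (- beta))%R.
  rewrite /c; move: (sc v.2) => s; rewrite powRM ?powR_ge0 ?(ltW y_gt0)// -powRrM.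
  by rewrite (_ : (theta - 1) * p = - beta)%R// betaE; ring.
have JC : J v w <= (C * c `^ p)%:E.
  apply: le_trans (J_G vw h0 _) _.
    apply: le_trans (spread_ge vw vba) _; apply: lee_pmul => //.
    - by rewrite lee_fin ltW.
    - exact: spread_ge0.
    - by rewrite -nvbE /wt leeDl// outer_measure_ge0.
  by rewrite cp /C lee_fin le_eqVlt; apply/orP; left; apply/eqP; field; rewrite gt_eqF.
have hol := holder vw c0' C0 JC.
have := uval_edge wug gp vw (lexx 0%R) t0 t1; rewrite edge_pt0 => ue.
have gint : \int[leb]_(s in `[0%R, t]) g (iota (edge_pt v w s)) <=
    \int[leb]_(s in `[0%R, 1%R]) g1 (iota (edge_pt v w s)).
  rewrite (_ : \int[leb]_(s in `[0%R, t]) g (iota (edge_pt v w s)) =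
    \int[leb]_(s in `[0%R, t]) g1 (iota (edge_pt v w s))); last first.
    apply: eq_integral => s /set_mem; rewrite /= in_itv/= => st; rewrite g1E//.
    by rewrite /dball/=; apply: lt_trans (segB s st) _; rewrite ltr_pMl// ltr1n.
  exact: le_integral_edge.
have as0 : 0 <= (alpha * sc v.2)%:E by rewrite lee_fin mulr_ge0 ?(ltW sv)// ltW.
have {}ue := le_trans ue (lee_wpmul2l as0 (le_trans gint hol)).
rewrite -EFinM lee_fin in ue.
have s1 : (sc v.2 * sc v.2 `^ (theta - 1) = sc v.2 `^ theta)%R.
  by rewrite -[X in (X * _)%R]powRr1 ?powR_ge0// -powRD ?subrKC// (gt_eqF sv) implybT.
have s2 : (sc v.2 `^ theta <= Kla `^ theta * r `^ theta)%R.
  rewrite -powRM ?(ltW Kla_gt0) ?(ltW r_gt0)//.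
  by apply: ge0_ler_powR; rewrite ?nnegrE ?powR_ge0 ?(ltW theta_gt0)// mulr_ge0 ?ltW.
have h2 : (alpha * sc v.2 * ((1 + C) * c) <=
    alpha * Kla `^ theta * (1 + alpha `^ beta) * (y * r `^ theta) * (1 + h / y `^ p))%R.
  have -> : (alpha * sc v.2 * ((1 + C) * c) = alpha * y * (1 + C) * sc v.2 `^ theta)%R.
    by rewrite -s1 /c; ring.
  have C1 : (1 + C <= (1 + alpha `^ beta) * (1 + h / y `^ p))%R.
    rewrite /C; have := powR_ge0 alpha beta; have : (0 <= h / y `^ p)%R by rewrite divr_ge0// ltW.
    by move: (alpha `^ beta)%R (h / y `^ p)%R => A B; nra.
  apply: (@le_trans _ _ (alpha * y * ((1 + alpha `^ beta) * (1 + h / y `^ p)) * (Kla `^ theta * r `^ theta))%R).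
    apply: ler_pM => //; last 2 first.
    - exact: powR_ge0.
    - by rewrite ler_wpM2l// mulr_ge0 ?(ltW a0) ?(ltW y_gt0).
    by apply: mulr_ge0; [apply: mulr_ge0; exact: ltW|exact: addr_ge0].
  by rewrite le_eqVlt; apply/orP; left; apply/eqP; ring.
apply: le_trans (ler_distD (uv (vertex_pt v)) _ _) _.
rewrite addrC (distrC (uv (edge_pt v w t))) /avg_cst' (mulrDl (path_cst + ray_cst)%R).
rewrite (mulrDl ((path_cst + ray_cst) * _)%R); apply: lerD => //.
exact: le_trans ue h2.
Qed.

(** Linear in [spread], so that its integral over [Z] is controlled; it also covers points where
    [spread] is infinite. *)
Definition osc_bound (a : Z) : \bar R :=
  (avg_cst' * (y * r `^ theta))%:E * (1 + (y `^ (- p))%:E * spread a).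

Let edge_osc v w t a : E v w -> (0 <= t <= 1)%R -> inB (vertex_pt v) ->
  (forall s, (0 <= s <= t)%R -> inB (edge_pt v w s)) -> half v a ->
  (`|uv (edge_pt v w t) - uv (vertex_pt v0)|%R)%:E <= osc_bound a.
Proof.
move=> vw t01 vB segB va; rewrite /osc_bound.
have := spread_ge0 a; case e : (spread a) => [h| |]// h0.
  have := edge_bound vw t01 vB segB va h0; rewrite e lexx => /(_ isT).
  have -> : 1 + (y `^ (- p))%:E * h%:E = (1 + h / y `^ p)%:E.
    by rewrite powRN -EFinM mulrC.
  by rewrite -EFinM lee_fin.
have c0' : (0 < avg_cst' * (y * r `^ theta))%R.
  apply: mulr_gt0; last by rewrite mulr_gt0// powR_gt0.
  rewrite /avg_cst' ltr_wpDl ?addr_ge0// mulr_gt0 ?mulr_gt0 ?powR_gt0//.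
  by rewrite ltr_wpDr// powR_ge0.
rewrite [(_)%:E * +oo]gt0_muley ?lte_fin ?powR_gt0// addey//.
by rewrite gt0_muley ?lte_fin// leey.
Qed.

Lemma edge_closed v w : E v w -> closed [set iota (edge_pt v w t) | t in I01].
Proof.
move=> vw; have c := edge_continuous vw.
have -> : [set iota (edge_pt v w t) | t in I01] =
    (fun t => iota (edge_pt v w (clip01 t))) @` I01.
  apply/seteqP; split => _ [t t01 <-]; exists t => //;
    by move: t01; rewrite /= in_itv/= => t01; rewrite clip01_id.
apply: compact_closed; first exact: metric_hausdorff.
apply: continuous_compact; first exact: continuous_subspaceT.
exact: segment_compact.
Qed.

Let osc_ge0 a : 0 <= osc_bound a.
Proof.
rewrite /osc_bound mule_ge0 ?lee_fin//; first by apply: mulr_ge0; [exact: avg_cst'_ge0|].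
by rewrite adde_ge0// mule_ge0 ?lee_fin ?powR_ge0// spread_ge0.
Qed.

Let osc_meas : om_measurable nu osc_bound.
Proof.
apply: emeasurable_funM; first exact: measurable_cst.
apply: emeasurable_funD; first exact: measurable_cst.
by apply: emeasurable_funM; [exact: measurable_cst|exact: spread_meas].
Qed.

(** The bound of [edge_osc] is valid for every point of the half ball. The infimum depends on the
    vertex only and is dominated by [osc_bound] on the half ball, as [packing_sum] demands. *)
Let Mv (v : Z * int) : \bar R := ereal_inf [set osc_bound a | a in half v].

Let Mv_ge0 v : 0 <= Mv v.
Proof. by apply: le_ereal_inf_tmp => _ [a _ <-]; exact: osc_ge0. Qed.

Let Mv_le v a : half v a -> Mv v <= osc_bound a.
Proof. by move=> va; apply: ereal_inf_lbound; exists a. Qed.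

Let hatB := dball dY (j z) r.
Let c1 := uv (vertex_pt v0).

(** The point is reached within hatB from one of the two ends of its edge; the sum covers both
    possibilities. *)
Let edge_Mv v w t : E v w -> (0 <= t <= 1)%R -> inB (edge_pt v w t) ->
  (`|uv (edge_pt v w t) - c1|%R)%:E <= Mv v + Mv w.
Proof.
move=> vw t01 tB; have [vv ww _ _ _] := vw.
have [N NP] := ball_reach (filling_edge vw t01) tB.
have vN := vert_nearv N%:Z z.
have /(reach_pt_rep vw t01) := NP N (leqnn _).
have /andP[t0 t1] := t01.
move=> -[[_ Pv]|[_ Pw]].
  apply: (@le_trans _ _ (Mv v)); last by rewrite leeDl.
  apply: le_ereal_inf_tmp => _ [a va <-]; apply: edge_osc => //.
  by rewrite -(edge_pt0 _ w); apply: Pv; rewrite lexx.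
apply: (@le_trans _ _ (Mv w)); last by rewrite leeDr.
apply: le_ereal_inf_tmp => _ [a wa <-]; rewrite edge_ptC; apply: edge_osc => //.
- exact: edge_sym.
- by apply/andP; split; lra.
- by rewrite -(edge_pt1 v); apply: Pw; rewrite lexx andbT.
- by move=> s /andP[s0 s1]; rewrite edge_ptC; apply: Pw; apply/andP; split; lra.
Qed.

Let Me (e : (Z * int) * (Z * int)) := Mv e.1 + Mv e.2.

(* The infimum over the edges through a point, [+oo] off the filling; this avoids
   proving that [iota] is injective. *)
Let Fn_ex : exists Fn : Y -> \bar R, [/\ borel_fun Fn, (forall x, 0 <= Fn x),
  (forall v w t, E v w -> (0 <= t <= 1)%R -> Fn (iota (edge_pt v w t)) <= Me (v, w)) &
  forall x b, (forall v w t, E v w -> (0 <= t <= 1)%R -> x = iota (edge_pt v w t) ->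
    b <= Me (v, w)) -> b <= Fn x].
Proof.
have [f finj] : exists f : (Z * int) * (Z * int) -> nat, {in edges &, injective f}.
  by have /countable_injP[f finj] := edges_countable; exists f.
pose img (e : (Z * int) * (Z * int)) := [set iota (edge_pt e.1 e.2 t) | t in I01].
(* As [f] is injective, at most one edge has number [k], so [Fk k] is constant on the closed image
   of that edge and +oo elsewhere, hence Borel. The infimum over all [k] is [einfs] from index 0. *)
pose Fk k x := ereal_inf [set Me e | e in [set e | [/\ edges e, f e = k & img e x]]].
have Me0 e : 0 <= Me e by rewrite adde_ge0.
have FkE k : exists2 Ak : set Y, borel_set Ak & exists c, Fk k = fun x => if x \in Ak then c else +oo.
  have [[e ee fe]|nk] := pselect (exists2 e, edges e & f e = k).
    exists (img e).
      by rewrite /borel_set -[img e]setCK; apply: measurableC; apply: sub_sigma_algebra;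
        apply: closed_openC; exact: edge_closed.
    exists (Me e); apply/funext => x; case: ifPn => xe.
      rewrite /Fk (_ : [set Me e0 | e0 in _] = [set Me e]) ?ereal_inf1//.
      apply/seteqP; split => [_ [e' [ee' fe' _] <-]|_ ->].
        by rewrite (finj e' e)// ?fe' ?fe//; exact: mem_set.
      by exists e => //; split => //; exact: set_mem.
    rewrite /Fk (_ : [set Me e0 | e0 in _] = set0) ?ereal_inf0//.
    apply/seteqP; split => // y' [e' [ee' fe' xe'] _].
    have e'e : e' = e by apply: finj; [exact: mem_set|exact: mem_set|rewrite fe'].
    by move/negP: xe; apply; apply/mem_set; rewrite -e'e.
  exists set0; first exact: measurable0.
  exists 0; apply/funext => x; rewrite in_set0 /Fk.
  rewrite (_ : [set Me e0 | e0 in _] = set0) ?ereal_inf0//.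
  by apply/seteqP; split => // y' [e' [ee' fe' _] _]; apply: nk; exists e'.
exists (fun x => einfs (Fk ^~ x) 0%N); split.
- apply: measurable_fun_einfs => k; have [Ak mA [c ->]] := FkE k.
  apply: measurable_fun_ifT; do ?exact: measurable_cst.
  apply: (measurable_fun_bool true); rewrite setTI.
  rewrite (_ : _ @^-1` _ = Ak)//; apply/seteqP; split => x /=; first exact: set_mem.
  exact: mem_set.
- move=> x; apply: le_ereal_inf_tmp => _ [k _ <-]; apply: le_ereal_inf_tmp => _ [e _ <-].
  exact: Me0.
- move=> v w t vw t01; apply: (@le_trans _ _ (Fk (f (v, w)) (iota (edge_pt v w t)))).
    by apply: ereal_inf_lbound; exists (f (v, w)).
  apply: ereal_inf_lbound; exists (v, w) => //; split => //.
  by exists t => //; rewrite /= in_itv.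
- move=> x b H; apply: le_ereal_inf_tmp => _ [k _ <-]; apply: le_ereal_inf_tmp.
  move=> _ [[v w] [vw _ [t t01 tx]] <-]; apply: (H v w t) => //.
Qed.

Hypothesis u_meas : om_measurable mu u.

Let hatB_cara : mu.-caratheodory hatB.
Proof. by apply: borel_cara_mu; exact: mball_open. Qed.

Definition osc_cst : R := (avg_cst' * (Clow * k2 `^ Q + 1))%R.

Let osc_int : om_integral nu A2 osc_bound <= (osc_cst * (y * r `^ theta) * V)%:E.
Proof.
pose K0 := (avg_cst' * (y * r `^ theta))%R.
have K00 : (0 <= K0)%R by apply: mulr_ge0 => //; exact: avg_cst'_ge0.
have -> : osc_bound = (fun a => K0%:E * 1 + (K0 * y `^ (- p))%:E * spread a).
  apply/funext => a; rewrite /osc_bound ge0_muleDr//; last first.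
    by rewrite mule_ge0 ?lee_fin ?powR_ge0// spread_ge0.
  by rewrite muleA -EFinM.
have K1 : (0 <= K0 * y `^ (- p))%R by rewrite mulr_ge0 ?powR_ge0.
rewrite (om_integral_lin (dZ_dball_cara _ _) K00 K1 (measurable_cst _) spread_meas (fun=> lee01) spread_ge0).
have h1 : om_integral nu A2 (fun=> 1) <= (Clow * k2 `^ Q * V)%:E.
  rewrite /om_integral integral_cst; last exact: dZ_dball_cara.
  by rewrite mul1e EFinM -nuBE; exact: decay_dbl.
have h2 : om_integral nu A2 spread <= (y `^ p * V)%:E.
  apply: le_trans spread_int; apply: ge0_subset_integral => //.
  - exact: dZ_dball_cara.
  - exact: spread_meas.
  - by move=> a _; exact: spread_ge0.
apply: (@le_trans _ _ (K0%:E * (Clow * k2 `^ Q * V)%:E + (K0 * y `^ (- p))%:E * (y `^ p * V)%:E)).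
  by apply: leeD; apply: lee_wpmul2l; rewrite ?lee_fin.
rewrite -!EFinM -EFinD lee_fin le_eqVlt; apply/orP; left; apply/eqP.
by rewrite powRN /osc_cst /K0; field; rewrite gt_eqF.
Qed.

Definition dev_cst : R := (alpha `^ beta * (1 + alpha `^ beta) * mass_cst * osc_cst)%R.

Let T1 (e : (Z * int) * (Z * int)) : \bar R :=
  if e.1 \in P2 then (sc e.1.2 `^ beta)%:E * Mv e.1 * wt e.1 e.2 else 0.

Let T1_ge0 e : 0 <= T1 e.
Proof.
by rewrite /T1; case: ifP => // _; rewrite mule_ge0 ?wt_ge0// mule_ge0// lee_fin powR_ge0.
Qed.

(** [mass_2B] handles functions of the first end of an edge; the terms with [Mv e.2] take this form
    after reversal. *)
Let swap (e : (Z * int) * (Z * int)) := (e.2, e.1).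

Let T1_swap : \esum_(e in edges) T1 (swap e) = \esum_(e in edges) T1 e.
Proof.
symmetry; apply: (@reindex_esum _ _ _ edges edges swap T1); split.
- by move=> [v w] vw; exact: edge_sym.
- by move=> [v w] [v' w'] _ _ [-> ->].
- by move=> [v w] vw; exists (w, v) => //; exact: edge_sym.
Qed.

Let T1_sum : \esum_(e in edges) T1 e <=
  (mass_cst * r `^ beta * (osc_cst * (y * r `^ theta) * V))%:E.
Proof.
apply: le_trans (mass_2B beta_gt0 osc_meas osc_ge0 Mv_ge0 (fun v a _ => @Mv_le v a)) _.
rewrite (EFinM (mass_cst * r `^ beta)%R); apply: lee_wpmul2l => //.
by rewrite lee_fin mulr_ge0 ?powR_ge0// mass_cst_ge0.
Qed.

(** The deviation is dominated by [Fn], which on an edge is at most the sum of the constants of its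
    ends; [mass_2B] packs this into an integral of [osc_bound] over [Z]. *)
Lemma dev_int : om_integral mu hatB (fun x => `|u x - c1%:E|) <=
  (dev_cst * (y * r `^ theta) * r `^ beta * V)%:E.
Proof.
have [Fn [mFn Fn0 FnE FnL]] := Fn_ex.
have uE x : fill x -> u (iota x) = (uv x)%:E.
  by move=> fx; rewrite /uv /uval fineK//; exact: (u_fin wug gp).
have dom x : hatB x -> `|u x - c1%:E| <= Fn x.
  move=> xB; apply: FnL => v w t vw t01 xE; rewrite xE uE; last exact: filling_edge.
  by rewrite -EFinB abse_EFin; apply: edge_Mv => //; move: xB; rewrite xE.
pose Fn1 := Fn \_ hatB.
have oB : borel_set hatB by apply: sub_sigma_algebra; exact: mball_open.
have mFn1 : borel_fun Fn1.
  apply: (proj1 (@measurable_restrictT _ _ (borel Y) _ hatB Fn oB)).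
  exact: measurable_funTS.
have Fn10 x : 0 <= Fn1 x by rewrite /Fn1 patchE; case: ifP.
apply: (@le_trans _ _ (om_integral mu setT Fn1)).
  rewrite /Fn1 -om_integral_restrict; apply: om_integral_le => //.
  - exact: om_measurable_dist.
  - exact: (om_measurable_sigma borel_cara_mu).
rewrite (mu_integral mFn1 Fn10).
apply: (@le_trans _ _ (\esum_(e in edges) ((alpha `^ beta)%:E * (T1 e + (alpha `^ beta)%:E * T1 (swap e))))).
  apply: le_esum => -[v w] /= vw; have {}vw : E v w := vw.
  have [[t0 [t01 tB]]|nB] := pselect (exists t0, (0 <= t0 <= 1)%R /\ inB (edge_pt v w t0)); last first.
    rewrite integral0_eq ?mule0//.
      by rewrite mule_ge0 ?lee_fin ?powR_ge0// adde_ge0// mule_ge0// lee_fin powR_ge0.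
    move=> t; rewrite /= in_itv/= => t01; rewrite /Fn1 patchE memNset ?mule0//.
    by move=> tB; apply: nB; exists t.
  have lt2 : (r < 2 * r)%R by rewrite ltr_pMl// ltr1n.
  have Pv : P2 v.
    have [? ?] := meet_bound vw t01 (lt_trans tB lt2).
    by split => //; case: vw.
  have Pw : P2 w.
    have t01' : (0 <= 1 - t0 <= 1)%R by apply/andP; split; lra.
    have wB : in2B (edge_pt w v (1 - t0)) by rewrite -edge_ptC; exact: lt_trans tB lt2.
    have [? ?] := meet_bound (edge_sym vw) t01' wB.
    by split => //; case: vw.
  rewrite /T1/= !mem_set//.
  have Mvw0 : 0 <= Mv v + Mv w by rewrite adde_ge0.
  have -> : wt w v = wt v w by rewrite /wt addeC.
  apply: (@le_trans _ _ (wt v w * ((alpha `^ beta * sc v.2 `^ beta)%:E * (Mv v + Mv w)))).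
    apply: lee_wpmul2l; first exact: wt_ge0.
    rewrite -[leRHS]mule1 -muleA.
    apply: (@le_trans _ _ (\int[leb]_(t in `[0%R, 1%R]) ((alpha `^ beta * sc v.2 `^ beta)%:E * (Mv v + Mv w)))).
      apply: ge0_le_integral => //.
      - by move=> t _; rewrite mule_ge0// lee_fin powR_ge0.
      - apply: emeasurable_funM.
          by apply/measurable_EFinP; exact: edge_height_measurable.
        exact: (measurableT_comp mFn1 (edge_measurable vw)).
      - move=> t; rewrite /= in_itv/= => t01'.
        apply: lee_pmul; [by rewrite lee_fin powR_ge0|by []|exact: dens_beta_le|].
        rewrite /Fn1 patchE; case: ifP => // _; exact: FnE.
    rewrite integral_cst//= lebesgue_measure_itv/= lte_fin ltr01.
    by rewrite -EFinB subr0 muleA.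
  rewrite (EFinM (alpha `^ beta)%R) -(muleA (alpha `^ beta)%:E) (muleCA (wt v w)).
  apply: lee_wpmul2l; first by rewrite lee_fin powR_ge0.
  rewrite mule_factor; first last.
  - by rewrite !mule_ge0// lee_fin powR_ge0.
  - by rewrite mule_ge0// lee_fin powR_ge0.
  apply: lee_wpmul2l; first exact: wt_ge0.
  rewrite (ge0_muleDr _ (Mv_ge0 v) (Mv_ge0 w)); apply: leeD; first exact: lexx.
  rewrite muleA -EFinM; apply: lee_wpmul2r; first exact: Mv_ge0.
  rewrite lee_fin -powRM ?powR_ge0 ?(ltW a0)//.
  apply: ge0_ler_powR; rewrite ?nnegrE ?powR_ge0 ?mulr_ge0 ?powR_ge0 ?(ltW a0) ?(ltW beta_gt0)//.
  by have [] := edge_sc vw.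
have T1s0 e : 0 <= T1 e + (alpha `^ beta)%:E * T1 (swap e).
  by rewrite adde_ge0// mule_ge0// lee_fin powR_ge0.
have ab0 : 0 <= (alpha `^ beta)%:E :> \bar R by rewrite lee_fin powR_ge0.
apply: le_trans (le_esumZ _ ab0 T1s0) _.
rewrite esumD//; last by move=> e _; rewrite mule_ge0.
have h1 := T1_sum; have h2 := le_esumZ edges ab0 (fun e => T1_ge0 (swap e)).
rewrite T1_swap in h2.
apply: le_trans (lee_wpmul2l ab0 (leeD h1 (le_trans h2 (lee_wpmul2l ab0 h1)))) _.
set A := (mass_cst * r `^ beta * (osc_cst * (y * r `^ theta) * V))%R.
rewrite (_ : _ * _ = (alpha `^ beta * (A + alpha `^ beta * A))%R%:E)// lee_fin /A.
by rewrite le_eqVlt; apply/orP; left; apply/eqP; rewrite /dev_cst; ring.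
Qed.

(** By the choice of n0, [r] is less than alpha bilip' sc n0, which is [hat_cst] times the scale of
    level n0 + 2, the deeper end of the edge used in [hatB_mass]. *)
Definition hat_cst : R := (bilip' * alpha `^ 3%:R)%R.

Let hat_cst_gt0 : (0 < hat_cst)%R.
Proof. by rewrite mulr_gt0 ?powR_gt0 ?bilip'_gt0. Qed.

Let hatB_fin : mu hatB < +oo.
Proof.
have o2 : mu.-caratheodory hat2B by apply: borel_cara_mu; exact: mball_open.
apply: (@le_lt_trans _ _ (mu hat2B)).
  apply: le_outer_measure => x; rewrite /hatB /dball/= => /lt_trans; apply.
  by rewrite ltr_pMl// ltr1n.
have := mass_ind beta_gt0; rewrite /om_integral integral_indic// setIT nuBE.
by move=> /le_lt_trans; apply; rewrite -EFinM ltry.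
Qed.

(** The vertical edge over [z] from level n0 + 1 to n0 + 2 lies in hatB and already carries this
    mass. *)
Lemma hatB_mass : (V / low_cst * (r / hat_cst) `^ beta)%:E <= mu hatB.
Proof.
have sn : (0 < sc (n0 + 1))%R by exact: sc_gt0.
have snE := sc_succ n0; have snE' := sc_succ (n0 + 1).
have d1 : (n0 + 1 <= n1)%R.
  rewrite lerD2l lez_nat lt0n; apply/negP => /eqP d0.
  by have := depthP; rewrite d0 powRr0; lra.
have vw := edge_nearS (n0 + 1) z.
have b'1 := bilip'_gt0.
have vwB t : (0 <= t <= 1)%R -> inB (edge_pt (nearv (n0 + 1) z) (nearv (n0 + 1 + 1) z) t).
  move=> /andP[t0 t1].
  apply: le_lt_trans (metric_triangle _ (vpt (nearv (n0 + 1) z)) _) _.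
  rewrite -{2}(edge_pt0 (nearv (n0 + 1) z) (nearv (n0 + 1 + 1) z)).
  rewrite (dY_vertical vw)// edge_pt0 dens_vertex; last exact: vert_nearv.
  have h1 := dY_j_near z (n0 + 1).
  have h2 : ((sc (n0 + 1) - dens (edge_pt (nearv (n0 + 1) z) (nearv (n0 + 1 + 1) z) t)) / la <=
      sc (n0 + 1) / la)%R.
    by rewrite ler_pM2r ?invr_gt0// gerBl ltW// dens_gt0.
  apply: (le_lt_trans (lerD h1 h2)).
  have -> : (sc (n0 + 1) / la + sc (n0 + 1) / la = (2 / la) * sc (n0 + 1))%R by lra.
  apply: (@lt_trans _ _ (bilip' * sc (n0 + 1))%R); first by rewrite ltr_pM2r// /bilip' ltrDl.
  apply: lt_le_trans n0_le; rewrite ltr_pM2l// snE ltr_pMl//.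
have oB : borel_set hatB by apply: sub_sigma_algebra; exact: mball_open.
have mI : borel_fun (fun x => (\1_hatB x)%:E : \bar R).
  by apply/measurable_EFinP; apply: measurable_indic.
have I0 x : 0 <= (\1_hatB x)%:E :> \bar R by rewrite lee_fin.
have e : om_integral mu setT (fun x => (\1_hatB x)%:E) = mu hatB.
  by rewrite /om_integral integral_indic// setIT.
have := mu_edge_ge beta_ge0 vw mI I0; rewrite e => h; apply: le_trans _ h.
rewrite (_ : \int[leb]_(t in _) _ = 1); last first.
  rewrite (_ : \int[leb]_(t in _) _ = \int[leb]_(t in `[0%R, 1%R]) 1).
    by rewrite integral_cst//= lebesgue_measure_itv/= lte_fin ltr01 -EFinB subr0 mule1.
  apply: eq_integral => t /set_mem; rewrite /= in_itv/= => t01.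
  by rewrite indicE mem_set//; exact: vwB.
rewrite mule1 EFinM; apply: lee_pmul.
- by rewrite lee_fin divr_ge0// ltW// low_cst_gt0.
- by rewrite lee_fin powR_ge0.
- apply: core_wt => //=; rewrite -(edge_pt0 _ (nearv (n0 + 1 + 1) z)).
  apply: lt_trans (vwB 0%R _) _; first by rewrite lexx ler01.
  by rewrite ltr_pMl// ltr1n.
rewrite lee_fin (mulrC beta) -mulNr powRrM; apply: ge0_ler_powR; rewrite ?nnegrE ?powR_ge0//.
  by rewrite divr_ge0// ltW.
have -> : (alpha `^ (- ((n0 + 1)%:~R + 1)) = sc (n0 + 1 + 1))%R by rewrite [in RHS]intrD.
rewrite ler_pdivrMr// /hat_cst mulrC -mulrA powR_mulrn ?(ltW a0)//.
rewrite (_ : alpha ^+ 3 * _ = alpha * sc n0)%R; last by rewrite snE snE'; ring.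
by apply: ltW; apply: lt_le_trans n0_gt _; rewrite le_eqVlt; apply/orP; left; apply/eqP; ring.
Qed.

Let hatB_pos_fin : 0 < mu hatB < +oo.
Proof.
rewrite hatB_fin andbT; apply: lt_le_trans hatB_mass.
by rewrite lte_fin mulr_gt0 ?powR_gt0 ?divr_gt0 ?low_cst_gt0.
Qed.

Definition avg_cst : R := (dev_cst * low_cst * hat_cst `^ beta)%R.

Let dev_cst_ge0 : (0 <= dev_cst)%R.
Proof.
have m0 := mass_cst_ge0 beta_gt0; have c0' := avg_cst'_ge0.
apply: mulr_ge0.
  apply: mulr_ge0 => //; apply: mulr_ge0; first exact: powR_ge0.
  by apply: addr_ge0 => //; exact: powR_ge0.
apply: mulr_ge0 => //; apply: addr_ge0 => //.
by apply: mulr_ge0; [exact: ltW|exact: powR_ge0].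
Qed.

Let avg_cst_ge0 : (0 <= avg_cst)%R.
Proof.
apply: mulr_ge0; last exact: powR_ge0.
by apply: mulr_ge0 => //; exact/ltW/low_cst_gt0.
Qed.

Lemma avg_bound : `|average mu hatB u - c1%:E| <= (avg_cst * (y * r `^ theta))%:E.
Proof.
apply: le_trans (average_dist hatB_cara hatB_pos_fin u_meas dev_int) _.
have hE : mu hatB = (fine (mu hatB))%:E.
  by have /andP[? ?] := hatB_pos_fin; rewrite fineK// ge0_fin_numE// ltW.
have := hatB_mass; rewrite hE lee_fin => hm.
have l0 := low_cst_gt0; have rb : (0 < r `^ beta)%R by rewrite powR_gt0.
have rh : (0 < (r / hat_cst) `^ beta)%R by rewrite powR_gt0// divr_gt0.
have m0 : (0 < fine (mu hatB))%R by apply: lt_le_trans hm; rewrite mulr_gt0// divr_gt0.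
rewrite lee_fin ler_pdivrMr//.
apply: (@le_trans _ _ (avg_cst * (y * r `^ theta) * (V / low_cst * (r / hat_cst) `^ beta))%R).
  rewrite powRM ?invr_ge0 ?(ltW r_gt0) ?(ltW hat_cst_gt0)// powRV ?(ltW hat_cst_gt0)//.
  rewrite le_eqVlt; apply/orP; left; apply/eqP; rewrite /avg_cst.
  by field; rewrite !gt_eqF ?powR_gt0.
by apply: ler_wpM2l => //; exact: mulr_ge0.
Qed.

Lemma spread_ae : om_ae nu (fun a => spread a < +oo).
Proof.
have : integrable (nu : set (caratheodory_type nu) -> \bar R) setT
    (spread : caratheodory_type nu -> \bar R).
  apply/integrableP; split; first exact: spread_meas.
  rewrite [X in X < _](_ : _ = om_integral nu setT spread); last first.
    by apply: eq_integral => a _; rewrite gee0_abs ?spread_ge0.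
  by apply: le_lt_trans spread_int _; rewrite ltry.
move=> /(integrable_ae measurableT); apply: filterS => a /(_ Logic.I).
by rewrite ge0_fin_numE ?spread_ge0.
Qed.

Lemma ray_finite b : central b -> spread b < +oo ->
  \sum_(i <oo) (sc (n0 + i%:Z))%:E * \int[leb]_(t in `[0%R, 1%R])
     g (iota (edge_pt (nearv (n0 + i%:Z) b) (nearv (n0 + i%:Z + 1) b) t)) < +oo.
Proof.
move=> cb; have := spread_ge0 b; case e : (spread b) => [h| |]// h0 _.
have bT : spread b <= (y `^ p * level h `^ Q)%:E by rewrite e lee_fin level_spread.
apply: (@le_lt_trans _ _ (ray_cst * y * r `^ theta * level h `^ de)%:E); last exact: ltry.
have I0 v w : 0 <= \int[leb]_(t in `[0%R, 1%R]) g (iota (edge_pt v w t)).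
  by apply: integral_ge0 => t _; exact: g_ge0.
apply: lime_le.
  by apply: is_cvg_nneseries => i _ _; rewrite mule_ge0// lee_fin powR_ge0.
apply: nearW => n.
have bv (i : nat) : (i < n)%N -> vb (nearv (n0 + i%:Z) b) b.
  by move=> _; rewrite /vb vball_dball /dball/=; apply/lt_sc_tau/near_lt.
apply: le_trans (ray_edges_sum cb (level_gt0 h0) bT bv); rewrite big_mkord.
apply: lee_sum => i _.
have n0i : (n0 <= n0 + i%:Z)%R by rewrite lerDl.
have n0i' : (n0 <= n0 + i%:Z + 1)%R by rewrite -addrA lerDl.
rewrite [X in _ <= _ * X](_ : _ = \int[leb]_(t in `[0%R, 1%R])
    g (iota (edge_pt (nearv (n0 + i%:Z) b) (nearv (n0 + i%:Z + 1) b) t))); last first.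
  apply: eq_integral => t /set_mem; rewrite /= in_itv/= => t01.
  by rewrite g1E//; apply: central_edge => //; exact: edge_nearS.
apply: lee_wpmul2r => //; rewrite lee_fin ler_peMl ?powR_ge0//.
exact: ltW.
Qed.

Definition main_cst : R := (path_cst + ray_cst + avg_cst)%R.

Lemma main_cst_ge0 : (0 <= main_cst)%R.
Proof. exact: (addr_ge0 (addr_ge0 path_cst_ge0 ray_cst_ge0) avg_cst_ge0). Qed.

Lemma hat2B_mass : 0 < mu hat2B <= (mass_cst' * r `^ beta * V)%:E.
Proof.
have o2 : mu.-caratheodory hat2B by apply: borel_cara_mu; exact: mball_open.
apply/andP; split.
  have /andP[h _] := hatB_pos_fin; apply: lt_le_trans h _.
  apply: le_outer_measure => x; rewrite /hatB /dball/= => /lt_trans; apply.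
  by rewrite ltr_pMl// ltr1n.
have := mass_ind beta_gt0; rewrite /om_integral integral_indic// setIT nuBE.
by rewrite -EFinM.
Qed.

(** From u(j a) along the ray to level n0, then by core edges to the central vertex, then to the
    mean by [avg_bound]. Since [level h] is at least 1, the last two terms absorb its power. *)
Lemma trace_bound a h : dball dZ z r a -> (0 <= h)%R -> spread a <= h%:E ->
  (forall e, (0 < e)%R -> exists n : nat,
    `|u (j a) - (uv (vertex_pt (nearv (n0 + n%:Z) a)))%:E| <= e%:E) ->
  `|u (j a) - average mu hatB u| <= (main_cst * (y * r `^ theta) * level h `^ de)%:E.
Proof.
move=> aB h0 ah lim; have ca := central_ball aB.
have aT : spread a <= (y `^ p * level h `^ Q)%:E.
  by apply: (le_trans ah); rewrite lee_fin; exact: level_spread.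
have ua : u (j a) \is a fin_num.
  have [n] := lim 1%R ltr01; case: (u (j a)) => //=.
have ab := avg_bound; have af : average mu hatB u \is a fin_num.
  by move: ab; case: (average mu hatB u).
rewrite -(fineK ua) -(fineK af) in lim ab *.
move: (fine (u (j a))) (fine (average mu hatB u)) lim ab => {ua af} ua av lim.
rewrite -!EFinB !abse_EFin !lee_fin => ab.
have L1 : (1 <= level h `^ de)%R.
  by rewrite -[leLHS](powRr0 (level h)) ler_powR ?level_ge1// ltW.
have c1' := conn_uval (conn_ball aB).
have h1 : (`|ua - uv (vertex_pt (nearv n0 a))| <= ray_cst * y * r `^ theta * level h `^ de)%R.
  apply/ler_addgt0Pr => e e0; have [n] := lim e e0.
  rewrite -EFinB abse_EFin lee_fin => un.
  have av' (i : nat) : (i < n)%N -> vb (nearv (n0 + i%:Z) a) a.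
    by move=> _; rewrite /vb vball_dball /dball/=; apply/lt_sc_tau/near_lt.
  have := ray_uval ca (level_gt0 h0) aT av'; rewrite distrC.
  have := ler_distD (uv (vertex_pt (nearv (n0 + n%:Z) a))) ua (uv (vertex_pt (nearv n0 a))).
  by lra.
apply: le_trans (ler_distD (uv (vertex_pt (nearv n0 a))) _ _) _.
apply: le_trans (lerD h1 (ler_distD c1 _ _)) _.
rewrite (distrC _ c1) [X in (_ + (_ + X) <= _)%R]distrC.
apply: le_trans (lerD (lexx _) (lerD c1' ab)) _.
have h2 : (path_cst * y * r `^ theta <= path_cst * (y * r `^ theta) * level h `^ de)%R.
  have -> : (path_cst * y * r `^ theta = path_cst * (y * r `^ theta))%R by rewrite mulrA.
  by have := ler_wpM2l (mulr_ge0 path_cst_ge0 yr_ge0) L1; rewrite mulr1.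
have h3 : (avg_cst * (y * r `^ theta) <= avg_cst * (y * r `^ theta) * level h `^ de)%R.
  by have := ler_wpM2l (mulr_ge0 avg_cst_ge0 yr_ge0) L1; rewrite mulr1.
apply: le_trans (lerD (lexx _) (lerD h2 h3)) _.
by rewrite le_eqVlt /main_cst; apply/orP; left; apply/eqP; ring.
Qed.

End ball.

(** By [ray_gradient] the difference is at most a tail of the convergent series. *)
Lemma ray_limit (u gD : Y -> \bar R) n0 a : upper_gradient u gD ->
  om_integral mu setT (fun x => gD x `^ p) < +oo ->
  \sum_(i <oo) (sc (n0 + i%:Z))%:E * \int[leb]_(t in `[0%R, 1%R])
     gD (iota (edge_pt (nearv (n0 + i%:Z) a) (nearv (n0 + i%:Z + 1) a) t)) < +oo ->
  forall e, (0 < e)%R -> exists n : nat,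
    `|u (j a) - (uval u (vertex_pt (nearv (n0 + n%:Z) a)))%:E| <= e%:E.
Proof.
move=> ug gDp fin e e0; have [_ gD0 _] := ug.
pose f (i : nat) := (sc (n0 + i%:Z))%:E * \int[leb]_(t in `[0%R, 1%R])
     gD (iota (edge_pt (nearv (n0 + i%:Z) a) (nearv (n0 + i%:Z + 1) a) t)).
have f0 i : 0 <= f i.
  by rewrite mule_ge0 ?lee_fin ?powR_ge0//; apply: integral_ge0 => t _; exact: gD0.
have := @nneseries_tail_cvg R f xpredT fin (fun i _ => f0 i).
move=> /fine_cvgP[[N1 _ N1P] /cvgrPdist_lt/(_ e e0)[N2 _ N2P]].
pose n := maxn N1 N2; exists n.
have tf := N1P n (leq_maxl _ _).
have h : (`|fine (\sum_(n <= k <oo) f k)| < e)%R.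
  by have := N2P n (leq_maxr _ _); rewrite /= sub0r normrN.
have <- : u (vpt (nearv (n0 + n%:Z) a)) = (uval u (vertex_pt (nearv (n0 + n%:Z) a)))%:E.
  rewrite /uval fineK//.
  exact: (u_fin (upper_weak_upper_gradient ug) gDp (filling_vertex (vert_nearv _ _))).
apply: le_trans (ray_gradient a (n0 + n%:Z)%R ug) _.
apply: (@le_trans _ _ (\sum_(n <= i <oo) f i)).
  rewrite -(@nneseries_addn _ f n f0); apply: lee_nneseries => [i _ _|i _].
    by rewrite mule_ge0 ?lee_fin ?powR_ge0//; apply: integral_ge0 => t _; exact: gD0.
  by rewrite /f addnC PoszD addrA.
rewrite -(fineK tf) lee_fin; apply: ltW; exact: le_lt_trans (ler_norm _) h.
Qed.

(** * Integration of the pointwise bound over the ball *)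

Section conclusion.
Variables (z : Z) (r : R) (n0 : int) (theta : R) (u g : Y -> \bar R) (y : R) (f : Z -> \bar R).
Hypothesis r_gt0 : (0 < r)%R.
Hypothesis n0_le : (bilip' * sc n0 <= r)%R.
Hypothesis n0_gt : (r < alpha * bilip' * sc n0)%R.
Hypothesis theta_gt0 : (0 < theta)%R.
Hypothesis theta_lt1 : (theta < 1)%R.
Hypothesis betaE : beta = (p * (1 - theta))%R.
Hypothesis ptQ : (p * theta < Q)%R.
Hypothesis wug : weak_upper_gradient mu p u g.
Hypothesis gp : om_integral mu setT (fun x => g x `^ p) < +oo.
Hypothesis y_gt0 : (0 < y)%R.
Hypothesis gy : om_integral mu (dball dY (j z) (2 * r)) (fun x => g x `^ p) <=
  (y `^ p)%:E * nu (dball dZ z r).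
Hypothesis u_dir : dirichlet_space mu p u.
Hypothesis f_meas : om_measurable nu f.
Hypothesis uf : om_ae nu (fun a => u (j a) = f a).

Local Notation B := (dball dZ z r).
Local Notation hatB := (dball dY (j z) r).

(* A weak upper gradient says nothing about an individual ray, hence the genuine
   upper gradient of [u] here. *)
Lemma limit_ae : om_ae nu (fun a => B a -> forall e, (0 < e)%R -> exists n : nat,
  `|u (j a) - (uval u (vertex_pt (nearv (n0 + n%:Z) a)))%:E| <= e%:E).
Proof.
have [_ [gD [ugD [_ gDp]]]] := u_dir; have [mgD gD0 _] := ugD.
have {}gDp : om_integral mu setT (fun x => gD x `^ p) < +oo.
  rewrite (_ : (fun x => gD x `^ p) = (fun x => `|gD x| `^ p))//.
  by apply/funext => x; rewrite gee0_abs.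
have [/[dup] B0 /ltW B0' Bf] : 0 < nu B /\ nu B < +oo by have /andP[] := dZ_ball_pos_fin z r_gt0.
have BE : nu B = (fine (nu B))%:E by rewrite fineK// ge0_fin_numE.
have V0 : (0 < fine (nu B))%R by rewrite -lte_fin -BE.
have [gI0 gI1] : 0 <= om_integral mu setT (fun x => gD x `^ p) /\
    om_integral mu (dball dY (j z) (2 * r)) (fun x => gD x `^ p) <=
    om_integral mu setT (fun x => gD x `^ p).
  split; first by apply: integral_ge0 => x _; exact: poweR_ge0.
  apply: om_integral_subset.
  - by apply: borel_cara_mu; exact: mball_open.
  - exact: (om_measurable_sigma borel_cara_mu (borel_pow mgD)).
  - by move=> x; exact: poweR_ge0.
set I := om_integral mu setT (fun x => gD x `^ p) in gI0 gI1.
have IE : I = (fine I)%:E by rewrite fineK// ge0_fin_numE.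
have I0 : (0 <= fine I)%R by rewrite fine_ge0.
(* The summand 1 keeps [yD] positive when [gD] has no energy; only finiteness matters here, so its
   size is immaterial. *)
pose X := (fine I / fine (nu B) + 1)%R.
have X0 : (0 < X)%R by rewrite ltr_wpDl// divr_ge0// ltW.
pose yD := (X `^ p^-1)%R; have yD0 : (0 < yD)%R by rewrite powR_gt0.
have gyD : om_integral mu (dball dY (j z) (2 * r)) (fun x => gD x `^ p) <=
    (yD `^ p)%:E * nu B.
  apply: (le_trans gI1); rewrite BE IE -EFinM lee_fin /yD -powRrM mulVf ?gt_eqF//.
  by rewrite powRr1 ?(ltW X0)// /X mulrDl divfK ?gt_eqF// lerDl mul1r ltW.
have wugD := upper_weak_upper_gradient ugD.
have sp := spread_ae r_gt0 wugD gyD.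
apply: (om_ae_mono3 _ sp sp sp) => a spa _ _ aB; apply: ray_limit ugD gDp _.
apply: (ray_finite r_gt0 n0_le theta_gt0 betaE wugD yD0 gyD ptQ _ spa).
exact: central_ball.
Qed.

(** Because de * Qs = Q, the [Qs]-th power of [trace_bound] is c^Qs (1 + spread / y^p). The integral
    of [spread] is at most y^p nu(B), whence the factor 2. *)
Lemma deviation_integral Qs : (Qs = Q * p / (Q - p * theta))%R ->
  om_integral nu B (fun a => `|f a - average mu hatB u| `^ Qs) <=
  ((main_cst theta * (y * r `^ theta)) `^ Qs * 2)%:E * nu B.
Proof.
move=> QsE; set c := (main_cst theta * _)%R.
have [u_meas _] := u_dir.
pose de := (Q / p - theta)%R.
have de0 : (0 < de)%R by rewrite subr_gt0 ltr_pdivlMr// mulrC.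
have pQ : (Q - p * theta = p * de)%R by rewrite /de; field; rewrite gt_eqF.
have deQ : (de * Qs = Q)%R by rewrite QsE pQ; field; rewrite !gt_eqF.
have Qs0 : (0 < Qs)%R by rewrite -(pmulr_rgt0 _ de0) deQ.
have c0 : (0 <= c `^ Qs)%R by rewrite powR_ge0.
have yp0 : (0 < y `^ p)%R by rewrite powR_gt0.
have c1 : (0 <= c `^ Qs / y `^ p)%R by rewrite divr_ge0// ltW.
pose sp := spread z r g.
have sp0 a : 0 <= sp a by exact: spread_ge0.
have msp : om_measurable nu sp by exact: spread_meas.
apply: (@le_trans _ _ (om_integral nu B (fun a => (c `^ Qs)%:E * 1 + (c `^ Qs / y `^ p)%:E * sp a))).
  apply: ae_ge0_le_integral.
  - exact: dZ_dball_cara.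
  - by move=> a _; exact: poweR_ge0.
  - apply: (measurableT_comp (@measurable_poweR R Qs)); apply: measurable_funTS.
    exact: om_measurable_dist.
  - by move=> a _; rewrite adde_ge0// mule_ge0// ?lee_fin.
  - apply: measurable_funTS; apply: emeasurable_funD; apply: emeasurable_funM => //;
      exact: measurable_cst.
  have spf := spread_ae r_gt0 wug gy.
  apply: (om_ae_mono3 _ limit_ae uf spf) => a lim ufa spa aB.
  rewrite -ufa.
  have sE : sp a = (fine (sp a))%:E by rewrite fineK// ge0_fin_numE.
  have h0 : (0 <= fine (sp a))%R by rewrite fine_ge0.
  have le1 : sp a <= (fine (sp a))%:E by rewrite -sE.
  have tb := trace_bound r_gt0 n0_le n0_gt theta_gt0 theta_lt1 betaE wug gp y_gt0 gy ptQ u_meas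
    aB h0 le1 (lim aB).
  apply: (@le_trans _ _ ((c * level y (fine (sp a)) `^ de)%:E `^ Qs)).
    apply: gt0_ler_poweR; first exact: ltW.
    - by rewrite in_itv/= abse_ge0 leey.
    - by rewrite in_itv/= leey andbT; apply: le_trans (abse_ge0 _) tb.
    - exact: tb.
  have cc : (0 <= c)%R.
    have := le_trans (abse_ge0 _) tb; rewrite lee_fin -/c pmulr_lge0// powR_gt0//.
    exact: level_gt0.
  rewrite sE poweR_EFin -EFinM lee_fin.
  rewrite powRM ?powR_ge0// -powRrM deQ level_pow//.
  by rewrite le_eqVlt; apply/orP; left; apply/eqP; field; rewrite gt_eqF.
have cB := @dZ_dball_cara z r.
rewrite (om_integral_lin cB c0 c1 (measurable_cst _) msp (fun=> lee01) sp0).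
have BE : nu B = (fine (nu B))%:E.
  by have /andP[/ltW ? ?] := dZ_ball_pos_fin z r_gt0; rewrite fineK// ge0_fin_numE.
have h1 : om_integral nu B (fun=> 1) = nu B.
  by rewrite /om_integral integral_cst// mul1e.
have h2 : om_integral nu B sp <= (y `^ p * fine (nu B))%:E.
  by apply: le_trans (spread_int r_gt0 wug gy); exact: om_integral_subset.
rewrite h1.
apply: le_trans (leeD (lexx _) (lee_wpmul2l (_ : 0 <= (c `^ Qs / y `^ p)%:E) h2)) _.
  by rewrite lee_fin.
rewrite BE -!EFinM -EFinD lee_fin le_eqVlt; apply/orP; left; apply/eqP.
by field; rewrite gt_eqF.
Qed.

End conclusion.

(** * The diameter of the ball and the normalized estimate *)

Section estimate.
Variables (Crev eta theta Qs : R) (z : Z) (r : R) (u g : Y -> \bar R) (f : Z -> \bar R).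
Hypothesis Crev_ge1 : (1 <= Crev)%R.
Hypothesis eta_gt0 : (0 < eta)%R.
Hypothesis rev : reverse_doubling dZ nu Crev eta.
Hypothesis r_gt0 : (0 < r)%R.
Hypothesis theta_gt0 : (0 < theta)%R.
Hypothesis theta_lt1 : (theta < 1)%R.
Hypothesis betaE : beta = (p * (1 - theta))%R.
Hypothesis ptQ : (p * theta < Q)%R.
Hypothesis QsE : Qs = (Q * p / (Q - p * theta))%R.
Hypothesis wug : weak_upper_gradient mu p u g.
Hypothesis g_int : p_integrable mu p setT g.
Hypothesis u_dir : dirichlet_space mu p u.
Hypothesis f_meas : om_measurable nu f.
Hypothesis uf : om_ae nu (fun a => u (j a) = f a).

Local Notation B := (dball dZ z r).
Local Notation hatB := (dball dY (j z) r).
Local Notation hat2B := (dball dY (j z) (2 * r)).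

(** The ratio of radii at which reverse doubling gives the ratio 1/2 of measures. *)
Definition diam_cst : R := ((2 * Crev) `^ (- eta^-1))%R.

Let Crev2 : (0 < 2 * Crev)%R.
Proof. by rewrite mulr_gt0// (lt_le_trans ltr01). Qed.

(** If every point of [B] were closer to [z] than diam_cst r, reverse doubling would give nu(B) <=
    nu(B) / 2. *)
Lemma diam_ge : (diam_cst * r <= diameter dZ B)%R.
Proof.
have d0 : (0 < diam_cst)%R by rewrite powR_gt0.
have d1 : (diam_cst <= 1)%R.
  rewrite /diam_cst -[leRHS](powRr0 (2 * Crev)); apply: ler_powR.
    by move: Crev_ge1; lra.
  by rewrite lerNl oppr0 invr_ge0 ltW.
have dr : (0 < diam_cst * r)%R by rewrite mulr_gt0.
have dr' : (diam_cst * r <= r)%R by rewrite ler_piMl// ltW.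
have [w wB dw] : exists2 w, B w & (diam_cst * r <= dZ z w)%R.
  apply: contrapT => H; have := rev z dr dr'.
  have /andP[] := dZ_ball_pos_fin z r_gt0; have Bsub : nu B <= nu (dball dZ z (diam_cst * r)).
    apply: le_outer_measure => w wB; rewrite /dball/= ltNge; apply/negP => h.
    by apply: H; exists w.
  move: Bsub; case: (nu B) => [W| |]// Bsub; rewrite lte_fin => W0 _.
  rewrite inver gt_eqF// lee_pdivrMr// => /(le_trans Bsub); rewrite -EFinM lee_fin.
  rewrite mulfK ?gt_eqF// /diam_cst -powRrM mulNr mulVf ?gt_eqF// powR_inv1 ?(ltW Crev2)//.
  have Cr0 : (0 < Crev)%R by exact: lt_le_trans Crev_ge1.
  have -> : (Crev * (2 * Crev)^-1 = 2^-1)%R by field; rewrite gt_eqF.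
  by move: W0; lra.
apply: (le_trans dw); apply: ub_le_sup.
  exists (2 * r)%R => _ [a [b [aB bB ->]]].
  have := dZ_triangle z a b; rewrite (dZ_sym a z).
  by move: aB bB; rewrite /dball/=; lra.
exists z, w; split => //.
by rewrite /dball/= /boundary_dist mdistxx.
Qed.

Definition final_cst : R :=
  (main_cst theta * 2 `^ Qs^-1 * mass_cst' `^ p^-1 / diam_cst)%R.

Lemma estimate : average nu B (fun a => `|f a - average mu hatB u| `^ Qs) `^ Qs^-1 <=
  final_cst%:E * (diameter dZ B)%:E * average mu hat2B (fun x => g x `^ p) `^ p^-1.
Proof.
have [mg g0 _] := wug; have [_ gp0] := g_int.
have gp : om_integral mu setT (fun x => g x `^ p) < +oo.
  rewrite (_ : (fun x => g x `^ p) = (fun x => `|g x| `^ p))//.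
  by apply/funext => x; rewrite gee0_abs.
have b0 := bilip'_gt0.
have [n /andP[n1 n2]] := scale_ex (divr_gt0 r_gt0 b0).
pose n0 := (n + 1)%R.
have n0_le : (bilip' * sc n0 <= r)%R by rewrite mulrC -ler_pdivlMr.
have n0_gt : (r < alpha * bilip' * sc n0)%R.
  rewrite -mulrA mulrCA -sc_succ mulrC -ltr_pdivrMr//.
have Qp : (0 < Q - p * theta)%R by rewrite subr_gt0.
have Qs0 : (0 < Qs)%R by rewrite QsE divr_gt0// mulr_gt0.
set I := om_integral mu hat2B (fun x => g x `^ p).
have I0 : 0 <= I by apply: integral_ge0 => x _; exact: poweR_ge0.
have Ifin : I < +oo.
  apply: le_lt_trans gp; apply: om_integral_subset.
  - by apply: borel_cara_mu; exact: mball_open.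
  - exact: (om_measurable_sigma borel_cara_mu (borel_pow mg)).
  - by move=> x; exact: poweR_ge0.
have IE : I = (fine I)%:E by rewrite fineK// ge0_fin_numE.
have fI0 : (0 <= fine I)%R by rewrite fine_ge0.
have [/[dup] B0 /ltW B0' Bf] : 0 < nu B /\ nu B < +oo by have /andP[] := dZ_ball_pos_fin z r_gt0.
have BE : nu B = (fine (nu B))%:E by rewrite fineK// ge0_fin_numE.
have V0 : (0 < fine (nu B))%R by rewrite -lte_fin -BE.
set V := fine (nu B) in BE V0.
pose x0 := ((fine I / V) `^ p^-1)%R.
have x00 : (0 <= x0)%R by exact: powR_ge0.
have gy y : (0 < y)%R -> (x0 <= y)%R -> I <= (y `^ p)%:E * nu B.
  move=> y0 xy; rewrite BE IE -EFinM lee_fin -ler_pdivrMr//.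
  have -> : (fine I / V = x0 `^ p)%R.
    by rewrite /x0 -powRrM mulVf ?gt_eqF// powRr1// divr_ge0// ltW.
  by apply: ge0_ler_powR; rewrite ?nnegrE ?(ltW y0)// ltW.
have y1 : (0 < x0 + 1)%R by rewrite ltr_wpDl.
have y1x : (x0 <= x0 + 1)%R by rewrite lerDl.
have Kge0 : (0 <= main_cst theta)%R.
  by apply: main_cst_ge0.
set K2 := (main_cst theta * 2 `^ Qs^-1 * r `^ theta)%R.
have K20 : (0 <= K2)%R by rewrite !mulr_ge0 ?powR_ge0.
set LHS := _ `^ Qs^-1.
have H y : (0 < y)%R -> (x0 <= y)%R -> LHS <= (K2 * y)%:E.
  move=> y0 xy.
  have := deviation_integral r_gt0 n0_le n0_gt theta_gt0 theta_lt1 betaE ptQ wug gp y0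
    (gy y y0 xy) u_dir f_meas uf QsE.
  set D := om_integral nu B _; set c := (main_cst theta * _)%R => h.
  have c0 : (0 <= c)%R by rewrite !mulr_ge0 ?powR_ge0// ltW.
  have h' : D / nu B <= (c `^ Qs * 2)%:E.
    by rewrite BE inver gt_eqF// lee_pdivrMr// -BE.
  have D0 : 0 <= D / nu B.
    rewrite BE inver gt_eqF// mule_ge0 ?lee_fin ?invr_ge0 ?(ltW V0)//.
    by apply: integral_ge0 => x _; exact: poweR_ge0.
  apply: (@le_trans _ _ ((c `^ Qs * 2)%:E `^ Qs^-1)).
    apply: gt0_ler_poweR; first by rewrite invr_ge0 ltW.
    - by rewrite in_itv/= D0 leey.
    - by rewrite in_itv/= leey andbT (le_trans D0 h').
    - exact: h'.
  rewrite poweR_EFin lee_fin powRM ?powR_ge0// -powRrM divff ?gt_eqF// powRr1//.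
  by rewrite le_eqVlt /c /K2; apply/orP; left; apply/eqP; ring.
(* [H] requires a positive [y]; letting [y] decrease to [x0] also settles the case of zero energy.
   The denominator K2 + 1 avoids a division by 0. *)
have {}H : LHS <= (K2 * x0)%:E.
  apply/lee_addgt0Pr => e e0; pose d := (e / (K2 + 1))%R.
  have K21 : (0 < K2 + 1)%R by rewrite ltr_wpDl.
  have d0 : (0 < d)%R by rewrite divr_gt0.
  apply: le_trans (H (x0 + d)%R _ _) _; [by rewrite ltr_wpDl|by rewrite lerDl ltW|].
  rewrite -EFinD lee_fin mulrDr lerD2l /d mulrCA ler_piMr ?(ltW e0)//.
  by rewrite ler_pdivrMr// mul1r lerDl.
apply: (le_trans H).
have /andP[m0 m1] : 0 < mu hat2B <= (mass_cst' * r `^ beta * V)%:E.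
  by apply: (@hat2B_mass z r n0 r_gt0 n0_le n0_gt theta).
have mE : mu hat2B = (fine (mu hat2B))%:E.
  by rewrite fineK// ge0_fin_numE ?(ltW m0)//; apply: le_lt_trans m1 _; rewrite ltry.
have -> : average mu hat2B (fun x => g x `^ p) = (fine I)%:E / (fine (mu hat2B))%:E.
  by rewrite /average -/I -IE -mE.
rewrite mE in m0 m1.
move: (fine (mu hat2B)) m0 m1 => m; rewrite lte_fin lee_fin => m0 m1.
have -> : (fine I)%:E / m%:E = (fine I / m)%:E by rewrite inver gt_eqF.
rewrite poweR_EFin -!EFinM lee_fin.
have rb : (0 < r `^ beta)%R by rewrite powR_gt0.
have M0 : (0 < mass_cst')%R.
  by have := lt_le_trans m0 m1; rewrite pmulr_lgt0// pmulr_lgt0.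
have d0 : (0 < diam_cst)%R by rewrite powR_gt0.
(* The powers of the radius combine through beta / p = 1 - theta: r^theta r^(1 - theta) = r, which
   [diam_ge] replaces by the diameter. *)
apply: (@le_trans _ _ (final_cst * (diam_cst * r) *
    (fine I / (mass_cst' * r `^ beta * V)) `^ p^-1)%R).
  have -> : (fine I / (mass_cst' * r `^ beta * V) = fine I / V * (mass_cst' * r `^ beta)^-1)%R.
    by field; rewrite !gt_eqF.
  have Mr : (0 <= mass_cst' * r `^ beta)%R by apply: mulr_ge0; exact: ltW.
  rewrite powRM ?invr_ge0 ?divr_ge0 ?(ltW V0)// -/x0 powRV// powRM ?(ltW M0) ?(ltW rb)// -powRrM.
  have -> : (beta * p^-1 = 1 - theta)%R by rewrite betaE mulrAC divff ?mul1r// gt_eqF.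
  have rr : (r = r `^ theta * r `^ (1 - theta))%R.
    rewrite -powRD; last by rewrite (gt_eqF r_gt0) implybT.
    by rewrite subrKC powRr1// ltW.
  rewrite le_eqVlt; apply/orP; left; apply/eqP.
  rewrite [in (diam_cst * r)%R]rr /K2 /final_cst.
  by field; rewrite !gt_eqF ?powR_gt0.
apply: ler_pM.
- by rewrite !mulr_ge0 ?invr_ge0 ?powR_ge0 ?(ltW r_gt0) ?(ltW d0).
- exact: powR_ge0.
- by rewrite ler_wpM2l ?diam_ge// !mulr_ge0 ?invr_ge0 ?powR_ge0.
have mV : (0 < mass_cst' * r `^ beta * V)%R.
  by apply: mulr_gt0 => //; exact: mulr_gt0.
apply: ge0_ler_powR.
- by rewrite invr_ge0 ltW.
- by rewrite nnegrE; apply: divr_ge0 => //; exact: ltW.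
- by rewrite nnegrE; apply: divr_ge0 => //; exact: ltW.
by rewrite ler_wpM2l// lef_pV2 ?posrE.
Qed.

End estimate.

End volume.

End filling.

Theorem proposition7p4 (R : realType)
    (alpha tau Clow Q Crev eta p theta : R)
    (alpha_gt1 : 1 < alpha)
    (tau_gt : Num.max 3 (alpha / (alpha - 1)) < tau)
    (Clow_ge1 : 1 <= Clow) (Q_gt0 : 0 < Q)
    (Crev_ge1 : 1 <= Crev) (eta_gt0 : 0 < eta)
    (p_ge1 : 1 <= p) (theta_gt0 : 0 < theta) (theta_lt1 : theta < 1)
    (ptheta_ltQ : p * theta < Q) :
  let Qs := Q * p / (Q - p * theta) in
  let beta := p * (1 - theta) in
  exists C : R,
  forall (Z : completeMetricType R) (nu : {outer_measure set Z -> \bar R}),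
    borel_regular nu ->
    balls_positive_finite mdist nu ->
    doubling mdist nu ->
  forall S : int -> set Z, filling_net alpha S ->
  forall (Xbar : completeMetricType R) (iota : (Z * int -> R) -> Xbar)
      (j : Z -> Xbar),
    is_completion alpha tau S iota ->
    boundary_identification alpha S iota j ->
  let dZ := boundary_dist j in
  let mu := uniformized_measure alpha tau S iota nu beta in
    relative_lower_volume_decay dZ nu Clow Q ->
    reverse_doubling dZ nu Crev eta ->
  forall (f : Z -> \bar R) (g u : Xbar -> \bar R),
    besov_space dZ nu theta p f ->
    dirichlet_space mu p u ->
    om_ae nu (fun z => u (j z) = f z) ->
    weak_upper_gradient mu p u g ->
    p_integrable mu p setT g ->
  forall (z : Z) (r : R), 0 < r ->
  let B := dball dZ z r in
  let hatB := dball mdist (j z) r in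
  let hat2B := dball mdist (j z) (2 * r) in
  (average nu B (fun x => `|f x - average mu hatB u| `^ Qs) `^ Qs^-1 <=
   C%:E * (diameter dZ B)%:E *
     average mu hat2B (fun x => g x `^ p) `^ p^-1)%E.
Proof.
(* No constant entering [final_cst] refers to the space, the net or the measure, so [C] can be
   chosen before them. *)
move=> Qs beta; exists (final_cst tau alpha_gt1 beta p Clow Q Crev eta theta Qs).
move=> Z nu nu_reg nu_ball _ S netS Y iota j compl jP dZ mu decay rev f g u.
move=> [f_meas _ _] u_dir uf wug g_int z r r_gt0.
have tau_gt3 : 3 < tau by apply: le_lt_trans tau_gt; rewrite le_max lexx.
have beta_ge0 : 0 <= beta by rewrite mulr_ge0 ?subr_ge0 ?(ltW theta_lt1)// (le_trans ler01).
have := @estimate R Z alpha tau S alpha_gt1 tau_gt3 netS Y iota j compl jP nu nu_reg nu_ball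
  beta beta_ge0 p p_ge1 Clow Q Clow_ge1 Q_gt0 decay Crev eta theta Qs z r u g f
  Crev_ge1 eta_gt0 rev r_gt0 theta_gt0 theta_lt1 erefl ptheta_ltQ erefl wug g_int u_dir f_meas uf.
exact.
Qed.
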